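(* Let $\alpha_c := \tfrac13(5\sqrt{10}-13)$ and let $\alpha\in(0,\infty)$. (Fast mixing.) Suppose $\alpha<\alpha_c$ or $\alpha>1$. There exists a constant $C$ so that for all $\varepsilon\in(0,1)$ and all $K$ and $n$ sufficiently large, $t_{\mathrm{mix}}(\varepsilon;\alpha,K,n)\le C\log n$. (Slow mixing.) Suppose $\alpha_c<\alpha<1$. There exists a positive constant $c$ so that for all $\varepsilon\in(0,\tfrac12)$ and all $K$ and $n$ sufficiently large, $t_{\mathrm{mix}}(\varepsilon;\alpha,K,n)\ge e^{cn}$.
   Context: Let $K,n\ge 1$ be integers, $\alpha>0$, $\Omega:=\{0,1,\dots,K\}^n$, and for $x\in\Omega$ let $\varphi(x):=\tfrac1n|\{j\in[n]: x_j=K\}|$ (the proportion of full links). $\mathrm{DAR}_n(\alpha,K)$ denotes the continuous-time Markov chain $X=(X^t)_{t\ge0}$ on $\Omega$ with the following transitions from state $x$: for each $j$ with $x_j<K$, $x_j\to x_j+1$ at rate $\alpha K\bigl(1+2\varphi(x)(1-\varphi(x))\bigr)$; for each $j$, $x_j\to x_j-1$ at rate $x_j$; no other transitions. $\Pi$ denotes its unique invariant distribution, and $$t_{\mathrm{mix}}(\varepsilon;\alpha,K,n):=\inf\bigl\{t\ge0:\max_{x\in\Omega}\|\mathbb{P}_x(X^t\in\cdot)-\Pi\|_{\mathrm{TV}}\le\varepsilon\bigr\}.$$ The constants $C,c$ may depend on $\alpha$ but not on $\varepsilon,K,n$. ''For all $K$ and $n$ sufficiently large'' means: there is $K_0$ such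 that for every $K\ge K_0$ there is $n_0$ (possibly depending on $K$) such that the assertion holds for all $n\ge n_0$; $K_0,n_0$ may depend on the parameters quantified before this phrase. *)

(* Defs.v *)
From mathcomp Require Import all_boot all_order all_algebra.
From mathcomp Require Import all_classical all_reals all_analysis.

Set Implicit Arguments.
Unset Strict Implicit.
Unset Printing Implicit Defensive.

Import Order.TTheory GRing.Theory Num.Theory.
Import numFieldNormedType.Exports.

Local Open Scope classical_set_scope.
Local Open Scope ring_scope.

Definition state (K n : nat) := {ffun 'I_n -> 'I_K.+1}.

Section FiniteChain.
Variables (R : realType) (S : finType).
Implicit Types (mu nu : {ffun S -> R}) (q : S -> S -> R).

(* Only the off-diagonal values of q matter. *)
Definition generator q : 'M[R]_#|S| :=
  \matrix_(i, j) (if i == j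
                  then - \sum_(y | y != enum_val i) q (enum_val i) y
                  else q (enum_val i) (enum_val j)).

(* The law at time t of the chain started at x and jumping from y to z at
   rate q y z: row x of the semigroup exp (t *: generator q), the exponential
   series being summed entrywise. *)
Definition law q (x : S) (t : R) : {ffun S -> R} :=
  [ffun y => limn (series (fun k => t ^+ k / k`!%:R *
    (generator q ^+ k) (enum_rank x) (enum_rank y)))].

Definition invariant_distribution q mu : Prop :=
  [/\ forall x, 0 <= mu x, \sum_x mu x = 1 &
      forall t, 0 <= t -> forall y, \sum_x mu x * law q x t y = mu y].

(* The null function is returned when there is no invariant distribution;
   when q is irreducible there is exactly one. *)
Definition stationary q : {ffun S -> R} :=
  xget [ffun=> 0] [set mu | invariant_distribution q mu].

Definition tv_dist mu nu : R :=
  \big[Num.max/0]_(A : {set S}) `|\sum_(x in A) mu x - \sum_(x in A) nu x|.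

(* Extended-real valued, so that the infimum of the empty set is +oo. *)
Definition mixing_time q (eps : R) : \bar R :=
  ereal_inf [set t%:E | t in [set t : R | 0 <= t /\
    \big[Num.max/0]_(x : S) tv_dist (law q x t) (stationary q) <= eps]].

End FiniteChain.

Section DAR.
Variables (R : realType) (alpha : R) (K n : nat).
Implicit Types x y : state K n.

Definition full_prop x : R := #|[pred j | x j == K :> nat]|%:R / n%:R.

(* Since y j <= K, this forces x j < K. *)
Definition raised_at (j : 'I_n) x y : bool :=
  [forall i, y i == x i + (i == j) :> nat]%N.

Definition dar_rate x y : R :=
  \sum_(j | raised_at j x y)
     alpha * K%:R * (1 + 2 * full_prop x * (1 - full_prop x)) +
  \sum_(j | raised_at j y x) (x j)%:R.

Definition tmix (eps : R) : \bar R := mixing_time dar_rate eps.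

End DAR.

Definition alpha_c (R : realType) : R := (5 * Num.sqrt 10 - 13) / 3.

(* Main.v *)
Require Import Defs.
From mathcomp Require Import all_boot all_order all_algebra.
From mathcomp Require Import all_classical all_reals all_analysis.
From mathcomp Require Import ring lra.

Set Implicit Arguments.
Unset Strict Implicit.
Unset Printing Implicit Defensive.

Import Order.TTheory GRing.Theory Num.Theory.
Import numFieldNormedType.Exports.

Local Open Scope classical_set_scope.
Local Open Scope ring_scope.

(* All estimates are made on semigroups of finite chains, through one comparison
   principle ([sg_super]): a time-dependent function [u] with [L u <= u' + e] on
   average dominates the evolution of its initial value.

   A single link with constant arrival rate [l] is an Erlang loss system; its
   blocking probability tends to [max 0 (1 - 1 / lam)] when [l = lam K] and
   [K -> oo].  As long as the birth rates of the interacting chain are bounded on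
   one side by [l], products over the links of functions evolved by the one-link
   semigroup are supersolutions, hence the occupancy of the links is controlled by
   [n] independent Erlang systems, up to errors exponentially small in [n].

   Fast mixing.  Since [alpha (1 + 2 f (1 - f)) (1 - f)] stays away from 1 on the
   relevant range of [f], iterating this control finitely often confines the
   proportion of full links, from every initial state, near 0 if [alpha < alpha_c]
   and above 4/25 if [alpha > 1].  In that region a synchronous coupling contracts
   a weighted l^1 distance at a rate independent of [K] and [n].

   Slow mixing.  Truncating the birth rates outside a well gives a chain compared
   with an independent system in equilibrium, which leaves the well with
   probability exponentially small in [n].  This applies to a well near 0 and to a
   well above the maximiser [phi_c] of [(1 + 2 f (1 - f)) (1 - f)], and the
   stationary distribution cannot give mass close to 1 to both. *)

(** Links with the birth rate frozen at proportion [f > 0] of full links would settle at the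
    proportion [max 0 (1 - 1 / rate_at alpha f)], which is below [f] exactly when
    [alpha (1 + 2 f (1 - f)) (1 - f) < 1]. On [[0, 1]] the left side has maximum [alpha / alpha_c]
    and equals [alpha] at 0: hence the two thresholds. Products over the links avoid any estimate of
    correlations: the generator multiplies a product by a sum over the links, in which only the
    difference between the true birth rate and [l] survives, times an increment of known sign.
    Confinement may take a time depending on [K], since [n] is large after [K] is fixed and this
    time is then below [log n]; only the contraction rate must be uniform. One full link more or
    less changes the birth rates of all [n] links, and near proportion 0 this can outweigh the
    contraction of the plain distance. Hence the weights for [alpha < alpha_c], and the confinement
    away from 0 for [alpha > 1]. Truncated rates obey their one-sided bound in every state, so that
    the comparison with independent links has no error term and holds for all times. *)

Section ExponentialSeries.
Variable R : realType.
Implicit Types (a b : nat -> R) (t : R).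

(** With [a k = iter k L f x] this is the semigroup of [L] at time [t], so that facts on semigroups
    reduce to facts on sequences of powers. *)
Definition eser a t : R := limn (series (fun k => t ^+ k / k`!%:R * a k)).

Definition geom_bounded a :=
  exists M B : R, [/\ 0 <= M, 0 <= B & forall k, `|a k| <= M * B ^+ k].

Lemma is_cvg_eser a t : geom_bounded a ->
  cvgn (series (fun k => t ^+ k / k`!%:R * a k)).
Proof.
move=> [M [B [M0 B0 aMB]]]; apply: normed_cvg; rewrite /normed_series_of /=.
apply: (@series_le_cvg _ _ (fun k => M * exp_coeff (`|t| * B) k)) => //.
- by move=> k; rewrite mulr_ge0// exp_coeff_ge0// mulr_ge0.
- move=> k; rewrite /exp_coeff /= !normrM normrX exprMn normfV normr_nat.
  rewrite [leRHS](_ : _ = `|t| ^+ k / k`!%:R * (M * B ^+ k)); last by ring.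
  by rewrite ler_wpM2l// divr_ge0// exprn_ge0.
- by apply: is_cvg_seriesZ; exact: is_cvg_series_exp_coeff.
Qed.

Lemma geom_boundedS a : geom_bounded a -> geom_bounded (fun k => a k.+1).
Proof.
move=> [M [B [M0 B0 aMB]]]; exists (M * B), B; split => //; first exact: mulr_ge0.
by move=> k; rewrite (le_trans (aMB _))// exprS mulrA.
Qed.

Lemma geom_boundedD a b :
  geom_bounded a -> geom_bounded b -> geom_bounded (fun k => a k + b k).
Proof.
move=> [M [B [M0 B0 aMB]]] [M' [B' [M'0 B'0 bMB]]].
exists (M + M'), (B + B'); split; [exact: addr_ge0|exact: addr_ge0|move=> k].
rewrite (le_trans (ler_normD _ _))// mulrDl lerD//.
  rewrite (le_trans (aMB _))// ler_wpM2l// lerXn2r// ?nnegrE ?addr_ge0//.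
  by rewrite lerDl.
rewrite (le_trans (bMB _))// ler_wpM2l// lerXn2r// ?nnegrE ?addr_ge0//.
by rewrite lerDr.
Qed.

Lemma geom_boundedZ c a : geom_bounded a -> geom_bounded (fun k => c * a k).
Proof.
move=> [M [B [M0 B0 aMB]]]; exists (`|c| * M), B; split => //.
  exact: mulr_ge0.
by move=> k; rewrite normrM -mulrA ler_wpM2l.
Qed.

Lemma geom_bounded_exp (M c : R) : geom_bounded (fun k => M * c ^+ k).
Proof.
exists `|M|, `|c|; split => // k.
by rewrite normrM normrX.
Qed.

Lemma eserD a b t : geom_bounded a -> geom_bounded b ->
  eser (fun k => a k + b k) t = eser a t + eser b t.
Proof.
move=> ga gb; rewrite /eser -lim_seriesD; [|exact: is_cvg_eser..].
by congr (limn (series _)); apply/funext => k /=; rewrite mulrDr.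
Qed.

Lemma eserZ c a t : geom_bounded a -> eser (fun k => c * a k) t = c * eser a t.
Proof.
move=> ga; rewrite /eser -[RHS]lim_seriesZ; last exact: is_cvg_eser.
by congr (limn (series _)); apply/funext => k /=; rewrite mulrCA.
Qed.

Lemma eser_sum (I : Type) (r : seq I) (w : I -> R) (a : I -> nat -> R) t :
  (forall i, geom_bounded (a i)) ->
  geom_bounded (fun k => \sum_(i <- r) w i * a i k) /\
  eser (fun k => \sum_(i <- r) w i * a i k) t = \sum_(i <- r) w i * eser (a i) t.
Proof.
move=> ga; elim: r => [|i r [IHg IHe]].
  have -> : (fun k => \sum_(i <- [::]) w i * a i k) = (fun k => 0 * 0 ^+ k).
    by apply/funext => k; rewrite big_nil mul0r.
  split; first exact: geom_bounded_exp.
  by rewrite big_nil eserZ ?mul0r//; exists 1, 0; split => // k;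
    rewrite normrX normr0 mul1r.
have -> : (fun k => \sum_(j <- i :: r) w j * a j k) =
          (fun k => w i * a i k + \sum_(j <- r) w j * a j k).
  by apply/funext => k; rewrite big_cons.
split; first by apply: geom_boundedD => //; exact: geom_boundedZ.
by rewrite big_cons eserD// ?eserZ ?IHe//; exact: geom_boundedZ.
Qed.

Lemma le_eser a b t : 0 <= t -> geom_bounded a -> geom_bounded b ->
  (forall k, a k <= b k) -> eser a t <= eser b t.
Proof.
move=> t0 ga gb ab; apply: lim_series_le; [exact: is_cvg_eser..|].
by move=> k; rewrite ler_wpM2l// divr_ge0// exprn_ge0.
Qed.

Lemma eser_exp (c t : R) : eser (fun k => c ^+ k) t = expR (c * t).
Proof.
rewrite /eser /expR; congr (limn (series _)); apply/funext => k /=.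
by rewrite /exp_coeff /= exprMn; ring.
Qed.

Lemma eser0 a : eser a 0 = a 0%N.
Proof.
apply/cvg_lim => //; rewrite -(cvg_shiftn 1).
rewrite [X in X @ _ --> _](_ : _ = fun=> a 0%N); first exact: cvg_cst.
apply/funext => n; rewrite /series /= addn1 big_nat_recl// big1 => [|i _].
  by rewrite expr0 fact0 divr1 mul1r addr0.
by rewrite expr0n /= mul0r mul0r.
Qed.

Lemma is_derive_eser a t : geom_bounded a ->
  is_derive t (1 : R) (eser a) (eser (fun k => a k.+1) t).
Proof.
have pE b s : series (fun k => s ^+ k / k`!%:R * b k)
    = pseries (fun k => b k / k`!%:R) s.
  by rewrite /pseries; congr series; apply/funext => k /=; ring.
have dE b : pseries_diffs (fun k => b k / k`!%:R) = (fun k => b k.+1 / k`!%:R :> R).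
  apply/funext => k; rewrite /pseries_diffs factS natrM.
  by rewrite invfM mulrCA mulVKf// pnatr_eq0.
move=> ga.
have -> : eser a = (fun s => limn (pseries (fun k => a k / k`!%:R) s)).
  by apply/funext => s; rewrite /eser pE.
rewrite /eser pE -dE; apply: (@pseries_snd_diffs _ _ (`|t| + 1)).
- by rewrite -pE; exact: is_cvg_eser.
- by rewrite dE -pE; apply: is_cvg_eser; exact: geom_boundedS.
- rewrite dE (dE (fun k => a k.+1)) -(pE (fun k => a k.+2)).
  by apply: is_cvg_eser; apply: geom_boundedS (geom_boundedS ga).
- by rewrite (@ger0_norm _ (`|t| + 1)) ?addr_ge0// ltrDl.
Qed.

End ExponentialSeries.

(** * Rules of differentiation and a mean value bound *)

Section RealDerivatives.
Variable R : realType.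
Implicit Types f g : R -> R.

Lemma is_derive_mul f g (x df dg : R) :
  is_derive x 1 f df -> is_derive x 1 g dg ->
  is_derive x 1 (fun s => f s * g s) (df * g x + f x * dg).
Proof.
move=> fdf gdg; apply: (is_derive_eq (is_deriveM fdf gdg)).
by rewrite /GRing.scale/= addrC mulrC.
Qed.

Lemma is_derive_scale (a : R) f (x df : R) :
  is_derive x 1 f df -> is_derive x 1 (fun s => a * f s) (a * df).
Proof.
move=> fdf; apply: (is_derive_eq (is_derive_mul (is_derive_cst a x 1) fdf)).
by rewrite mul0r add0r.
Qed.

Lemma is_derive_expR_scale (a s : R) :
  is_derive s 1 (fun r => expR (a * r)) (a * expR (a * s)).
Proof.
have lin := is_derive_scale a (is_derive_id s 1); rewrite mulr1 in lin.
have := @is_derive1_comp _ expR (fun r => a * r) s _ _ (is_derive_expR _) lin.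
by rewrite mulrC.
Qed.

Lemma is_derive_bigsum (I : Type) (r : seq I) (f : I -> R -> R) (df : I -> R)
    (x : R) :
  (forall i, is_derive x 1 (f i) (df i)) ->
  is_derive x 1 (fun s => \sum_(i <- r) f i s) (\sum_(i <- r) df i).
Proof.
move=> fdf; elim: r => [|i r IH].
  rewrite big_nil (_ : (fun _ => _) = cst 0); first exact: is_derive_cst.
  by apply/funext => s; rewrite big_nil.
rewrite big_cons (_ : (fun _ => _) = f i + (fun s => \sum_(i <- r) f i s)).
  exact: is_deriveD.
by apply/funext => s; rewrite big_cons.
Qed.

Lemma is_derive_reverse f (tau s d : R) :
  is_derive (tau - s) 1 f d -> is_derive s 1 (fun r => f (tau - r)) (- d).
Proof.
move=> fd; have rev_d : is_derive s 1 (fun r => tau - r) (-1 : R).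
  by apply: (is_derive_eq (is_deriveB (is_derive_cst tau s 1) (is_derive_id s 1)));
    rewrite sub0r.
by have := @is_derive1_comp _ f (fun r => tau - r) s _ _ fd rev_d; rewrite mulrN1.
Qed.

Lemma increment_ge f (df : R -> R) (tau e : R) : 0 <= tau ->
  (forall s : R, 0 <= s -> s <= tau -> is_derive s 1 f (df s)) ->
  (forall s, 0 <= s -> s <= tau -> - e <= df s) ->
  f 0 <= f tau + tau * e.
Proof.
move=> tau0 fdf df_ge.
have [||c + ] := @MVT_segment _ f df 0 tau tau0.
- by move=> s; rewrite in_itv/= => /andP[/ltW ? /ltW ?]; exact: fdf.
- by apply: derivable_within_continuous => s; rewrite in_itv/= => /andP[s0 st];
    case: (fdf s s0 st).
rewrite in_itv/= subr0 => /andP[c0 ct] incr.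
have := ler_wpM2r tau0 (df_ge c c0 ct); rewrite -incr.
by lra.
Qed.

End RealDerivatives.

(** * Semigroups of linear operators on functions over a finite set *)

Section OperatorSemigroup.
Variables (R : realType) (S : finType).
Implicit Types (L : (S -> R) -> S -> R) (f g nu : S -> R).

Definition linear_op L := forall (a : R) f g x,
  L (fun y => a * f y + g y) x = a * L f x + L g x.

Definition delta (y : S) : S -> R := fun x => (x == y)%:R.

Definition sg L (t : R) f x : R := eser (fun k => iter k L f x) t.

(** Uniformization: for a generator and [c] large this operator is positive, and the semigroup of
    [L] is [expR (- c * t)] times that of the shift. Inequalities between powers thus become
    inequalities between semigroups. *)
Definition shift_op (c : R) L f x : R := L f x + c * f x.

Lemma sum_delta f x : f x = \sum_y f y * delta y x.
Proof.
rewrite (bigD1 x)//= /delta eqxx mulr1 big1 ?addr0// => y /negPf yx.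
by rewrite eq_sym yx mulr0.
Qed.

Section Linear.
Variable L : (S -> R) -> S -> R.
Hypothesis linL : linear_op L.

Lemma linear_op0 x : L (fun=> 0) x = 0.
Proof.
have e : (fun y : S => -1 * 0 + 0) = (fun=> 0) :> (S -> R).
  by apply/funext => y; rewrite mulr0 addr0.
by have := linL (-1) (fun=> 0) (fun=> 0) x; rewrite e mulN1r addNr.
Qed.

Lemma linear_opZ a f x : L (fun y => a * f y) x = a * L f x.
Proof.
rewrite -[RHS]addr0 -[in RHS](linear_op0 x) -linL; congr (L _ x).
by apply/funext => y; rewrite addr0.
Qed.

Lemma linear_op_sum (I : Type) (r : seq I) (w : I -> R) (f : I -> S -> R) x :
  L (fun y => \sum_(i <- r) w i * f i y) x = \sum_(i <- r) w i * L (f i) x.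
Proof.
elim: r => [|i r IH].
  by rewrite big_nil -[RHS](linear_op0 x); congr (L _ x); apply/funext => y; rewrite big_nil.
rewrite big_cons -IH -linL; congr (L _ x); apply/funext => y.
by rewrite big_cons.
Qed.

Lemma linear_opE f x : L f x = \sum_y f y * L (delta y) x.
Proof.
rewrite -linear_op_sum; congr (L _ x); apply/funext => y; exact: sum_delta.
Qed.

Lemma linear_op_iter k : linear_op (iter k L).
Proof.
elim: k => [|k IH] a f g x //=.
rewrite -linL; congr (L _ x); apply/funext => y; exact: IH.
Qed.

Lemma linear_op_shift c : linear_op (shift_op c L).
Proof. by move=> a f g x; rewrite /shift_op linL; ring. Qed.

Lemma geom_bounded_iter f x : geom_bounded (fun k => iter k L f x).
Proof.
pose N g := \sum_x `|g x|.
pose B := \sum_y \sum_x `|L (delta y) x|.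
have le_N g y : `|g y| <= N g.
  by rewrite /N (bigD1 y)//= lerDl sumr_ge0.
have N_L g : N (L g) <= B * N g.
  rewrite {1}/N (@le_trans _ _ (\sum_y `|g y| * \sum_x `|L (delta y) x|))//.
    rewrite [leRHS](eq_bigr (fun y => \sum_z `|g y| * `|L (delta y) z|)); last first.
      by move=> y _; rewrite mulr_sumr.
    rewrite exchange_big /=; apply: ler_sum => z _; rewrite linear_opE.
    rewrite (le_trans (ler_norm_sum _ _ _))//.
    by apply: ler_sum => y _; rewrite normrM.
  rewrite mulrC mulr_suml; apply: ler_sum => y _; rewrite ler_wpM2l//.
  by rewrite /B [leRHS](bigD1 y)//= lerDl sumr_ge0// => z _; rewrite sumr_ge0.
have N_ge0 g : 0 <= N g by exact: sumr_ge0.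
have B_ge0 : 0 <= B by apply: sumr_ge0 => y _; exact: sumr_ge0.
exists (N f), B; split => // k; rewrite (le_trans (le_N _ _))//.
elim: k => [|k IH] /=; first by rewrite mulr1.
by rewrite (le_trans (N_L _))// exprS mulrCA ler_wpM2l.
Qed.

Lemma sg0 f x : sg L 0 f x = f x.
Proof. by rewrite /sg eser0. Qed.

Lemma linear_op_sg t : linear_op (sg L t).
Proof.
move=> a f g x; rewrite /sg -eserZ; last exact: geom_bounded_iter.
rewrite -eserD; last 2 first.
- exact/geom_boundedZ/geom_bounded_iter.
- exact: geom_bounded_iter.
by congr (eser _ t); apply/funext => k; rewrite linear_op_iter.
Qed.

Lemma is_derive_sg (t : R) f x : is_derive t 1 (fun s => sg L s f x) (sg L t (L f) x).
Proof.
apply: (is_derive_eq (is_derive_eser t (geom_bounded_iter f x))).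
by congr (eser _ t); apply/funext => k; rewrite iterSr.
Qed.

Lemma sg_commute t f x : sg L t (L f) x = L (sg L t f) x.
Proof.
rewrite [RHS]linear_opE.
pose w y := L (delta y) x.
rewrite (eq_bigr (fun y => w y * sg L t f y)); last by move=> y _; rewrite mulrC.
rewrite /sg -(proj2 (eser_sum _ w t (fun y => geom_bounded_iter f y))).
congr (eser _ t); apply/funext => k.
rewrite -iterSr iterS linear_opE; apply: eq_bigr => y _; exact: mulrC.
Qed.

Lemma is_derive_sg' (t : R) f x : is_derive t 1 (fun s => sg L s f x) (L (sg L t f) x).
Proof. by rewrite -sg_commute; exact: is_derive_sg. Qed.

End Linear.

Section Evolution.
Variable L : (S -> R) -> S -> R.
Hypothesis linL : linear_op L.

(* [s |-> nu (sg (tau - s) (u s))] has derivative at least [- e]. *)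
Lemma sg_super nu (u u' : R -> S -> R) (tau e : R) : 0 <= tau ->
  (forall (s : R) x, 0 <= s -> s <= tau ->
    is_derive s 1 (fun r => u r x) (u' s x)) ->
  (forall s, 0 <= s -> s <= tau ->
    \sum_x nu x * sg L (tau - s) (fun y => L (u s) y - u' s y) x <= e) ->
  \sum_x nu x * sg L tau (u 0) x <= \sum_x nu x * u tau x + tau * e.
Proof.
move=> tau0 du bound.
have linS s := linear_op_sg linL s.
pose F s := \sum_x nu x * (\sum_y u s y * sg L (tau - s) (delta y) x).
have FE s : F s = \sum_x nu x * sg L (tau - s) (u s) x.
  by apply: eq_bigr => x _; rewrite [in RHS](linear_opE (linS _)).
have -> : \sum_x nu x * sg L tau (u 0) x = F 0 by rewrite FE subr0.
have -> : \sum_x nu x * u tau x = F tau.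
  by rewrite FE subrr; apply: eq_bigr => x _; rewrite sg0.
pose dF s := \sum_x nu x * (\sum_y (u' s y * sg L (tau - s) (delta y) x
                                - u s y * sg L (tau - s) (L (delta y)) x)).
have dFE s : dF s =
    - \sum_x nu x * sg L (tau - s) (fun y => L (u s) y - u' s y) x.
  rewrite -sumrN; apply: eq_bigr => x _; rewrite -mulrN; congr (_ * _).
  rewrite sumrB -(linear_opE (linS _)).
  rewrite -(linear_op_sum (linS _) _ (u s) (fun y => L (delta y))).
  have -> : (fun z => \sum_y u s y * L (delta y) z) = L (u s).
    by apply/funext => z; rewrite [RHS](linear_opE linL).
  have -> : (fun y => L (u s) y - u' s y) = (fun y => -1 * u' s y + L (u s) y).
    by apply/funext => y; rewrite mulN1r addrC.
  by rewrite linS mulN1r opprD opprK.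
apply: (@increment_ge _ F dF) => // [s s0 st|s s0 st]; last first.
  by rewrite dFE lerN2 bound.
apply: is_derive_bigsum => x.
apply: is_derive_scale.
under eq_bigr do rewrite -mulrN.
apply: is_derive_bigsum => y; apply: is_derive_mul; first exact: du.
apply: (@is_derive_reverse _ (fun r => sg L r (delta y) x)).
exact: is_derive_sg.
Qed.

(** The weights in [sg_super] may have any sign, so the case of zero error, applied to [delta x] and
    to its opposite, gives both inequalities. *)
Lemma sg_unique (u : R -> S -> R) (tau : R) x : 0 <= tau ->
  (forall (s : R) x, is_derive s 1 (fun r => u r x) (L (u s) x)) ->
  sg L tau (u 0) x = u tau x.
Proof.
move=> tau0 du.
have nuE (g : S -> R) : \sum_y delta x y * g y = g x.
  by rewrite (bigD1 x)//= /delta eqxx mul1r big1 ?addr0// => y /negPf ->; rewrite mul0r.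
have null w s : \sum_y w y * sg L s (fun z => L (u (tau - s)) z - L (u (tau - s)) z) y = 0.
  apply: big1 => y _.
  rewrite (_ : (fun _ => _) = fun=> 0); last by apply/funext => z; rewrite subrr.
  by rewrite (linear_op0 (linear_op_sg linL _)) mulr0.
have one_side w : \sum_y w y * sg L tau (u 0) y <= \sum_y w y * u tau y.
  have := @sg_super w u (fun s => L (u s)) tau 0 tau0 (fun s y _ _ => du s y).
  rewrite mulr0 addr0; apply => s _ _.
  by have := null w (tau - s); rewrite opprB addrCA subrr addr0 => ->.
apply/eqP; rewrite eq_le; apply/andP; split.
  by have := one_side (delta x); rewrite !nuE.
have := one_side (fun y => - delta x y).
by under eq_bigr do rewrite mulNr; under [leRHS]eq_bigr do rewrite mulNr;
  rewrite !sumrN lerN2 !nuE.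
Qed.

Lemma sgD s t f x : 0 <= s -> sg L s (sg L t f) x = sg L (s + t) f x.
Proof.
move=> s0.
have -> : sg L t f = (fun y => sg L (0 + t) f y) by apply/funext => y; rewrite add0r.
apply: (@sg_unique (fun r y => sg L (r + t) f y)) => // r y.
have sh : is_derive r 1 (fun v => v + t) (1 : R).
  by apply: (is_derive_eq (is_deriveD (is_derive_id r 1) (is_derive_cst t r 1)));
    rewrite addr0.
have := @is_derive1_comp _ (fun v => sg L v f y) (fun v => v + t) r _ _
  (is_derive_sg' linL (r + t) f y) sh.
by rewrite mulr1.
Qed.

Lemma sg_shift c t f x : 0 <= t ->
  sg L t f x = expR (- c * t) * sg (shift_op c L) t f x.
Proof.
move=> t0; have linLc := linear_op_shift linL c.
have {1}-> : f = (fun y => expR (- c * 0) * sg (shift_op c L) 0 f y).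
  by apply/funext => y; rewrite mulr0 expR0 mul1r sg0.
apply: (@sg_unique (fun r y => expR (- c * r) * sg (shift_op c L) r f y)) => // r y.
rewrite (linear_opZ linL).
have -> : expR (- c * r) * L (fun y => sg (shift_op c L) r f y) y =
   (expR (- c * r) * - c) * sg (shift_op c L) r f y +
   expR (- c * r) * shift_op c L (sg (shift_op c L) r f) y.
  by rewrite /shift_op /=; ring.
apply: is_derive_mul; last exact: is_derive_sg'.
by rewrite mulrC; exact: is_derive_expR_scale.
Qed.

Lemma sg_const t (a : R) x : 0 <= t -> (forall y, L (fun=> 1) y = 0) ->
  sg L t (fun=> a) x = a.
Proof.
move=> t0 L1; apply: (@sg_unique (fun _ _ => a)) => // s y.
have -> : L (fun=> a) y = 0.
  rewrite -(mulr0 a) -(L1 y) -(linear_opZ linL); congr (L _ y).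
  by apply/funext => z; rewrite mulr1.
exact: is_derive_cst.
Qed.

(** Summing the bounds on the powers with exponential coefficients gives [m * expR (b * t)]; undoing
    the shift turns [c - b] into a decay rate. *)
Lemma sg_diff_le c m b t f x y : 0 <= t ->
  (forall k, iter k (shift_op c L) f x - iter k (shift_op c L) f y <= m * b ^+ k) ->
  sg L t f x - sg L t f y <= m * expR ((b - c) * t).
Proof.
move=> t0 bound; have linLc := linear_op_shift linL c.
have -> : m * expR ((b - c) * t) = expR (- c * t) * (m * expR (b * t)).
  by rewrite mulrBl -mulNr expRD; ring.
rewrite !(sg_shift c)// -mulrBr ler_wpM2l ?expR_ge0//.
have gx := geom_bounded_iter linLc f x; have gy := geom_bounded_iter linLc f y.
rewrite -[X in _ - X]mul1r -mulNr -eserZ// -eserD//; last exact: geom_boundedZ.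
rewrite -eser_exp -eserZ; last first.
  by rewrite (_ : (fun k => b ^+ k) = (fun k => 1 * b ^+ k));
    [exact: geom_bounded_exp | apply/funext => k; rewrite mul1r].
apply: le_eser => // [||k]; [|exact: geom_bounded_exp|by rewrite mulN1r].
by apply: geom_boundedD => //; exact: geom_boundedZ.
Qed.

Section Positive.
Variable c : R.
Hypothesis posL : forall f, (forall x, 0 <= f x) -> forall x, 0 <= shift_op c L f x.

Lemma sg_ge0 t f x : 0 <= t -> (forall y, 0 <= f y) -> 0 <= sg L t f x.
Proof.
move=> t0 f0; rewrite (sg_shift c)// mulr_ge0 ?expR_ge0//.
have it_ge0 k y : 0 <= iter k (shift_op c L) f y by elim: k y => //= k IH; exact: posL.
rewrite -(mul0r (expR (0 * t))) -eser_exp -eserZ; last first.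
  by rewrite (_ : (fun k => 0 ^+ k) = (fun k => 1 * 0 ^+ k));
    [exact: geom_bounded_exp | apply/funext => k; rewrite mul1r].
apply: le_eser => // [||k]; [exact: geom_bounded_exp| |by rewrite mul0r].
exact/geom_bounded_iter/linear_op_shift.
Qed.

Lemma le_sg t f g x : 0 <= t -> (forall y, f y <= g y) -> sg L t f x <= sg L t g x.
Proof.
move=> t0 fg; rewrite -subr_ge0 addrC -mulN1r -(linear_op_sg linL).
by apply: sg_ge0 => // y; rewrite mulN1r addrC subr_ge0.
Qed.

End Positive.
End Evolution.
End OperatorSemigroup.

(** * Existence of an invariant measure *)

Section EnumSums.
Variables (V : nmodType) (S : finType).

Lemma sum_enum_val (F : S -> V) : \sum_x F x = \sum_(i < #|S|) F (enum_val i).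
Proof. by rewrite (reindex (enum_val : 'I_#|S| -> S))//; exact/onW_bij/enum_val_bij. Qed.

Lemma sum_enum_rank (F : 'I_#|S| -> V) : \sum_i F i = \sum_x F (enum_rank x).
Proof. by rewrite (reindex (enum_rank : S -> 'I_#|S|))//; exact/onW_bij/enum_rank_bij. Qed.

End EnumSums.

Section InvariantMeasure.
Variables (R : realType) (S : finType) (L : (S -> R) -> S -> R).
Hypothesis linL : linear_op L.

Lemma sg_invariant (mu : S -> R) t f :
  (forall g, \sum_x mu x * L g x = 0) ->
  \sum_x mu x * sg L t f x = \sum_x mu x * f x.
Proof.
move=> mu0.
have -> : \sum_x mu x * f x = \sum_x mu x * sg L 0 f x.
  by apply: eq_bigr => x _; rewrite sg0.
apply: (@is_derive_0_is_cst R (fun s => \sum_x mu x * sg L s f x)) => s.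
apply: is_derive_eq (mu0 (sg L s f)); apply: is_derive_bigsum => x.
exact/is_derive_scale/is_derive_sg'.
Qed.

(** The matrix of [L] kills the constant vector, so it is singular and has a left null vector, of
    unknown signs; positivity of the shift allows passing to absolute values. *)
Lemma ex_invariant_measure (c : R) : (0 < #|S|)%N ->
  (forall f, (forall x, 0 <= f x) -> forall x, 0 <= shift_op c L f x) ->
  (forall x, L (fun=> 1) x = 0) ->
  exists mu : S -> R, [/\ forall x, 0 <= mu x, \sum_x mu x = 1 &
    forall f, \sum_x mu x * L f x = 0].
Proof.
move=> S_gt0 posL L1.
pose A : 'M[R]_#|S| := \matrix_(i, j) L (delta R (enum_val j)) (enum_val i).
have A1 : A *m const_mx 1 = 0 :> 'cV_#|S|.
  apply/matrixP => i j; rewrite !mxE; transitivity (L (fun=> 1) (enum_val i)) => //.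
  rewrite [RHS](linear_opE linL).
  rewrite [RHS]sum_enum_val.
by apply: eq_bigr => k _; rewrite !mxE mulr1 mul1r.
have /det0P[v v_neq0 vA] : \det A == 0.
  rewrite -[_ == 0]negbK; apply/negP; rewrite -unitfE -unitmxE => Au.
  have : const_mx 1 = 0 :> 'cV[R]_#|S| by rewrite -(mulKmx Au (const_mx 1)) A1 mulmx0.
  by move/matrixP => /(_ (Ordinal S_gt0) 0); rewrite !mxE => /eqP; rewrite oner_eq0.
(* If [w L = 0] then [|w| L >= 0]; the total mass of [|w| L] is 0, so [|w| L = 0]. *)
pose w x := v 0 (enum_rank x).
have wL y : \sum_x w x * L (delta R y) x = 0.
  have /matrixP/(_ 0 (enum_rank y)) := vA; rewrite !mxE => e; apply: (etrans _ e).
  rewrite [LHS]sum_enum_val.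
  by apply: eq_bigr => k _; rewrite !mxE /w enum_valK enum_rankK.
pose m x := `|w x|.
have m_ge0 x : 0 <= m x by exact: normr_ge0.
have sum_deltar (g : S -> R) y : \sum_x g x * delta R y x = g y.
  rewrite (bigD1 y)//= /delta eqxx mulr1 big1 ?addr0// => x /negPf ->.
  by rewrite mulr0.
have delta_ge0 y x : 0 <= delta R y x by rewrite /delta; case: eqP.
have a_ge0 y : 0 <= \sum_x m x * L (delta R y) x.
  have h : c * m y <= \sum_x m x * shift_op c L (delta R y) x.
    have [c0|c0] := leP 0 c; last first.
      apply: (@le_trans _ _ 0); first by rewrite mulr_le0_ge0 ?m_ge0// ltW.
      by apply: sumr_ge0 => x _; rewrite mulr_ge0// posL.
    rewrite /m -[X in X * _](ger0_norm c0) -normrM.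
    have -> : c * w y = \sum_x w x * shift_op c L (delta R y) x.
      transitivity (\sum_x w x * L (delta R y) x + c * \sum_x w x * delta R y x).
        by rewrite wL sum_deltar add0r.
      rewrite mulr_sumr -big_split/=.
      by apply: eq_bigr => x _; rewrite /shift_op; ring.
    rewrite (le_trans (ler_norm_sum _ _ _))//; apply: ler_sum => x _.
    by rewrite normrM ler_wpM2l// ger0_norm// posL.
  rewrite -(lerD2r (c * m y)) add0r (le_trans h)// -[X in _ + c * X](sum_deltar m y).
  rewrite mulr_sumr -big_split/= ler_sum// => x _.
  by rewrite /shift_op le_eqVlt; apply/orP; left; apply/eqP; ring.
have a_sum : \sum_y \sum_x m x * L (delta R y) x = 0.
  rewrite exchange_big big1//= => x _; rewrite -mulr_sumr.
  transitivity (m x * L (fun=> 1) x); last by rewrite L1 mulr0.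
  by rewrite (linear_opE linL) /=; under [in RHS]eq_bigr do rewrite mul1r.
have a0 y : \sum_x m x * L (delta R y) x = 0.
  by have := psumr_eq0P (fun y _ => a_ge0 y) a_sum; apply.
have M_gt0 : 0 < \sum_x m x.
  have [i vi] : exists i, v 0 i != 0.
    by apply/rV0Pn.
  rewrite (bigD1 (enum_val i))//= ltr_pwDl ?sumr_ge0//.
  by rewrite /m /w enum_valK normr_gt0.
exists (fun x => m x / \sum_x m x); split => [x||f].
- by rewrite divr_ge0// ltW.
- by rewrite -mulr_suml divff// gt_eqF.
- rewrite (eq_bigr (fun x => \sum_y (f y / \sum_x m x) * (m x * L (delta R y) x))).
    rewrite exchange_big big1//= => y _.
    by rewrite -mulr_sumr a0 mulr0.
  by move=> x _; rewrite (linear_opE linL) mulr_sumr; apply: eq_bigr => y _; ring.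
Qed.

End InvariantMeasure.

(** * Jump generators, and the link with [law] and [stationary] *)

Section JumpOperator.
Variables (R : realType) (S I : finType) (r : I -> S -> R) (m : I -> S -> S).

(** A move that fixes [x] contributes nothing, so its rate may stay positive where the transition is
    blocked. *)
Definition jump (f : S -> R) (x : S) : R := \sum_i r i x * (f (m i x) - f x).

Lemma linear_op_jump : linear_op jump.
Proof.
move=> a f g x; rewrite /jump mulr_sumr -big_split/=.
by apply: eq_bigr => i _; ring.
Qed.

Lemma jump1 x : jump (fun=> 1) x = 0.
Proof. by rewrite /jump big1// => i _; rewrite subrr mulr0. Qed.

Hypothesis r_ge0 : forall i x, 0 <= r i x.

Lemma jump_shift_ge0 f : (forall x, 0 <= f x) ->
  forall x, 0 <= shift_op (\sum_i \sum_y r i y) jump f x.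
Proof.
move=> f0 x; rewrite /shift_op mulr_suml -big_split/= sumr_ge0// => i _.
have -> : r i x * (f (m i x) - f x) + (\sum_y r i y) * f x =
          r i x * f (m i x) + (\sum_y r i y - r i x) * f x by ring.
rewrite addr_ge0 ?mulr_ge0// subr_ge0 (bigD1 x)//= lerDl.
exact: sumr_ge0.
Qed.

End JumpOperator.

Section Law.
Variables (R : realType) (S : finType) (q : S -> S -> R).

Definition gen_op : (S -> R) -> S -> R := jump (fun y x => q x y) (fun y _ => y).

Lemma generator_gen_op k x y :
  (generator q ^+ k) (enum_rank x) (enum_rank y) = iter k gen_op (delta R y) x.
Proof.
elim: k x => [|k IH] x.
  by rewrite expr0 !mxE /= /delta (inj_eq enum_rank_inj).
have -> : generator q ^+ k.+1 = generator q *m generator q ^+ k by rewrite exprS.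
rewrite [LHS]mxE [LHS]sum_enum_rank.
rewrite iterS; set g := iter k _ _.
transitivity (\sum_z generator q (enum_rank x) (enum_rank z) * g z).
  by apply: eq_bigr => z _; congr (_ * _); exact: IH.
rewrite (bigD1 x)//= !mxE eqxx enum_rankK.
rewrite [X in _ + X](eq_bigr (fun z => q x z * g z)); last first.
  by move=> z zx; rewrite !mxE (inj_eq enum_rank_inj) eq_sym (negPf zx) !enum_rankK.
rewrite /gen_op /jump [RHS](bigD1 x)//= subrr mulr0 add0r mulNr mulr_suml addrC -sumrB.
by apply: eq_bigr => z _; rewrite mulrBr.
Qed.

Lemma lawE x t y : law q x t y = sg gen_op t (delta R y) x.
Proof.
rewrite ffunE /sg /eser; congr (limn (series _)); apply/funext => k.
by rewrite generator_gen_op.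
Qed.

Lemma sum_law x t f : \sum_y law q x t y * f y = sg gen_op t f x.
Proof.
rewrite [RHS](linear_opE (linear_op_sg (linear_op_jump _ _) t)).
by apply: eq_bigr => y _; rewrite lawE mulrC.
Qed.

Lemma stationaryP : (0 < #|S|)%N -> (forall x y, 0 <= q x y) ->
  invariant_distribution q (stationary q).
Proof.
move=> S_gt0 q_ge0.
(* [xget] returns an element of the set as soon as there is one, so existence is enough. *)
suff [mu mu_inv] : exists mu, invariant_distribution q mu.
  exact: (xgetPex [ffun=> 0] (ex_intro _ mu mu_inv)).
have linL := linear_op_jump (fun y x => q x y) (fun y _ => y).
have [m [m0 m1 mL]] := ex_invariant_measure linL S_gt0
  (jump_shift_ge0 (fun y _ => y) (fun y x => q_ge0 x y)) (jump1 _ _).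
exists [ffun x => m x]; split => [x||t t0 y]; first by rewrite ffunE.
  by under eq_bigr do rewrite ffunE.
rewrite ffunE -[RHS](_ : \sum_x m x * delta R y x = _).
  by rewrite -(sg_invariant linL t (delta R y) mL); apply: eq_bigr => x _;
    rewrite ffunE lawE.
rewrite (bigD1 y)//= /delta eqxx mulr1 big1 ?addr0// => x /negPf ->.
by rewrite mulr0.
Qed.

End Law.

(** * One link with constant arrival rate *)

Section SingleLink.
Variables (R : realType) (K : nat).
Implicit Types (k p : 'I_K.+1) (f v : 'I_K.+1 -> R) (l : R).

Definition up k : 'I_K.+1 := inord (minn k.+1 K).
Definition dn k : 'I_K.+1 := inord k.-1.

Lemma val_up k : up k = minn k.+1 K :> nat.
Proof. by rewrite inordK// ltnS geq_minr. Qed.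

Lemma val_dn k : dn k = k.-1 :> nat.
Proof. by rewrite inordK// (leq_ltn_trans (leq_pred _) (ltn_ord k)). Qed.

Definition link l : ('I_K.+1 -> R) -> 'I_K.+1 -> R :=
  jump (fun b k => if b then l else k%:R) (fun b k => if b then up k else dn k).

Lemma linkE l f k : link l f k = l * (f (up k) - f k) + k%:R * (f (dn k) - f k).
Proof. by rewrite /link /jump big_bool. Qed.

Lemma linear_op_link l : linear_op (link l).
Proof. exact: linear_op_jump. Qed.

Lemma link1 l k : link l (fun=> 1) k = 0.
Proof. exact: jump1. Qed.

Definition link_shift l : R := l + K%:R.

Lemma link_shiftE l f k : shift_op (link_shift l) (link l) f k =
  l * f (up k) + (K%:R - k%:R) * f k + k%:R * f (dn k).
Proof. by rewrite /shift_op linkE /link_shift; ring. Qed.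

Let natK k : k%:R <= K%:R :> R.
Proof. by rewrite ler_nat -ltnS. Qed.

Lemma link_shift_ge0 l f : 0 <= l -> (forall k, 0 <= f k) ->
  forall k, 0 <= shift_op (link_shift l) (link l) f k.
Proof. by move=> l0 f0 k; rewrite link_shiftE !addr_ge0 ?mulr_ge0// subr_ge0. Qed.

Definition increasing f := forall k p, (k <= p)%N -> f k <= f p.

(** For [k < p], the value [K * f k] separates the terms without [l]: those of [k] only involve
    levels up to [k], those of [p] levels from [p - 1 >= k] on, with total weight [K] in both
    cases. *)
Lemma increasing_link_shift l f : 0 <= l -> increasing f ->
  increasing (shift_op (link_shift l) (link l) f).
Proof.
move=> l0 f_inc k p; rewrite leq_eqVlt => /predU1P[kp|kp].
  by rewrite (ord_inj kp).
rewrite !link_shiftE.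
have up_le : l * f (up k) <= l * f (up p).
  by rewrite ler_wpM2l// f_inc// !val_up leq_min geq_minr andbT geq_min ltnS ltnW.
have dn_ge : p%:R * f k <= p%:R * f (dn p).
  by rewrite ler_wpM2l// f_inc// val_dn -ltnS (leq_trans kp)// leqSpred.
have p_ge : (K%:R - p%:R) * f k <= (K%:R - p%:R) * f p.
  by rewrite ler_wpM2l ?subr_ge0// f_inc// ltnW.
have dn_k : k%:R * f (dn k) <= k%:R * f k.
  by rewrite ler_wpM2l// f_inc// val_dn leq_pred.
lra.
Qed.

Lemma increasing_sg_link l t f : 0 <= l -> 0 <= t -> increasing f ->
  increasing (sg (link l) t f).
Proof.
move=> l0 t0 f_inc k p kp; rewrite -subr_le0.
rewrite -(mul0r (expR ((0 - link_shift l) * t))).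
apply: (sg_diff_le (linear_op_link l) t0) => j.
rewrite mul0r subr_le0.
suff : increasing (iter j (shift_op (link_shift l) (link l)) f) by apply.
by elim: j => //= j IH; exact: increasing_link_shift.
Qed.

Definition lipschitz_link (m : R) f :=
  forall k p, (k <= p)%N -> `|f p - f k| <= m * (p%:R - k%:R).

(** Departure rates grow by 1 per unit of occupancy, so two copies at distance [d] get closer by one
    at rate [d]. The weight [l + K] thus drops to [l + K - 1]: a contraction at rate 1, whatever [l]
    and [K]. *)
Lemma lipschitz_link_shift l m f : (0 < K)%N -> 0 <= l -> lipschitz_link m f ->
  lipschitz_link ((link_shift l - 1) * m) (shift_op (link_shift l) (link l) f).
Proof.
move=> K0 l0 f_lip k p; rewrite leq_eqVlt => /predU1P[kp|kp].
  by rewrite (ord_inj kp) !subrr normr0 mulr0.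
have m0 : 0 <= m.
  have := le_trans (normr_ge0 _) (f_lip k p (ltnW kp)).
  by rewrite pmulr_lge0// subr_gt0 ltr_nat.
rewrite !link_shiftE.
set d : R := p%:R - k%:R.
have d1 : 1 <= d by rewrite lerBrDr nat1r ler_nat.
have k_up : (k <= up p)%N by rewrite val_up leq_min ltnW ?(ltn_trans kp)//= -ltnS.
have e1 : `|f (up p) - f (up k)| <= m * d.
  have upkp : (up k <= up p)%N.
    by rewrite !val_up leq_min geq_minr andbT geq_min ltnS ltnW.
  rewrite (le_trans (f_lip _ _ upkp))// ler_wpM2l// !val_up.
  rewrite (minn_idPl (_ : (k.+1 <= K)%N)); last by rewrite (leq_trans kp)// -ltnS.
  have : (minn p.+1 K)%:R <= p.+1%:R :> R by rewrite ler_nat geq_minl.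
  by rewrite -!natr1 /d; lra.
have e2 : `|f p - f k| <= m * d by exact/f_lip/ltnW.
have p0 : (0 < p)%N by exact: leq_ltn_trans kp.
have pE : p.-1%:R = p%:R - 1 :> R by rewrite -[in RHS](prednK p0) -natr1 addrK.
have e3 : `|f (dn p) - f k| <= m * (d - 1).
  have kdp : (k <= dn p)%N by rewrite val_dn -ltnS (leq_trans kp)// leqSpred.
  by rewrite (le_trans (f_lip _ _ kdp))// val_dn pE /d ler_wpM2l//; lra.
have e4 : `|k%:R * (f (dn p) - f (dn k))| <= k%:R * (m * d).
  rewrite normrM normr_nat; have [->|k0] := posnP k; first by rewrite !mul0r.
  rewrite ler_wpM2l//.
  have dkp : (dn k <= dn p)%N by rewrite !val_dn -!subn1 leq_sub2r// ltnW.
  have kE : k.-1%:R = k%:R - 1 :> R by rewrite -[in RHS](prednK k0) -natr1 addrK.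
  by rewrite (le_trans (f_lip _ _ dkp))// !val_dn pE kE /d ler_wpM2l//; lra.
(* A coupling of the copies at [k < p]: both rise, both stay, only [p] falls, both fall. *)
have -> : l * f (up p) + (K%:R - p%:R) * f p + p%:R * f (dn p) -
   (l * f (up k) + (K%:R - k%:R) * f k + k%:R * f (dn k)) =
   l * (f (up p) - f (up k)) + (K%:R - p%:R) * (f p - f k) +
   d * (f (dn p) - f k) + k%:R * (f (dn p) - f (dn k)) by rewrite /d; ring.
rewrite (le_trans (ler_normD _ _))//.
have -> : (link_shift l - 1) * m * d = l * (m * d) + (K%:R - p%:R) * (m * d) +
  d * (m * (d - 1)) + k%:R * (m * d) by rewrite /link_shift /d; ring.
rewrite lerD//.
rewrite (le_trans (ler_normD _ _))// lerD//.
  rewrite (le_trans (ler_normD _ _))// lerD// normrM ger0_norm ?subr_ge0// ler_wpM2l//.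
  by rewrite subr_ge0.
by rewrite normrM ger0_norm ?ler_wpM2l//; lra.
Qed.

Lemma sg_link_lipschitz l t f (k p : 'I_K.+1) : (0 < K)%N -> 0 <= l -> 0 <= t ->
  lipschitz_link 1 f -> sg (link l) t f k - sg (link l) t f p <= K%:R * expR (- t).
Proof.
move=> K0 l0 t0 f_lip.
have -> : - t = (link_shift l - 1 - link_shift l) * t by ring.
apply: (sg_diff_le (linear_op_link l) t0) => j.
have : lipschitz_link ((link_shift l - 1) ^+ j) (iter j (shift_op (link_shift l) (link l)) f).
  elim: j => [|j IH]; first by rewrite expr0.
  by rewrite exprS iterS; exact: lipschitz_link_shift.
move: (iter j _ f) => g g_lip.
have shift_ge0 : 0 <= (link_shift l - 1) ^+ j.
  by rewrite exprn_ge0// /link_shift -addrA addr_ge0// subr_ge0 ler1n.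
have diff_le : `|g k - g p| <= (link_shift l - 1) ^+ j * K%:R.
  have p_ge0 : 0 <= p%:R :> R by [].
  have k_ge0 : 0 <= k%:R :> R by [].
  have [kp|/ltnW pk] := leqP k p.
    rewrite distrC (le_trans (g_lip _ _ kp))// ler_wpM2l//.
    by have := natK p; lra.
  rewrite (le_trans (g_lip _ _ pk))// ler_wpM2l//.
  by have := natK k; lra.
by rewrite mulrC (le_trans (ler_norm _)).
Qed.

Section Stationary.
Variable l : R.
Hypothesis l_gt0 : 0 < l.

(** Normalised on levels up to [K], this is the Poisson law of parameter [l] conditioned to be at
    most [K]; its mass at [K] is the Erlang blocking probability. *)
Definition erlang_weight (k : nat) : R := l ^+ k / k`!%:R.
Definition erlang_const : R := \sum_(k < K.+1) erlang_weight k.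
Definition erlang (k : nat) : R := erlang_weight k / erlang_const.

Lemma erlang_weight_gt0 (k : nat) : 0 < erlang_weight k.
Proof. by rewrite divr_gt0 ?exprn_gt0// ltr0n fact_gt0. Qed.

Lemma erlang_const_gt0 : 0 < erlang_const.
Proof.
rewrite /erlang_const (bigD1 ord0)//=; apply: ltr_pwDl. exact: (erlang_weight_gt0 0).
by apply: sumr_ge0 => k _; exact/ltW/erlang_weight_gt0.
Qed.

Lemma erlang_ge0 (k : nat) : 0 <= erlang k.
Proof. by rewrite divr_ge0// ltW ?erlang_weight_gt0 ?erlang_const_gt0. Qed.

Lemma sum_erlang : \sum_(k < K.+1) erlang k = 1.
Proof. by rewrite -mulr_suml divff// gt_eqF// erlang_const_gt0. Qed.

Lemma erlang_weightS (k : nat) : k.+1%:R * erlang_weight k.+1 = l * erlang_weight k.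
Proof.
rewrite /erlang_weight exprS factS natrM invfM.
by rewrite mulrCA mulVKf ?mulrA// pnatr_eq0.
Qed.

(** Detailed balance: by [erlang_weightS] the upward flow from [k] cancels the downward flow from
    [k + 1]. The terms left over, upward at [K] and downward at 0, vanish. *)
Lemma erlang_invariant f : \sum_(k < K.+1) erlang k * link l f k = 0.
Proof.
rewrite (eq_bigr (fun k => erlang_const^-1 * (erlang_weight k * link l f k))); last first.
  by move=> k _; rewrite /erlang; ring.
rewrite -mulr_sumr.
suff -> : \sum_(k < K.+1) erlang_weight k * link l f k = 0 by rewrite mulr0.
pose F i := f (inord i).
have fE k : f k = F k by rewrite /F inord_val.
rewrite (eq_bigr (fun k : 'I_K.+1 => l * erlang_weight k * (F (minn k.+1 K) - F k) +
  k%:R * erlang_weight k * (F k.-1 - F k))); last first.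
  by move=> k _; rewrite linkE !fE val_up val_dn; ring.
rewrite big_split/= big_ord_recr big_ord_recl/=.
rewrite (minn_idPr (leqnSn K)) subrr mulr0 addr0 mul0r mul0r add0r -big_split/= big1// => k _.
rewrite /bump/= add1n add0n (minn_idPl (ltn_ord k)).
by rewrite erlang_weightS; ring.
Qed.

Lemma sum_erlang_sg t f : \sum_(k < K.+1) erlang k * sg (link l) t f k = \sum_(k < K.+1) erlang k * f k.
Proof. exact: (sg_invariant (linear_op_link l) t f erlang_invariant). Qed.

End Stationary.
End SingleLink.

(** * Blocking probability and upper levels for arrival rate [lam K] *)

Section ErlangEstimates.
Variable R : realType.
Implicit Types (K : nat) (l lam x : R).

Lemma sum_erlang_cst K l (c : R) : 0 < l -> \sum_(k < K.+1) erlang K l k * c = c.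
Proof. by move=> l0; rewrite -mulr_suml sum_erlang// mul1r. Qed.

Lemma sum_erlang_top K l :
  \sum_(k < K.+1) erlang K l k * (k == K :> nat)%:R = erlang K l K.
Proof.
rewrite (bigD1 ord_max)//= eqxx mulr1 big1 ?addr0// => k kK.
by rewrite (_ : _ == _ = false) ?mulr0//; apply: contraNF kK => /eqP kK; apply/eqP/ord_inj.
Qed.

(* The mean occupancy [l (1 - erlang K l K)] is at most [K]. *)
Lemma erlang_full_ge K l : 0 < l -> 1 - K%:R / l <= erlang K l K.
Proof.
move=> l0; have inv := erlang_invariant l (fun k : 'I_K.+1 => k%:R).
have linkid (k : 'I_K.+1) :
    link l (fun k : 'I_K.+1 => k%:R) k = l - l * (k == K :> nat)%:R - k%:R.
  rewrite linkE val_up val_dn; have [kK|kK] := eqVneq (k : nat) K.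
    by rewrite kK (minn_idPr (leqnSn K)); case: (K) => [|m] /=;
      rewrite ?subrr ?mulr0 ?mulr1 ?subrr ?addr0// -[m.+1%:R]natr1; ring.
  have k_lt : (k < K)%N by rewrite ltn_neqAle kK -ltnS ltn_ord.
  rewrite (minn_idPl k_lt) mulr0 subr0; case: (nat_of_ord k) => [|m] /=.
    by rewrite !subr0 mulr1 mul0r addr0.
  by rewrite -[m.+2%:R]natr1 -[m.+1%:R]natr1; ring.
have mean_le : \sum_(k < K.+1) erlang K l k * k%:R <= K%:R.
  rewrite -[leRHS](sum_erlang_cst K _ l0); apply: ler_sum => k _.
  apply: ler_wpM2l; first exact: erlang_ge0.
  by rewrite ler_nat -ltnS.
have : l - l * erlang K l K - \sum_(k < K.+1) erlang K l k * k%:R = 0.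
  apply: (etrans _ inv); rewrite -[X in X - _ - _](sum_erlang_cst K _ l0) -(sum_erlang_top K l).
  rewrite mulr_sumr -!sumrB; apply: eq_bigr => k _; rewrite linkid; ring.
move=> eq0; have : l - l * erlang K l K <= K%:R by lra.
rewrite -[X in X - _]mulr1 -mulrBr mulrC -ler_pdivlMr// => h.
by lra.
Qed.

Lemma erlang_weight_pred (lam : R) K i : 0 < lam -> (0 < K)%N -> (i < K)%N ->
  erlang_weight (lam * K%:R) (K - i.+1) =
  (K - i)%:R / K%:R / lam * erlang_weight (lam * K%:R) (K - i).
Proof.
move=> lam0 K0 iK; have := erlang_weightS (lam * K%:R) (K - i.+1).
rewrite subnSK// => e.
have K0' : K%:R != 0 :> R by rewrite pnatr_eq0 -lt0n.
have lam0' : lam != 0 by rewrite gt_eqF.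
have -> : (K - i)%:R / K%:R / lam * erlang_weight (lam * K%:R) (K - i) =
   ((K - i)%:R * erlang_weight (lam * K%:R) (K - i)) / (lam * K%:R).
  by field; rewrite lam0' K0'.
by rewrite e; field; rewrite lam0' K0'.
Qed.

Lemma erlang_weight_top_le lam K i : 0 < lam -> (0 < K)%N -> (i <= K)%N ->
  erlang_weight (lam * K%:R) (K - i) <= lam^-1 ^+ i * erlang_weight (lam * K%:R) K.
Proof.
move=> lam0 K0; have l0 : 0 < lam * K%:R by rewrite mulr_gt0// ltr0n.
elim: i => [|i IH] iK; first by rewrite subn0 mul1r.
rewrite erlang_weight_pred// exprS.
have := IH (ltnW iK); set a := erlang_weight _ (K - i) => aE.
have -> : (K - i)%:R / K%:R / lam * a = lam^-1 * ((K - i)%:R / K%:R * a) by ring.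
rewrite -[leRHS]mulrA.
rewrite ler_wpM2l ?invr_ge0 ?(ltW lam0)// (le_trans _ aE)//.
rewrite ler_piMl ?(ltW (erlang_weight_gt0 l0 _))//.
by rewrite ler_pdivrMr ?ltr0n// mul1r ler_nat leq_subr.
Qed.

(** Ratios of successive weights within [m] levels of the top lie between [(1 - m / K) / lam] and
    [lam^-1], so seen from [K] the law is nearly geometric. *)
Lemma erlang_weight_top_ge lam K m i : 0 < lam -> (0 < K)%N -> (m <= K)%N -> (i <= m)%N ->
  ((1 - m%:R / K%:R) / lam) ^+ i * erlang_weight (lam * K%:R) K <=
  erlang_weight (lam * K%:R) (K - i).
Proof.
move=> lam0 K0 mK; have l0 : 0 < lam * K%:R by rewrite mulr_gt0// ltr0n.
have K0' : K%:R != 0 :> R by rewrite pnatr_eq0 -lt0n.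
elim: i => [|i IH] im; first by rewrite subn0 mul1r.
rewrite erlang_weight_pred// ?(leq_trans im)// exprS -mulrA.
apply: ler_pM => //.
- by rewrite divr_ge0 ?(ltW lam0)// subr_ge0 ler_pdivrMr ?ltr0n// mul1r ler_nat.
- rewrite mulr_ge0 ?exprn_ge0 ?(ltW (erlang_weight_gt0 l0 _))//.
  by rewrite divr_ge0 ?(ltW lam0)// subr_ge0 ler_pdivrMr ?ltr0n// mul1r ler_nat.
- rewrite ler_pM2r ?invr_gt0// ler_pdivlMr ?ltr0n// mulrBl mul1r divfK//.
  by rewrite natrB ?(leq_trans (ltnW im))// lerD2l lerN2 ler_nat ltnW.
- exact/IH/ltnW.
Qed.

Lemma ex_nat_gt x : exists N : nat, x < N%:R.
Proof.
exists (Num.Def.archi_bound `|x|); apply: le_lt_trans (ler_norm x) _.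
exact: archi_boundP.
Qed.

Lemma bernoulli (y : R) m : 0 <= y -> y <= 1 -> 1 - m%:R * y <= (1 - y) ^+ m.
Proof.
move=> y0 y1; elim: m => [|m IH]; first by rewrite mul0r subr0.
rewrite exprS -natr1.
have : (1 - y) * (1 - m%:R * y) <= (1 - y) * (1 - y) ^+ m.
  by rewrite ler_wpM2l// subr_ge0.
have : 0 <= m%:R * (y * y) by rewrite !mulr_ge0.
by lra.
Qed.

Lemma bernoulli_ge (y : R) m : 0 <= y -> 1 + m%:R * y <= (1 + y) ^+ m.
Proof.
move=> y0; elim: m => [|m IH]; first by rewrite mul0r addr0.
rewrite exprS -natr1.
have : (1 + y) * (1 + m%:R * y) <= (1 + y) * (1 + y) ^+ m.
  by rewrite ler_wpM2l// addr_ge0.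
have : 0 <= m%:R * (y * y) by rewrite !mulr_ge0.
by lra.
Qed.

(** The full series diverges if [lam <= 1] and otherwise sums to [1 / (1 - lam^-1)], which exceeds
    [1 / x]. *)
Lemma ex_geometric_gt lam x : 0 < lam -> 0 < x -> 1 - lam^-1 < x ->
  exists m : nat, 1 < x * \sum_(i < m) lam^-1 ^+ i.
Proof.
move=> lam0 x0 lamx; have [lam1|lam1] := leP lam 1.
  have [m xm] := ex_nat_gt x^-1; exists m.
  rewrite (lt_le_trans (y := x * m%:R))//.
    by rewrite -ltr_pdivrMl ?mulr1.
  rewrite ler_wpM2l ?(ltW x0)// -[leLHS]mulr_natl mulr1.
  rewrite -[X in X%:R <= _](card_ord m) -sumr_const; apply: ler_sum => i _.
  by rewrite exprn_ege1// invf_ge1.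
set q := lam^-1 in lamx *.
have q0 : 0 < q by rewrite invr_gt0.
have q1 : q < 1 by rewrite invf_lt1.
have d0 : 0 < x - (1 - q) by lra.
(* By Bernoulli's inequality for [lam ^+ m], this [m] makes [x * q ^+ m] smaller than the margin
   [x - (1 - q)]. *)
have [m xm] := ex_nat_gt ((x / (x - (1 - q))) / (lam - 1)); exists m.
have qm : x * q ^+ m < x - (1 - q).
  have big : x / (x - (1 - q)) < lam ^+ m.
    have := @bernoulli_ge (lam - 1) m; rewrite subr_ge0 (ltW lam1) => /(_ isT).
    have -> : 1 + (lam - 1) = lam by ring.
    apply: lt_le_trans.
    by move: xm; rewrite ltr_pdivrMr ?subr_gt0//; lra.
  rewrite /q exprVn ltr_pdivrMr ?exprn_gt0//.
  by rewrite ltr_pdivrMr// in big; rewrite mulrC.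
have geo : (1 - q) * \sum_(i < m) q ^+ i = 1 - q ^+ m.
  by rewrite -opprB mulNr -subrX1 opprB.
rewrite -(ltr_pM2l (_ : 0 < 1 - q)) ?subr_gt0// mulr1 mulrCA geo; lra.
Qed.

(* The inverse blocking probability is [\sum_i K (K - 1) .. (K - i + 1) / l ^ i]
   and tends to the geometric series of ratio [lam^-1]. *)
Lemma erlang_full_lt lam x : 0 < lam -> 0 < x -> 1 - lam^-1 < x ->
  exists K0 : nat, forall K, (K0 <= K)%N -> (0 < K)%N -> erlang K (lam * K%:R) K < x.
Proof.
move=> lam0 x0 lamx; have [m xm] := ex_geometric_gt lam0 x0 lamx.
set G := \sum_(i < m) _ in xm.
(* For finite [K] the first [m] terms lose a factor of at least [1 - m * m / K]; from [N] on this
   loss is covered by the excess [x * G - 1]. *)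
have [N Nm] := ex_nat_gt (m%:R * m%:R * (x * G) / (x * G - 1)).
exists (maxn m N) => K; rewrite geq_max => /andP[mK NK] K0.
have l0 : 0 < lam * K%:R by rewrite mulr_gt0// ltr0n.
have K0r : 0 < K%:R :> R by rewrite ltr0n.
rewrite /erlang ltr_pdivrMr ?erlang_const_gt0//.
set y := m%:R / K%:R : R.
have y0 : 0 <= y by rewrite divr_ge0.
have y1 : y <= 1 by rewrite ler_pdivrMr// mul1r ler_nat.
have bern : 1 - m%:R * y <= (1 - y) ^+ m by exact: bernoulli.
have const_ge : (1 - m%:R * y) * G * erlang_weight (lam * K%:R) K <= erlang_const K (lam * K%:R).
  rewrite /erlang_const (reindex_inj rev_ord_inj)/=.
  rewrite (eq_bigr (fun i : 'I_K.+1 => erlang_weight (lam * K%:R) (K - i))); last first.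
    by move=> i _; rewrite subSS.
  rewrite -(big_mkord xpredT (fun i => erlang_weight (lam * K%:R) (K - i))).
  rewrite (big_cat_nat (n := m))//= ?(leq_trans mK)//.
  rewrite -[leLHS]addr0 lerD//; last first.
    by apply: sumr_ge0 => i _; exact/ltW/erlang_weight_gt0.
  rewrite big_mkord mulr_sumr mulr_suml; apply: ler_sum => i _.
  have im : (i <= m)%N by exact: ltnW.
  rewrite (le_trans _ (erlang_weight_top_ge lam0 K0 mK im))// -/y.
  rewrite ler_wpM2r ?(ltW (erlang_weight_gt0 l0 _))// exprMn.
  rewrite ler_wpM2r ?exprn_ge0 ?invr_ge0 ?(ltW lam0)// (le_trans bern)//.
  by rewrite ler_wiXn2l// ?subr_ge0// gerBl.
have w0 := erlang_weight_gt0 l0 K.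
rewrite (lt_le_trans _ (ler_wpM2l (ltW x0) const_ge))// mulrA.
rewrite ltr_pMl//.
have d0 : 0 < x * G - 1 by rewrite subr_gt0.
have : m%:R * y * (x * G) < x * G - 1.
  rewrite ltr_pdivrMr// in Nm.
  have NK' : N%:R <= K%:R :> R by rewrite ler_nat.
  have -> : m%:R * y * (x * G) = m%:R * m%:R * (x * G) / K%:R by rewrite /y; ring.
  rewrite ltr_pdivrMr// (lt_le_trans Nm)// mulrC; apply: ler_wpM2l => //.
  exact: ltW.
by lra.
Qed.

Lemma erlang_top_le lam K i0 : 0 < lam -> (0 < K)%N -> (i0 <= K)%N ->
  \sum_(k < K.+1) erlang K (lam * K%:R) k * (K - i0 < k)%N%:R <=
  erlang K (lam * K%:R) K * \sum_(i < i0) lam^-1 ^+ i.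
Proof.
move=> lam0 K0 iK; have l0 : 0 < lam * K%:R by rewrite mulr_gt0// ltr0n.
have c0 := erlang_const_gt0 K l0.
rewrite (eq_bigr (fun k : 'I_K.+1 => (erlang_weight (lam * K%:R) k * (K - i0 < k)%N%:R)
   / erlang_const K (lam * K%:R))); last by move=> k _; rewrite /erlang; ring.
rewrite -mulr_suml /erlang mulrAC ler_pM2r ?invr_gt0//.
rewrite (reindex_inj rev_ord_inj)/=.
rewrite (eq_bigr (fun i : 'I_K.+1 => erlang_weight (lam * K%:R) (K - i) * (i < i0)%N%:R)); last first.
  by move=> i _; rewrite subSS ltn_sub2lE// -ltnS.
rewrite -(big_mkord xpredT (fun i => erlang_weight (lam * K%:R) (K - i) * (i < i0)%N%:R)).
rewrite (big_cat_nat (n := i0))//= ?(leq_trans iK)//.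
rewrite [X in _ + X]big_nat_cond [X in _ + X]big1 ?addr0; last first.
  by move=> i /andP[/andP[i0i _] _]; rewrite ltnNge i0i mulr0.
rewrite big_mkord mulr_sumr; apply: ler_sum => i _; rewrite ltn_ord mulr1 [leRHS]mulrC.
by rewrite erlang_weight_top_le// (leq_trans (ltnW (ltn_ord i))).
Qed.

(** The likelihood ratio of the two laws increases with [k]. Adding the double sum to its transpose
    leaves products of two factors of equal sign. *)
Lemma erlang_monotone K l l' (g : 'I_K.+1 -> R) : 0 < l -> l <= l' ->
  increasing g ->
  \sum_(k < K.+1) erlang K l k * g k <= \sum_(k < K.+1) erlang K l' k * g k.
Proof.
move=> l0 ll' g_inc; have l'0 : 0 < l' by exact: lt_le_trans ll'.
rewrite -[leLHS](sum_erlang_cst K _ l'0) -[leRHS](sum_erlang_cst K _ l0) -subr_ge0.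
set a := erlang K l; set b := erlang K l'.
have e : \sum_(i < K.+1) a i * (\sum_(k < K.+1) b k * g k) -
    \sum_(i < K.+1) b i * (\sum_(k < K.+1) a k * g k) =
    \sum_(i < K.+1) \sum_(k < K.+1) a i * b k * (g k - g i).
  have -> : \sum_(i < K.+1) b i * (\sum_(k < K.+1) a k * g k) =
     \sum_(i < K.+1) \sum_(k < K.+1) a i * b k * g i.
    under eq_bigr do rewrite mulr_sumr.
    rewrite exchange_big/=; apply: eq_bigr => i _; apply: eq_bigr => k _; ring.
  rewrite -sumrB; apply: eq_bigr => i _; rewrite mulr_sumr -sumrB.
  by apply: eq_bigr => k _; ring.
rewrite e; set T := \sum_(i < _) _.
have T2 : T + T = \sum_(i < K.+1) \sum_(k < K.+1) (a i * b k - a k * b i) * (g k - g i).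
  rewrite {2}/T exchange_big/= -big_split/=; apply: eq_bigr => i _.
  by rewrite -big_split/=; apply: eq_bigr => k _; ring.
suff : 0 <= T + T by lra.
have cross (i k : 'I_K.+1) : (i <= k)%N -> a k * b i <= a i * b k.
  move=> ik; have c := erlang_const_gt0 K l0; have c' := erlang_const_gt0 K l'0.
  have -> : a k * b i = l ^+ k * l' ^+ i *
      (k`!%:R^-1 * i`!%:R^-1 / erlang_const K l / erlang_const K l').
    by rewrite /a /b /erlang /erlang_weight; ring.
  have -> : a i * b k = l ^+ i * l' ^+ k *
      (k`!%:R^-1 * i`!%:R^-1 / erlang_const K l / erlang_const K l').
    by rewrite /a /b /erlang /erlang_weight; ring.
  rewrite ler_wpM2r//; first by rewrite !mulr_ge0// invr_ge0 ltW.
  rewrite -(subnK ik) !exprD.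
  have -> : l ^+ (k - i) * l ^+ i * l' ^+ i = l ^+ (k - i) * (l ^+ i * l' ^+ i) by ring.
  have -> : l ^+ i * (l' ^+ (k - i) * l' ^+ i) = l' ^+ (k - i) * (l ^+ i * l' ^+ i) by ring.
  rewrite ler_wpM2r//; first by rewrite mulr_ge0// exprn_ge0// ltW.
  by rewrite lerXn2r// nnegrE ltW.
rewrite T2; apply: sumr_ge0 => i _; apply: sumr_ge0 => k _.
have [ik|/ltnW ki] := leqP i k.
  by rewrite mulr_ge0 ?subr_ge0 ?cross// g_inc.
by rewrite -mulrNN !opprB mulr_ge0 ?subr_ge0 ?cross// g_inc.
Qed.

End ErlangEstimates.

(** * The interacting chain and its action on products over the links *)

Section Chain.
Variables (R : realType) (K n : nat).
Notation state := (state K n).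
Implicit Types (x y : state) (lam : state -> R) (f v : 'I_K.+1 -> R).

Definition upd x (j : 'I_n) (k : 'I_K.+1) : state :=
  [ffun i => if i == j then k else x i].

(** The common birth rate is an arbitrary function of the state, so that truncated dynamics are
    covered as well. *)
Definition chain lam : (state -> R) -> state -> R :=
  jump (fun (p : 'I_n * bool) x => if p.2 then lam x else (x p.1)%:R)
    (fun p x => upd x p.1 (if p.2 then up (x p.1) else dn (x p.1))).

Lemma chainE lam g x : chain lam g x =
  \sum_j (lam x * (g (upd x j (up (x j))) - g x) +
          (x j)%:R * (g (upd x j (dn (x j))) - g x)).
Proof.
rewrite /chain /jump -(pair_bigA _ (fun j (b : bool) =>
  (if b then lam x else (x j)%:R) *
  (g (upd x j (if b then up (x j) else dn (x j))) - g x)))/=.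
by apply: eq_bigr => j _; rewrite big_bool.
Qed.

Lemma linear_op_chain lam : linear_op (chain lam).
Proof. exact: linear_op_jump. Qed.

Lemma chain1 lam x : chain lam (fun=> 1) x = 0.
Proof. exact: jump1. Qed.

Lemma chain_shift_ge0 lam : (forall x, 0 <= lam x) -> exists c : R,
  forall g, (forall x, 0 <= g x) -> forall x, 0 <= shift_op c (chain lam) g x.
Proof.
move=> lam0; eexists; apply: jump_shift_ge0 => -[j []] x /=; first exact: lam0.
exact: ler0n.
Qed.

Definition dar_lam (alpha : R) x : R :=
  alpha * K%:R * (1 + 2 * full_prop R x * (1 - full_prop R x)).

Lemma raised_atE j x y :
  raised_at j x y = (x j < K)%N && (y == upd x j (up (x j))).
Proof.
apply/forallP/andP => [y_up|[xK /eqP ->] i]; last first.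
  rewrite ffunE; have [->|_] := eqVneq i j; last by rewrite /= addn0.
  by rewrite /= val_up (minn_idPl xK) addn1.
have xK : (x j < K)%N.
  by have /eqP := y_up j; rewrite eqxx addn1 => e; rewrite -e -ltnS.
split => //; apply/eqP/ffunP => i; rewrite ffunE; apply/ord_inj.
rewrite (eqP (y_up i)); have [->|_] := eqVneq i j; last by rewrite /= addn0.
by rewrite /= val_up (minn_idPl xK) addn1.
Qed.

Lemma lowered_atE j x y :
  raised_at j y x = (0 < x j)%N && (y == upd x j (dn (x j))).
Proof.
apply/forallP/andP => [y_dn|[x0 /eqP ->] i]; last first.
  rewrite ffunE; have [->|_] := eqVneq i j; last by rewrite /= addn0.
  by rewrite /= val_dn addn1 prednK.
have x0 : (0 < x j)%N by rewrite (eqP (y_dn j)) eqxx addn1.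
split => //; apply/eqP/ffunP => i; rewrite ffunE; apply/ord_inj.
have [ij|ij] := eqVneq i j.
  by rewrite val_dn -ij (eqP (y_dn i)) ij eqxx addn1.
by rewrite (eqP (y_dn i)) (negPf ij) addn0.
Qed.

Lemma upd_id x j : upd x j (x j) = x.
Proof. by apply/ffunP => i; rewrite ffunE; case: eqP => // ->. Qed.

Lemma gen_op_dar alpha : gen_op (@dar_rate R alpha K n) = chain (dar_lam alpha).
Proof.
apply/funext => g; apply/funext => x; rewrite chainE /gen_op /jump /dar_rate.
under eq_bigr do rewrite mulrDl !mulr_suml.
rewrite big_split/= [X in X + _](exchange_big_dep xpredT)//=.
rewrite [X in _ + X](exchange_big_dep xpredT)//= -big_split/=.
apply: eq_bigr => j _; congr (_ + _).
  under eq_bigl do rewrite raised_atE.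
  have [xK|Kx] := ltnP (x j) K; first by rewrite big_pred1_eq.
  (* A full link has no upward transition; in [chain] its birth is a move that changes nothing. *)
  rewrite big_pred0//; suff -> : up (x j) = x j by rewrite upd_id subrr mulr0.
  apply/ord_inj; rewrite val_up (minn_idPr (leqW Kx)).
  by apply/eqP; rewrite eqn_leq Kx -ltnS ltn_ord.
under eq_bigl do rewrite lowered_atE.
have [x0|] := ltnP 0 (x j); first by rewrite big_pred1_eq.
by rewrite leqn0 => /eqP ->; rewrite big_pred0// mul0r.
Qed.

Definition prodf f x : R := \prod_j f (x j).

Lemma prodf_upd f x j k : f (x j) != 0 ->
  prodf f (upd x j k) = prodf f x * (f k / f (x j)).
Proof.
move=> f0; rewrite /prodf (bigD1 j)//= [in RHS](bigD1 j)//= ffunE eqxx.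
rewrite (eq_bigr (fun i => f (x i))); last by move=> i /negPf ij; rewrite ffunE ij.
by rewrite [RHS]mulrC -mulrA mulKf.
Qed.

Lemma chain_prodf lam f x : (forall k, f k != 0) ->
  chain lam (prodf f) x = prodf f x * \sum_j link (lam x) f (x j) / f (x j).
Proof.
move=> f0; rewrite chainE mulr_sumr; apply: eq_bigr => j _.
rewrite !prodf_upd// linkE.
have {2 4}-> : prodf f x = prodf f x * (f (x j) / f (x j)) by rewrite divff ?mulr1.
by ring.
Qed.

Lemma is_derive_prod (I : Type) (r : seq I) (F : I -> R -> R) (dF : I -> R) (s : R) :
  (forall i, is_derive s 1 (F i) (dF i)) -> (forall i, F i s != 0) ->
  is_derive s 1 (fun t => \prod_(i <- r) F i t)
    ((\prod_(i <- r) F i s) * \sum_(i <- r) dF i / F i s).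
Proof.
move=> FdF F0; elim: r => [|i r IH].
  rewrite !big_nil mulr0 (_ : (fun _ => _) = cst 1); first exact: is_derive_cst.
  by apply/funext => t; rewrite big_nil.
rewrite !big_cons (_ : (fun _ => _) = fun t => F i t * \prod_(i <- r) F i t); last first.
  by apply/funext => t; rewrite big_cons.
apply: (is_derive_eq (is_derive_mul (FdF i) IH)).
rewrite mulrDr; congr (_ + _); last by rewrite mulrA.
by field; exact: F0.
Qed.

Section Tilt.
Variables (l eta sgn : R) (v : 'I_K.+1 -> R).
Hypotheses (l_ge0 : 0 <= l) (eta_ge0 : 0 <= eta) (eta_le1 : eta <= 1).
Hypothesis v01 : forall k, 0 <= v k <= 1.

(* The initial value is [\prod_j (1 + eta * v (x j))]; evolving each factor by the
   one-link semigroup gives a supersolution where the rates are on the right side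
   of [l]. *)
Definition relaxed (s : R) : 'I_K.+1 -> R := sg (link l) s v.
Definition tilted (s : R) : state -> R := prodf (fun k => 1 + eta * relaxed s k).

Lemma relaxed01 s k : 0 <= s -> 0 <= relaxed s k <= 1.
Proof.
move=> s0; have lin := @linear_op_link R K l.
apply/andP; split.
  apply: (sg_ge0 lin (fun f => @link_shift_ge0 R K l f l_ge0) _ s0) => p.
  by have /andP[] := v01 p.
rewrite -(sg_const lin (1 : R) k s0 (@link1 R K l)).
apply: (le_sg lin (fun f => @link_shift_ge0 R K l f l_ge0) _ s0) => p.
by have /andP[] := v01 p.
Qed.

Lemma tilted_factor_ge1 s k : 0 <= s -> 1 <= 1 + eta * relaxed s k.
Proof. by move=> s0; rewrite lerDl mulr_ge0//; have /andP[] := relaxed01 k s0. Qed.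

Lemma tilted_ge1 s x : 0 <= s -> 1 <= tilted s x.
Proof.
move=> s0; rewrite /tilted /prodf; elim/big_ind : _ => // [a b|j _]; first exact: mulr_ege1.
exact: tilted_factor_ge1.
Qed.

Lemma tilted_le s a x : 0 <= s -> (forall k, relaxed s k <= a) ->
  tilted s x <= expR (eta * a * n%:R).
Proof.
move=> s0 ra; rewrite expRM_natr -[X in _ ^+ X]card_ord.
rewrite -prodr_const; apply: ler_prod => j _.
rewrite (le_trans _ (tilted_factor_ge1 _ s0))//=.
by rewrite (le_trans _ (expR_ge1Dx _))// lerD2l ler_wpM2l.
Qed.

Definition tilted_deriv (s : R) x : R :=
  tilted s x * \sum_j (eta * link l (relaxed s) (x j)) / (1 + eta * relaxed s (x j)).

Lemma is_derive_tilted (s : R) x : 0 <= s ->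
  is_derive s 1 (fun r => tilted r x) (tilted_deriv s x).
Proof.
move=> s0; apply: is_derive_prod => j; last first.
  by rewrite gt_eqF// (lt_le_trans ltr01)// tilted_factor_ge1.
have := is_deriveD (is_derive_cst (1 : R) s 1)
  (is_derive_scale eta (is_derive_sg' (@linear_op_link R K l) s v (x j))).
by rewrite add0r.
Qed.

(** Deaths and births at rate [l] are absorbed by the evolution of the factors; only the excess of
    the birth rate over [l] remains. *)
Lemma chain_tiltedE lam s x : 0 <= s -> chain lam (tilted s) x - tilted_deriv s x =
  tilted s x * \sum_j (lam x - l) * eta * (relaxed s (up (x j)) - relaxed s (x j))
     / (1 + eta * relaxed s (x j)).
Proof.
move=> s0; rewrite chain_prodf; last first.
  by move=> k; rewrite gt_eqF// (lt_le_trans ltr01)// tilted_factor_ge1.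
rewrite /tilted_deriv -/(tilted s x) -mulrBr -sumrB; congr (_ * _).
by apply: eq_bigr => j _; rewrite -mulrBl; congr (_ / _); rewrite !linkE; ring.
Qed.

Hypotheses (sgn2 : sgn * sgn = 1) (sgn_v : increasing (fun k => sgn * v k)).

Lemma relaxed_increasing s : 0 <= s -> increasing (fun k => sgn * relaxed s k).
Proof.
move=> s0 k p kp; have := increasing_sg_link l_ge0 s0 sgn_v kp.
by rewrite !(linear_opZ (linear_op_sg (@linear_op_link R K l) s)).
Qed.

Lemma le_up (k : 'I_K.+1) : (k <= up k)%N.
Proof. by rewrite val_up leq_min leqnSn -ltnS ltn_ord. Qed.

(** [sgn] is 1 or -1 and treats together rates at most [l] with [v] increasing and rates at least
    [l] with [v] decreasing. Off [G] only a crude bound with [expR (eta * n)] is left; a small [eta]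
    lets the rarity of these states beat it. *)
Lemma chain_tilted_le lam (G : pred state) (B s : R) x : 0 <= s ->
  (G x -> sgn * (lam x - l) <= 0) -> `|lam x - l| <= B ->
  chain lam (tilted s) x - tilted_deriv s x <=
  expR (eta * n%:R) * (n%:R * B) * (~~ G x)%:R.
Proof.
move=> s0 lamG lamB; rewrite chain_tiltedE//.
have pos k : 0 < 1 + eta * relaxed s k by rewrite (lt_le_trans ltr01)// tilted_factor_ge1.
have t0 : 0 <= tilted s x by rewrite (le_trans ler01)// tilted_ge1.
have [Gx|_] := boolP (G x); rewrite ?mulr0 ?mulr1.
  rewrite mulr_ge0_le0// sumr_le0// => j _.
  rewrite pmulr_lle0 ?invr_gt0//.
  have inc : 0 <= sgn * (relaxed s (up (x j)) - relaxed s (x j)).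
    by rewrite mulrBr subr_ge0; exact: (relaxed_increasing s0 (le_up (x j))).
  have -> : (lam x - l) * eta * (relaxed s (up (x j)) - relaxed s (x j)) =
      eta * ((sgn * (lam x - l)) * (sgn * (relaxed s (up (x j)) - relaxed s (x j)))).
    by rewrite mulrACA sgn2; ring.
  by rewrite mulr_ge0_le0// mulr_le0_ge0// lamG.
have B0 : 0 <= B by exact: le_trans (normr_ge0 _) lamB.
have t_le : tilted s x <= expR (eta * n%:R).
  rewrite -[eta]mulr1; apply: tilted_le => // k.
  by have /andP[] := relaxed01 k s0.
apply: le_trans (_ : tilted s x * (n%:R * B) <= _); last first.
  by rewrite ler_wpM2r// mulr_ge0.
rewrite ler_wpM2l// mulr_natl -[X in _ *+ X]card_ord -sumr_const ler_sum// => j _.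
rewrite ler_pdivrMr// (le_trans (ler_norm _))// -[X in X <= _]mulr1.
rewrite ler_pM ?tilted_factor_ge1// !normrM -[B]mulr1 ler_pM ?mulr_ge0//.
  by rewrite -[B]mulr1 ler_pM// ger0_norm.
have /andP[a0 a1] := relaxed01 (up (x j)) s0; have /andP[b0 b1] := relaxed01 (x j) s0.
by rewrite ler_norml; apply/andP; split; lra.
Qed.

End Tilt.

Section Comparison.
Variables (l eta sgn : R) (v : 'I_K.+1 -> R).
Hypotheses (l_ge0 : 0 <= l) (eta_ge0 : 0 <= eta) (eta_le1 : eta <= 1).
Hypothesis v01 : forall k, 0 <= v k <= 1.
Hypotheses (sgn2 : sgn * sgn = 1) (sgn_v : increasing (fun k => sgn * v k)).

Lemma tilted_comparison lam (G : pred state) (B tau e : R) (nu : state -> R) :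
  (forall x, 0 <= lam x) -> (forall x, G x -> sgn * (lam x - l) <= 0) ->
  (forall x, `|lam x - l| <= B) ->
  0 <= tau -> (forall x, 0 <= nu x) ->
  (forall r, 0 <= r -> r <= tau ->
    \sum_x nu x * sg (chain lam) r (fun y => (~~ G y)%:R) x <= e) ->
  \sum_x nu x * sg (chain lam) tau (tilted l eta v 0) x <=
  \sum_x nu x * tilted l eta v tau x + tau * (expR (eta * n%:R) * (n%:R * B) * e).
Proof.
move=> lam0 lamG lamB tau0 nu0 escape; have lin := linear_op_chain lam.
have [c posC] := chain_shift_ge0 lam0.
apply: (sg_super lin tau0 (u' := tilted_deriv l eta v)).
  by move=> s x s0 _; exact: is_derive_tilted.
move=> s s0 st; have ts0 : 0 <= tau - s by rewrite subr_ge0.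
set M := expR _ * _.
rewrite (@le_trans _ _ (M * \sum_x nu x * sg (chain lam) (tau - s) (fun y => (~~ G y)%:R) x))//.
  rewrite mulr_sumr; apply: ler_sum => x _.
  rewrite mulrCA ler_wpM2l// -(linear_opZ (linear_op_sg lin _)).
  apply: (le_sg lin posC _ ts0) => y.
  apply: (@chain_tilted_le l eta sgn v) => //; exact: lamG.
have B0 : 0 <= B by apply: le_trans (lamB [ffun=> ord0]); exact: normr_ge0.
rewrite ler_wpM2l ?mulr_ge0 ?expR_ge0// escape// gerBl//.
Qed.

End Comparison.
End Chain.

(** * Control of the occupancy by independent links, up to rare events *)

Section Stage.
Variables (R : realType) (K : nat).

(** With [z = y - y * y]: [expR z * (1 - z) <= 1], while [(1 + y) * (1 - z) = 1 + y ^+ 3]. *)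
Lemma expR_quadratic (y : R) : 0 <= y -> y <= 1 -> expR (y - y * y) <= 1 + y.
Proof.
move=> y0 y1; have := expR_ge1Dx (- (y - y * y)).
have := expRxMexpNx_1 (y - y * y); have := expR_gt0 (y - y * y).
set E := expR _; set F := expR _ => E0 EF F_ge.
have q0 : 0 < 1 + - (y - y * y) by nra.
have : E * (1 + - (y - y * y)) <= (1 + y) * (1 + - (y - y * y)).
  apply: (@le_trans _ _ 1); first by have := ler_wpM2l (ltW E0) F_ge; rewrite EF.
  have : 0 <= y * y * y by rewrite !mulr_ge0.
  lra.
by rewrite ler_pM2r.
Qed.

Lemma expR_dominates_linear (A c : R) : 0 < c -> exists N : nat,
  forall n, (N <= n)%N -> 1 + A * n%:R <= expR (c * n%:R).
Proof.
move=> c0; have [N NA] := ex_nat_gt (2 * A / (c * c)); exists N => n Nn.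
apply: le_trans (@expR_ge1Dxn _ (c * n%:R) 1 _); last by rewrite mulr_ge0// ltW.
rewrite lerD2l ler_pdivlMr// expr2.
have : 2 * A <= c * c * n%:R.
  rewrite -ler_pdivrMl ?mulr_gt0// mulrC (le_trans (ltW NA))//.
  by rewrite ler_nat.
move=> /(ler_wpM2r (ler0n R n)); rewrite -[2`!]/2%N; lra.
Qed.

Lemma lipschitz_unit (v : 'I_K.+1 -> R) : (forall k, 0 <= v k <= 1) -> lipschitz_link 1 v.
Proof.
move=> v01 k p; rewrite leq_eqVlt => /predU1P[kp|kp].
  by rewrite (ord_inj kp) !subrr normr0 mulr0.
have /andP[? ?] := v01 k; have /andP[? ?] := v01 p.
have : (k.+1)%:R <= p%:R :> R by rewrite ler_nat.
rewrite -natr1 mul1r => kp1; apply: (@le_trans _ _ 1); last by lra.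
by rewrite ler_norml; apply/andP; split; lra.
Qed.

Section FixedSize.
Variable n : nat.
Implicit Types (x : state K n) (lam : state K n -> R).

Definition load (v : 'I_K.+1 -> R) x : R := \sum_j v (x j).

Lemma load0 v x : n = 0%N -> load v x = 0.
Proof.
move=> n0; apply: big1 => j _; have := leq_ltn_trans (leq0n j) (ltn_ord j).
by rewrite lt0n => /eqP /(_ n0).
Qed.

Definition is_full (k : 'I_K.+1) : R := (k == K :> nat)%:R.

Lemma load_full x : (0 < n)%N -> load is_full x = full_prop R x * n%:R.
Proof.
move=> n0; rewrite /full_prop divfK ?pnatr_eq0 -?lt0n// /load /is_full -natr_sum.
by rewrite -sum1_card -big_mkcond.
Qed.

Lemma full_prop01 x : 0 <= full_prop R x <= 1.
Proof.
rewrite /full_prop divr_ge0//=.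
have full_le : #|[pred j | x j == K :> nat]|%:R <= n%:R :> R.
  by rewrite ler_nat -[X in (_ <= X)%N]card_ord max_card.
have [n0|n0] := posnP n; last by rewrite ler_pdivrMr ?ltr0n// mul1r.
by rewrite [X in _ / X](_ : _ = 0) ?invr0 ?mulr0// n0.
Qed.

Lemma dar_lam_bounds (alpha : R) x : 0 <= alpha ->
  alpha * K%:R <= dar_lam alpha x <= 3 / 2 * alpha * K%:R.
Proof.
move=> a0; have /andP[] := full_prop01 x; set f := full_prop R x => f0 f1.
have aK : 0 <= alpha * K%:R by rewrite mulr_ge0.
have f_f : 0 <= f * (1 - f) by rewrite mulr_ge0// subr_ge0.
have f_q : f * (1 - f) <= 1 / 4 by have := sqr_ge0 (2 * f - 1); lra.
rewrite /dar_lam -/f; apply/andP; split.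
  by rewrite -[leLHS]mulr1 ler_wpM2l//; lra.
rewrite [leRHS](_ : _ = alpha * K%:R * (3 / 2)); last by ring.
by rewrite ler_wpM2l//; lra.
Qed.

Variables (l eta sgn : R) (v : 'I_K.+1 -> R).
Hypotheses (l_ge0 : 0 <= l) (eta_ge0 : 0 <= eta) (eta_le1 : eta <= 1).
Hypothesis v01 : forall k, 0 <= v k <= 1.
Hypotheses (sgn2 : sgn * sgn = 1) (sgn_v : increasing (fun k => sgn * v k)).

Lemma tilted0_ge x : expR ((eta - eta * eta) * load v x) <= tilted l eta v 0 x.
Proof.
rewrite /load mulr_sumr expR_sum /tilted /prodf; apply: ler_prod => j _.
rewrite expR_ge0 /= /relaxed sg0.
have /andP[v0 v1] := v01 (x j).
apply: le_trans (expR_quadratic _ _); [|exact: mulr_ge0|exact: mulr_ile1].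
rewrite ler_expR; have : 0 <= eta * eta * (v (x j) * (1 - v (x j))).
  by rewrite !mulr_ge0// subr_ge0.
by lra.
Qed.

(** Exponential Markov inequality; the loss from [eta] to [eta - eta * eta] is the price of factors
    [1 + eta * v] in place of exponentials. *)
Lemma sg_load_ge lam (nu : state K n -> R) (t a : R) :
  (forall x, 0 <= lam x) -> (forall x, 0 <= nu x) -> 0 <= t ->
  \sum_x nu x * sg (chain lam) t (fun y => (a * n%:R <= load v y)%R%:R) x <=
  expR (- ((eta - eta * eta) * a * n%:R)) *
    \sum_x nu x * sg (chain lam) t (tilted l eta v 0) x.
Proof.
move=> lam0 nu0 t0; have [c posC] := chain_shift_ge0 lam0.
have lin := linear_op_chain lam.
rewrite mulr_sumr; apply: ler_sum => x _; rewrite mulrCA ler_wpM2l//.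
rewrite -(linear_opZ (linear_op_sg lin t)); apply: (le_sg lin posC _ t0) => y.
have [load_ge|_] := boolP (a * n%:R <= load v y); last first.
  by rewrite mulr_ge0 ?expR_ge0// (le_trans ler01)// tilted_ge1.
rewrite (le_trans _ (ler_wpM2l (expR_ge0 _) (tilted0_ge y)))//.
have -> : true%:R = expR 0 :> R by rewrite expR0.
rewrite -expRD ler_expR addrC -mulrA -mulrBr.
by rewrite mulr_ge0// subr_ge0// ler_piMl.
Qed.

(** The comparison starts from the law at time [T], when being outside [G] has become unlikely, and
    lasts for the time [tau] in which single links relax. *)
Lemma stage_bound lam (G : pred (state K n)) (B T tau e a a' : R) x :
  (forall x, 0 <= lam x) -> (forall x, G x -> sgn * (lam x - l) <= 0) ->
  (forall x, `|lam x - l| <= B) -> 0 <= T -> 0 <= tau ->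
  (forall r y, T <= r -> sg (chain lam) r (fun z => (~~ G z)%:R) y <= e) ->
  (forall k, relaxed l v tau k <= a') ->
  sg (chain lam) (T + tau) (fun y => (a * n%:R <= load v y)%R%:R) x <=
  expR (- ((eta - eta * eta) * a * n%:R)) *
    (expR (eta * a' * n%:R) + tau * (expR (eta * n%:R) * (n%:R * B) * e)).
Proof.
move=> lam0 lamG lamB T0 tau0 escape rel.
have lin := linear_op_chain lam; have [c posC] := chain_shift_ge0 lam0.
pose nu y := sg (chain lam) T (delta R y) x.
have delta_ge0 y z : 0 <= delta R y z :> R by rewrite /delta ler0n.
have nu0 y : 0 <= nu y by apply: (sg_ge0 lin posC _ T0) => z; exact: delta_ge0.
have nuE g : \sum_y nu y * g y = sg (chain lam) T g x.
  by rewrite (linear_opE (linear_op_sg lin T)); apply: eq_bigr => y _; exact: mulrC.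
rewrite -(sgD lin)// -nuE (le_trans (sg_load_ge _ lam0 nu0 tau0))//.
rewrite ler_wpM2l ?expR_ge0//.
apply: (le_trans (@tilted_comparison R K n l eta sgn v l_ge0 eta_ge0 eta_le1 v01 sgn2
  sgn_v lam G B tau e nu lam0 lamG lamB tau0 nu0 _)).
  move=> r r0 _; rewrite nuE (sgD lin)//; apply: escape.
  by rewrite lerDl.
rewrite lerD2r nuE -(sg_const lin (expR (eta * a' * n%:R)) x T0 (chain1 lam)).
by apply: (le_sg lin posC _ T0) => y; exact: tilted_le.
Qed.

End FixedSize.

Section Rare.
Variable alpha : R.
Hypothesis alpha_gt0 : 0 < alpha.

Definition dar n : (state K n -> R) -> state K n -> R := chain (@dar_lam R K n alpha).

Lemma dar_lam_ge0 n (x : state K n) : 0 <= dar_lam alpha x.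
Proof.
have /andP[+ _] := dar_lam_bounds x (ltW alpha_gt0); apply: le_trans.
by rewrite mulr_ge0// ltW.
Qed.

Lemma linear_op_dar n : linear_op (@dar n).
Proof. exact: linear_op_chain. Qed.

Lemma dar_pos n : exists c : R, forall g, (forall x, 0 <= g x) ->
  forall x, 0 <= shift_op c (@dar n) g x.
Proof. exact: (chain_shift_ge0 (@dar_lam_ge0 n)). Qed.

(* The time and the constants may depend on [K]. *)
Definition rare (bad : forall n, pred (state K n)) : Prop :=
  exists (T c : R) (N : nat), [/\ 0 <= T, 0 < c &
    forall n, (N <= n)%N -> forall x : state K n,
      sg (@dar n) T (fun y => (bad n y)%:R) x <= expR (- (c * n%:R))].

Lemma rare_later n (bad : pred (state K n)) (T e r : R) : 0 <= T -> T <= r ->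
  (forall x, sg (@dar n) T (fun y => (bad y)%:R) x <= e) ->
  forall x, sg (@dar n) r (fun y => (bad y)%:R) x <= e.
Proof.
move=> T0 Tr bound x; have lin := @linear_op_dar n; have [c pos] := @dar_pos n.
have r0 : 0 <= r - T by rewrite subr_ge0.
rewrite -(subrK T r) -(sgD lin)//.
rewrite -[leRHS](sg_const lin e x r0 (@chain1 R K n _)).
exact: (le_sg lin pos _ r0).
Qed.

Lemma rareU b1 b2 : rare b1 -> rare b2 -> rare (fun n x => b1 n x || b2 n x).
Proof.
move=> [T1 [c1 [N1 [T10 c10 bound1]]]] [T2 [c2 [N2 [T20 c20 bound2]]]].
pose c := Num.min c1 c2; have c0 : 0 < c by rewrite lt_min c10.
have [N N_lin] := @expR_dominates_linear 1 (c / 2) (divr_gt0 c0 (ltr0n _ 2)).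
exists (Num.max T1 T2), (c / 2), (maxn (maxn N1 N2) (maxn N 1)).
split; [by rewrite le_max T10|exact: divr_gt0|move=> n].
rewrite !geq_max => /andP[/andP[N1n N2n] /andP[Nn n1]] x.
have lin := @linear_op_dar n; have [d pos] := @dar_pos n.
have t0 : 0 <= Num.max T1 T2 by rewrite le_max T10.
have e1 : sg (@dar n) (Num.max T1 T2) (fun y => (b1 n y)%:R) x <= expR (- (c * n%:R)).
  apply: (rare_later T10); first by rewrite le_max lexx.
  move=> y; rewrite (le_trans (bound1 n N1n y))// ler_expR lerN2 ler_wpM2r//.
  by rewrite ge_min lexx.
have e2 : sg (@dar n) (Num.max T1 T2) (fun y => (b2 n y)%:R) x <= expR (- (c * n%:R)).
  apply: (rare_later T20); first by rewrite le_max lexx orbT.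
  move=> y; rewrite (le_trans (bound2 n N2n y))// ler_expR lerN2 ler_wpM2r//.
  by rewrite ge_min lexx orbT.
have sub : sg (@dar n) (Num.max T1 T2) (fun y => (b1 n y || b2 n y)%:R) x <=
    sg (@dar n) (Num.max T1 T2) (fun y => 1 * (b1 n y)%:R + (b2 n y)%:R) x.
  apply: (le_sg lin pos _ t0) => y; rewrite mul1r -natrD ler_nat.
  by case: (b1 n y); case: (b2 n y).
rewrite (le_trans sub)// (linear_op_sg lin) mul1r (le_trans (lerD e1 e2))//.
set E := expR (- (c * n%:R)).
have two_le : 2 <= expR (c / 2 * n%:R).
  by apply: le_trans (N_lin n Nn); rewrite mul1r (_ : 2 = 1 + 1)// lerD2l ler1n.
have -> : expR (- (c / 2 * n%:R)) = expR (c / 2 * n%:R) * E.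
  by rewrite -expRD; congr expR; field.
have : 2 * E <= expR (c / 2 * n%:R) * E by rewrite ler_wpM2r ?expR_ge0.
by lra.
Qed.

(** The gap between the equilibrium mean [m] and [a] is shared: one half, up to [a'], for the
    relaxation of a link, the other for the large deviation bound. *)
Lemma rare_stage (bad : forall n, pred (state K n)) (l sgn a : R) (v : 'I_K.+1 -> R) :
  (0 < K)%N -> 0 < l -> rare bad ->
  (forall n (x : state K n), ~~ bad n x -> sgn * (dar_lam alpha x - l) <= 0) ->
  (forall k, 0 <= v k <= 1) -> sgn * sgn = 1 -> increasing (fun k => sgn * v k) ->
  \sum_(k < K.+1) erlang K l k * v k < a ->
  rare (fun n x => a * n%:R <= load v x).
Proof.
move=> K0 l0 [T [c [N [T0 c0 bound]]]] good v01 sgn2 sgn_v.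
set m := \sum_(k < _) _ => ma.
have m0 : 0 <= m.
  by apply: sumr_ge0 => k _; rewrite mulr_ge0 ?erlang_ge0//; case/andP: (v01 k).
pose a' := (m + a) / 2.
have a0 : 0 < a by exact: le_lt_trans ma.
(* Since [tau <= expR tau], this gives [K * expR (- tau) <= a' - m]: the initial occupancy of a link
   is nearly forgotten. *)
pose tau := K%:R / (a' - m).
have gap : 0 < a' - m by rewrite /a'; lra.
have tau0 : 0 <= tau by rewrite divr_ge0// ltW.
have rel k : relaxed l v tau k <= a'.
  have step p : relaxed l v tau k - relaxed l v tau p <= a' - m.
    apply: le_trans (sg_link_lipschitz k p K0 (ltW l0) tau0 (lipschitz_unit v01)) _.
    rewrite expRN ler_pdivrMr ?expR_gt0// mulrC -ler_pdivrMr// -/tau.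
    by apply: le_trans (expR_ge1Dx tau); rewrite lerDr.
  have : \sum_(p < K.+1) erlang K l p * (relaxed l v tau k - relaxed l v tau p) <= a' - m.
    rewrite -[leRHS](sum_erlang_cst K _ l0); apply: ler_sum => p _.
    by rewrite ler_wpM2l ?erlang_ge0.
  under eq_bigr do rewrite mulrBr.
  rewrite sumrB sum_erlang_cst// /relaxed sum_erlang_sg -/m.
  by rewrite lerD2r.
(* [c / 2] lets the rarity of [bad] beat [expR (eta * n)]; the last bound gives
   [(1 - eta) * a >= (a + a') / 2], above [a']. *)
pose eta := Num.min (Num.min 1 (c / 2)) ((a - a') / (2 * a)).
have aa' : 0 < a - a' by rewrite /a'; lra.
have eta0 : 0 < eta by rewrite !lt_min ltr01 !divr_gt0// mulr_gt0.
have eta1 : eta <= 1 by rewrite !ge_min lexx.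
have etac : eta <= c / 2 by rewrite !ge_min lexx orbT.
have etaa : eta * a <= (a - a') / 2.
  rewrite -ler_pdivlMr// (le_trans (_ : _ <= (a - a') / (2 * a)))//.
    by rewrite !ge_min lexx !orbT.
  by rewrite invfM mulrA.
pose B := 3 / 2 * alpha * K%:R + l.
have lamB n (x : state K n) : `|dar_lam alpha x - l| <= B.
  have /andP[? ?] := dar_lam_bounds x (ltW alpha_gt0).
  have ? : 0 <= alpha * K%:R by rewrite mulr_ge0// ltW.
  by rewrite /B ler_norml; apply/andP; split; lra.
(* A common exponent for both error terms; half of it will absorb the factor [1 + tau * B * n]. *)
pose d := Num.min (eta * ((a - a') / 2)) (c / 2).
have d0 : 0 < d by rewrite lt_min !mulr_gt0// invr_gt0.
have [N' N'_lin] := @expR_dominates_linear (tau * B) (d / 2) (divr_gt0 d0 (ltr0n _ 2)).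
exists (T + tau), (d / 2), (maxn N N'); split; [exact: addr_ge0|exact: divr_gt0|].
move=> n; rewrite geq_max => /andP[Nn N'n] x.
have escape r y : T <= r ->
    sg (@dar n) r (fun z => (~~ ~~ bad n z)%:R) y <= expR (- (c * n%:R)).
  move=> Tr; under eq_fun do rewrite negbK.
  exact: (rare_later T0 Tr (bound n Nn)).
have := @stage_bound n l eta sgn v (ltW l0) (ltW eta0) eta1 v01 sgn2 sgn_v
  (@dar_lam R K n alpha) (fun z => ~~ bad n z) B T tau (expR (- (c * n%:R))) a a' x
  (@dar_lam_ge0 n) (good n) (lamB n) T0 tau0 escape rel.
move/le_trans; apply.
have n0 : 0 <= n%:R :> R by [].
have first_le : expR (- ((eta - eta * eta) * a * n%:R)) * expR (eta * a' * n%:R) <=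
    expR (- (d * n%:R)).
  rewrite -expRD ler_expR.
  have : d * n%:R <= eta * ((a - a') / 2) * n%:R.
    by rewrite ler_wpM2r// ge_min lexx.
  have : eta * (eta * a) * n%:R <= eta * ((a - a') / 2) * n%:R.
    by rewrite ler_wpM2r// ler_wpM2l// ltW.
  by lra.
have second_le : expR (- ((eta - eta * eta) * a * n%:R)) *
   (tau * (expR (eta * n%:R) * (n%:R * B) * expR (- (c * n%:R)))) <=
   tau * B * n%:R * expR (- (d * n%:R)).
  have B0 : 0 <= B by exact: le_trans (normr_ge0 _) (lamB n x).
  have -> : expR (- ((eta - eta * eta) * a * n%:R)) *
   (tau * (expR (eta * n%:R) * (n%:R * B) * expR (- (c * n%:R)))) =
   tau * B * n%:R * (expR (- ((eta - eta * eta) * a * n%:R)) *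
      expR (eta * n%:R) * expR (- (c * n%:R))) by ring.
  apply: ler_wpM2l; first exact: mulr_ge0 (mulr_ge0 tau0 B0) n0.
  rewrite -!expRD ler_expR.
  have : d * n%:R <= c / 2 * n%:R by rewrite ler_wpM2r// ge_min lexx orbT.
  have : eta * n%:R <= c / 2 * n%:R by rewrite ler_wpM2r.
  have : 0 <= (eta - eta * eta) * a * n%:R.
    by rewrite !mulr_ge0 ?(ltW a0)// subr_ge0 ler_piMl// ltW.
  by lra.
rewrite mulrDr (le_trans (lerD first_le second_le))//.
rewrite -[X in X + _]mul1r -mulrDl.
apply: (le_trans (ler_wpM2r (expR_ge0 _) (N'_lin n N'n))).
by rewrite -expRD ler_expR; lra.
Qed.

End Rare.
End Stage.

(** * Synchronous coupling of two copies *)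

Section Coupling.
Variables (R : realType) (K n : nat).
Notation state := (state K n).
Implicit Types (x y : state) (z : state * state) (lam : state -> R) (p q : 'I_K.+1).

Definition move_rate lam (b : bool) (j : 'I_n) x : R := if b then lam x else (x j)%:R.
Definition move (b : bool) (j : 'I_n) x : state :=
  upd x j (if b then up (x j) else dn (x j)).

(* [None]: both copies make the move; [Some true], [Some false]: only the first,
   only the second one does. *)
Definition coupled_rate lam (i : 'I_n * bool * option bool) z : R :=
  let a := move_rate lam i.1.2 i.1.1 z.1 in
  let a' := move_rate lam i.1.2 i.1.1 z.2 in
  match i.2 with
  | None => Num.min a a'
  | Some true => a - Num.min a a'
  | Some false => a' - Num.min a a'
  end.

Definition coupled_move (i : 'I_n * bool * option bool) z : state * state :=
  (if i.2 is Some false then z.1 else move i.1.2 i.1.1 z.1,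
   if i.2 is Some true then z.2 else move i.1.2 i.1.1 z.2).

Definition coupled lam : (state * state -> R) -> state * state -> R :=
  jump (coupled_rate lam) coupled_move.

Lemma linear_op_coupled lam : linear_op (coupled lam).
Proof. exact: linear_op_jump. Qed.

Lemma coupled1 lam z : coupled lam (fun=> 1) z = 0.
Proof. exact: jump1. Qed.

Lemma coupled_pos lam : (forall x, 0 <= lam x) -> exists c : R,
  forall g, (forall z, 0 <= g z) -> forall z, 0 <= shift_op c (coupled lam) g z.
Proof.
move=> lam0; eexists; apply: jump_shift_ge0 => -[[j b] o] z.
have rate0 x : 0 <= move_rate lam b j x by rewrite /move_rate; case: b.
rewrite /coupled_rate /=; case: o => [[]|].
- by rewrite subr_ge0 ge_min lexx.
- by rewrite subr_ge0 ge_min lexx orbT.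
- by rewrite le_min !rate0.
Qed.

Lemma sum_option_bool (F : option bool -> R) :
  \sum_o F o = F None + F (Some true) + F (Some false).
Proof.
rewrite (bigD1 None)//= -addrA; congr (_ + _).
rewrite (bigD1 (Some true))//=; congr (_ + _).
by rewrite (big_pred1 (Some false))// => -[[]|].
Qed.

Lemma coupledE lam g x y : coupled lam g (x, y) = \sum_j \sum_(b : bool)
  let a := move_rate lam b j x in let a' := move_rate lam b j y in
  (Num.min a a' * (g (move b j x, move b j y) - g (x, y)) +
   (a - Num.min a a') * (g (move b j x, y) - g (x, y)) +
   (a' - Num.min a a') * (g (x, move b j y) - g (x, y))).
Proof.
rewrite /coupled /jump pair_big/= -(pair_bigA _ (fun (p : 'I_n * bool) o =>
  coupled_rate lam (p, o) (x, y) * (g (coupled_move (p, o) (x, y)) - g (x, y))))/=.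
by apply: eq_bigr => -[j b] _; rewrite sum_option_bool.
Qed.

Lemma chain_moveE lam f x :
  chain lam f x = \sum_j \sum_(b : bool) move_rate lam b j x * (f (move b j x) - f x).
Proof. by rewrite chainE; apply: eq_bigr => j _; rewrite big_bool. Qed.

Lemma coupled_fst lam f z : coupled lam (fun w => f w.1) z = chain lam f z.1.
Proof.
case: z => x y; rewrite coupledE chain_moveE; apply: eq_bigr => j _.
by apply: eq_bigr => b _ /=; ring.
Qed.

Lemma coupled_snd lam f z : coupled lam (fun w => f w.2) z = chain lam f z.2.
Proof.
case: z => x y; rewrite coupledE chain_moveE; apply: eq_bigr => j _.
by apply: eq_bigr => b _ /=; ring.
Qed.

Lemma sg_coupled_fst lam t f z :
  sg (coupled lam) t (fun w => f w.1) z = sg (chain lam) t f z.1.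
Proof.
rewrite /sg; congr eser; apply/funext => k; elim: k z => //= k IH z.
by rewrite -coupled_fst; congr (coupled lam _ z); apply/funext => w; exact: IH.
Qed.

Lemma sg_coupled_snd lam t f z :
  sg (coupled lam) t (fun w => f w.2) z = sg (chain lam) t f z.2.
Proof.
rewrite /sg; congr eser; apply/funext => k; elim: k z => //= k IH z.
by rewrite -coupled_snd; congr (coupled lam _ z); apply/funext => w; exact: IH.
Qed.

Section Distance.
Variable W : 'I_K.+1 -> R.
Hypothesis W_inc : increasing W.

Definition gap p q : R := `|W p - W q|.
Definition distance z : R := \sum_j gap (z.1 j) (z.2 j).

Lemma distance_upd x y j p q :
  distance (upd x j p, upd y j q) - distance (x, y) = gap p q - gap (x j) (y j).
Proof.
rewrite /distance (bigD1 j)//= [X in _ - X](bigD1 j)//= !ffunE eqxx.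
rewrite (eq_bigr (fun i => gap (x i) (y i))); first by ring.
by move=> i /negPf ij; rewrite !ffunE ij.
Qed.

(** Drift of the gap at one link when both copies have birth rate [m]; the surplus births of one
    copy are counted apart. *)
Definition merged_drift (m : R) p q : R :=
  m * (gap (up p) (up q) - gap p q) +
  (Num.min p%:R q%:R * (gap (dn p) (dn q) - gap p q) +
   (p%:R - Num.min p%:R q%:R) * (gap (dn p) q - gap p q) +
   (q%:R - Num.min p%:R q%:R) * (gap p (dn q) - gap p q)).

Lemma coupled_distance lam x y : lam y <= lam x ->
  coupled lam distance (x, y) = \sum_j
    (merged_drift (lam y) (x j) (y j) +
     (lam x - lam y) * (gap (up (x j)) (y j) - gap (x j) (y j))).
Proof.
move=> yx; rewrite coupledE; apply: eq_bigr => j _; rewrite big_bool /=.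
rewrite /move_rate (min_idPr yx) subrr mul0r addr0 /move.
have left_move p : distance (upd x j p, y) - distance (x, y) =
    gap p (y j) - gap (x j) (y j) by rewrite -distance_upd upd_id.
have right_move q : distance (x, upd y j q) - distance (x, y) =
    gap (x j) q - gap (x j) (y j) by rewrite -distance_upd upd_id.
by rewrite !distance_upd !left_move right_move /merged_drift; ring.
Qed.

Lemma gapC p q : gap p q = gap q p.
Proof. by rewrite /gap distrC. Qed.

Lemma gap_le p q : (p <= q)%N -> gap p q = W q - W p.
Proof. by move=> pq; rewrite /gap distrC ger0_norm// subr_ge0 W_inc. Qed.

Lemma merged_driftC m p q : merged_drift m p q = merged_drift m q p.
Proof.
rewrite /merged_drift minC (gapC p q) (gapC (up p)) (gapC (dn p) (dn q)).
by rewrite (gapC (dn p) q) (gapC p (dn q)); ring.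
Qed.

(** Merged moves keep the order of the two occupancies, a lone death hitting only the larger one;
    without absolute values the drift is linear in [W]. *)
Lemma merged_drift_le m p q : (p <= q)%N ->
  merged_drift m p q = link m W q - link m W p.
Proof.
move=> pq; have pq' : p%:R <= q%:R :> R by rewrite ler_nat.
rewrite /merged_drift (min_idPl pq') subrr mul0r addr0 !linkE.
have up_pq : (up p <= up q)%N.
  by rewrite !val_up leq_min geq_minr andbT geq_min ltnS pq.
have dn_pq : (dn p <= dn q)%N by rewrite !val_dn -!subn1 leq_sub2r.
rewrite (gap_le pq) (gap_le up_pq) (gap_le dn_pq).
move: pq; rewrite leq_eqVlt => /predU1P[/ord_inj ->|pq]; first by ring.
have pdq : (p <= dn q)%N by rewrite val_dn -ltnS (leq_trans pq)// leqSpred.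
by rewrite (gap_le pdq); ring.
Qed.

Lemma gap_up_le p q : gap (up p) q - gap p q <= W (up p) - W p.
Proof.
have up_ge : W p <= W (up p) by exact/W_inc/le_up.
rewrite lerBlDr /gap -[W (up p) - W p]ger0_norm ?subr_ge0//.
by apply: le_trans (ler_normD _ _); rewrite addrA subrK.
Qed.

(* The last terms are the extra gain when exactly one of the two links is full,
   which compensates the difference of the birth rates of the two copies. *)
Definition contracting (m kappa w : R) := forall p q, (p <= q)%N ->
  link m W q + kappa * W q + m * w * is_full R q <=
  link m W p + kappa * W p + m * w * is_full R p.

Lemma merged_drift_contracting m kappa w p q : contracting m kappa w ->
  merged_drift m p q <= - kappa * gap p q - m * w * `|is_full R p - is_full R q|.
Proof.
move=> ctr; wlog pq : p q / (p <= q)%N => [hwlog|].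
  have [|/ltnW qp] := leqP p q; first exact: hwlog.
  by rewrite merged_driftC gapC distrC hwlog.
rewrite merged_drift_le// gap_le//.
have full_le : is_full R p <= is_full R q.
  rewrite /is_full ler_nat; case: eqP => // pK; rewrite pK in pq.
  suff -> : (q : nat) == K by [].
  by rewrite eqn_leq pq andbT -ltnS ltn_ord.
by rewrite distrC ger0_norm ?subr_ge0//; have := ctr p q pq; lra.
Qed.

Lemma gap_max p q : gap p q <= W ord_max - W ord0.
Proof.
have lo r : W ord0 <= W r by exact: W_inc.
have hi r : W r <= W ord_max by apply: W_inc; rewrite -ltnS.
have := lo p; have := hi p; have := lo q; have := hi q.
by rewrite /gap ler_norml => *; apply/andP; split; lra.
Qed.

Lemma gap_ge0 p q : 0 <= gap p q. Proof. exact: normr_ge0. Qed.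

Lemma distanceC x y : distance (x, y) = distance (y, x).
Proof. by apply: eq_bigr => j _; exact: gapC. Qed.

Lemma distance_ge0 z : 0 <= distance z.
Proof. by apply: sumr_ge0 => j _; exact: gap_ge0. Qed.

Lemma distance_max z : distance z <= n%:R * (W ord_max - W ord0).
Proof.
rewrite mulr_natl -[X in _ *+ X]card_ord -sumr_const.
by apply: ler_sum => j _; exact: gap_max.
Qed.

Lemma coupled_distanceC lam x y :
  coupled lam distance (x, y) = coupled lam distance (y, x).
Proof.
rewrite !coupledE; apply: eq_bigr => j _; apply: eq_bigr => b _ /=.
rewrite minC ![distance (_, y)]distanceC ![distance (x, _)]distanceC.
by rewrite [distance (y, x)]distanceC [distance (move b j y, move b j x)]distanceC; ring.
Qed.

(** For the states without contraction, where a bound linear in [n] is enough because they are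
    exponentially unlikely. *)
Lemma coupled_distance_crude lam (b : R) x y : (forall x, 0 <= lam x <= b) ->
  coupled lam distance (x, y) <=
  n%:R * ((2 * b + 2 * K%:R) * (W ord_max - W ord0)).
Proof.
move=> lamb; wlog yx : x y / lam y <= lam x => [hwlog|].
  have [|/ltW xy] := leP (lam y) (lam x); first exact: hwlog.
  by rewrite coupled_distanceC; exact: hwlog.
rewrite coupled_distance// mulr_natl -[X in _ *+ X]card_ord -sumr_const.
apply: ler_sum => j _; set D := W ord_max - W ord0.
have /andP[x0 xb] := lamb x; have /andP[y0 yb] := lamb y.
have diff p q p' q' : gap p q - gap p' q' <= D.
  by rewrite lerBlDr (le_trans (gap_max _ _))// lerDl gap_ge0.
have D0 : 0 <= D by apply: le_trans (gap_max ord0 ord0); exact: gap_ge0.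
have term (a c : R) (k k' r r' : 'I_K.+1) : 0 <= a -> a <= c ->
    a * (gap k k' - gap r r') <= c * D.
  move=> a0 ac; apply: (@le_trans _ _ (a * D)); first exact: ler_wpM2l.
  exact: ler_wpM2r.
rewrite /merged_drift; set p := x j; set q := y j.
have pK : p%:R <= K%:R :> R by rewrite ler_nat -ltnS.
have qK : q%:R <= K%:R :> R by rewrite ler_nat -ltnS.
have [pq|qp] := leP (p%:R : R) q%:R.
  have := @term (lam y) b (up p) (up q) p q y0 yb.
  have := @term (lam x - lam y) b (up p) q p q.
  rewrite subr_ge0 yx => /(_ isT); rewrite lerBlDr (le_trans xb) ?lerDl// => /(_ isT).
  have := @term p%:R K%:R (dn p) (dn q) p q (ler0n _ _) pK.
  have := @term (q%:R - p%:R) K%:R p (dn q) p q.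
  rewrite subr_ge0 pq => /(_ isT); rewrite lerBlDr (le_trans qK) ?lerDl// => /(_ isT).
  by rewrite subrr mul0r; lra.
have := @term (lam y) b (up p) (up q) p q y0 yb.
have := @term (lam x - lam y) b (up p) q p q.
rewrite subr_ge0 yx => /(_ isT); rewrite lerBlDr (le_trans xb) ?lerDl// => /(_ isT).
have := @term q%:R K%:R (dn p) (dn q) p q (ler0n _ _) qK.
have := @term (p%:R - q%:R) K%:R (dn p) q p q.
rewrite subr_ge0 (ltW qp) => /(_ isT); rewrite lerBlDr (le_trans pK) ?lerDl// => /(_ isT).
by rewrite subrr mul0r; lra.
Qed.

(** The birth rates differ by [2 alpha K (fx - fy) (1 - fx - fy)], with [fx], [fy] the proportions
    of full links, and [n |fx - fy|] is at most the number of links full in exactly one copy. Each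
    of these brings the gain [m * w] of [contracting], which by the last hypothesis pays for the
    surplus births. *)
Lemma coupled_distance_contracts alpha (kappa w : R) x y : 0 <= alpha ->
  dar_lam alpha y <= dar_lam alpha x ->
  contracting (dar_lam alpha y) kappa w ->
  2 * alpha * K%:R * `|1 - full_prop R x - full_prop R y| *
     (\sum_j (W (up (x j)) - W (x j))) <= n%:R * (dar_lam alpha y * w) ->
  coupled (dar_lam alpha) distance (x, y) <= - kappa * distance (x, y).
Proof.
move=> a0 yx ctr excess; rewrite coupled_distance//.
set m := dar_lam alpha y; set d := dar_lam alpha x - m.
pose N : R := \sum_j `|is_full R (x j) - is_full R (y j)|.
have d0 : 0 <= d by rewrite subr_ge0.
apply: (@le_trans _ _ (\sum_j (- kappa * gap (x j) (y j)
    - m * w * `|is_full R (x j) - is_full R (y j)| + d * (W (up (x j)) - W (x j))))).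
  apply: ler_sum => j _; rewrite lerD ?merged_drift_contracting//.
  by rewrite ler_wpM2l// gap_up_le.
rewrite big_split sumrB/= -!mulr_sumr -/N; set U := \sum_j (W _ - W _) in excess *.
rewrite /distance/= -subr_ge0.
have [n0|n0] := posnP n.
  have e (F : 'I_n -> R) : \sum_j F j = 0.
    by apply: big1 => j _; have := leq_ltn_trans (leq0n j) (ltn_ord j);
      rewrite lt0n => /eqP /(_ n0).
  by rewrite /N /U !e; lra.
have n0r : 0 < n%:R :> R by rewrite ltr0n.
have prop_le : n%:R * `|full_prop R x - full_prop R y| <= N.
  rewrite -[X in X * _]normr_nat -normrM mulrC mulrBl -!load_full// /load -sumrB.
  exact: ler_norm_sum.
have U0 : 0 <= U by apply: sumr_ge0 => j _; rewrite subr_ge0; exact/W_inc/le_up.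
have mw0 : 0 <= m * w.
  rewrite -(pmulr_rge0 _ n0r); apply: le_trans excess.
  by rewrite !mulr_ge0.
have dE : d = 2 * alpha * K%:R * (full_prop R x - full_prop R y) *
    (1 - full_prop R x - full_prop R y) by rewrite /d /m /dar_lam; ring.
suff : n%:R * (d * U) <= n%:R * (m * w * N) by rewrite ler_pM2l//; lra.
have -> : n%:R * (d * U) = `|n%:R * (full_prop R x - full_prop R y)| *
    (2 * alpha * K%:R * `|1 - full_prop R x - full_prop R y| * U).
  rewrite normrM normr_nat -[d]ger0_norm// dE !normrM (ger0_norm a0) !normr_nat; ring.
rewrite normrM normr_nat.
apply: (@le_trans _ _ (N * (n%:R * (m * w)))).
  by apply: ler_pM => //; rewrite !mulr_ge0.
by rewrite le_eqVlt; apply/orP; left; apply/eqP; ring.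
Qed.

End Distance.
End Coupling.

(** * From contraction outside rare states to logarithmic mixing *)

Section Mixing.
Variables (R : realType) (K : nat) (alpha : R).
Hypothesis alpha_gt0 : 0 < alpha.

Lemma bigmax_le_bound (I : finType) (F : I -> R) (e : R) :
  0 <= e -> (forall i, F i <= e) -> \big[Num.max/0]_i F i <= e.
Proof. by move=> e0 Fe; elim/big_ind : _ => // a b ae be; rewrite ge_max ae. Qed.

Lemma le_bigmax_term (I : finType) (F : I -> R) i : F i <= \big[Num.max/0]_i F i.
Proof. by rewrite (bigD1 i)//= le_max lexx. Qed.

Lemma card_state_gt0 n : (0 < #|{: state K n}|)%N.
Proof. by apply/card_gt0P; exists [ffun=> ord0]. Qed.

Lemma dar_rate_ge0 n (x y : state K n) : 0 <= dar_rate alpha x y.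
Proof.
rewrite /dar_rate addr_ge0//; last by apply: sumr_ge0 => j _.
by apply: sumr_ge0 => j _; exact: (dar_lam_ge0 alpha_gt0).
Qed.

Lemma dar_stationaryP n :
  invariant_distribution (@dar_rate R alpha K n) (stationary (@dar_rate R alpha K n)).
Proof. by apply: stationaryP; [exact: card_state_gt0 | exact: dar_rate_ge0]. Qed.

Lemma sum_law_set n (A : {set state K n}) x t :
  \sum_(y in A) law (@dar_rate R alpha K n) x t y = sg (@dar R K alpha n) t (fun y => (y \in A)%:R) x.
Proof.
rewrite /dar -gen_op_dar -sum_law big_mkcond; apply: eq_bigr => y _.
by case: (y \in A); rewrite ?mulr1 ?mulr0.
Qed.

(** The stationary mass of a set is the average of its probability over stationary starts, so it
    suffices to compare two starts. *)
Lemma tmix_le n (eps t : R) : 0 <= t -> 0 <= eps ->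
  (forall (A : {set state K n}) x y,
    sg (@dar R K alpha n) t (fun z => (z \in A)%:R) x
    - sg (@dar R K alpha n) t (fun z => (z \in A)%:R) y <= eps) ->
  (tmix alpha K n eps <= t%:E)%E.
Proof.
move=> t0 eps0 osc; apply: ereal_inf_lbound; exists t => //; split => //.
have [pi0 pi1 piP] := dar_stationaryP n; set pi := stationary _ in pi0 pi1 piP *.
apply: bigmax_le_bound => // x; apply: bigmax_le_bound => // A.
rewrite sum_law_set; set F := sg _ t _.
have piA : \sum_(y in A) pi y = \sum_z pi z * F z.
  under eq_bigr do rewrite -(piP t t0).
  rewrite exchange_big/=; apply: eq_bigr => z _; rewrite -mulr_sumr.
  by rewrite sum_law_set.
rewrite piA -[F x]mul1r -pi1 mulr_suml -sumrB.
rewrite (le_trans (ler_norm_sum _ _ _))//.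
have -> : eps = \sum_z pi z * eps by rewrite -mulr_suml pi1 mul1r.
apply: ler_sum => z _; rewrite -mulrBr normrM ger0_norm// ler_wpM2l//.
by rewrite ler_norml lerNl opprB !osc.
Qed.

Variables (W : 'I_K.+1 -> R) (kappa : R) (bad : forall n, pred (state K n)).
Hypotheses (W_inc : increasing W) (W_sep : forall p q, p != q -> 1 <= gap W p q).
Hypotheses (kappa_gt0 : 0 < kappa) (bad_rare : rare alpha bad).
Hypothesis W_contracts : forall n (x y : state K n), ~~ bad x -> ~~ bad y ->
  coupled (dar_lam alpha) (distance W) (x, y) <= - kappa * distance W (x, y).

Let Wmax := W ord_max - W ord0.
Let M := (2 * (3 / 2 * alpha * K%:R) + 2 * K%:R + kappa) * Wmax.

Let Wmax_ge0 : 0 <= Wmax.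
Proof. by rewrite subr_ge0; apply: W_inc. Qed.

Let M_ge0 : 0 <= M.
Proof.
by rewrite mulr_ge0// !addr_ge0 ?mulr_ge0 ?(ltW alpha_gt0) ?(ltW kappa_gt0)// divr_ge0.
Qed.

Lemma coupled_distance_bad n (x y : state K n) :
  coupled (dar_lam alpha) (distance W) (x, y) + kappa * distance W (x, y) <=
  n%:R * M * ((bad x)%:R + (bad y)%:R).
Proof.
have nM0 : 0 <= n%:R * M by exact: mulr_ge0 (ler0n _ _) M_ge0.
have crude : coupled (dar_lam alpha) (distance W) (x, y) + kappa * distance W (x, y)
    <= n%:R * M.
  have -> : n%:R * M = n%:R * ((2 * (3 / 2 * alpha * K%:R) + 2 * K%:R) * Wmax) +
    kappa * (n%:R * Wmax) by rewrite /M; ring.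
  rewrite lerD//; last by rewrite ler_wpM2l ?(ltW kappa_gt0)// distance_max.
  apply: coupled_distance_crude => // z.
  have /andP[_ ->] := dar_lam_bounds z (ltW alpha_gt0).
  by rewrite dar_lam_ge0.
case: (boolP (bad x)) => bx; case: (boolP (bad y)) => b_y /=.
- by apply: (le_trans crude); rewrite ler_peMr// lerDl.
- by rewrite addr0 mulr1.
- by rewrite add0r mulr1.
- by rewrite addr0 mulr0; have := W_contracts bx b_y; lra.
Qed.

(** Copies that differ are at distance at least 1, so [distance] dominates the difference of
    indicators. After [T], the function [expR (- kappa * s) * distance W] is a supersolution except
    at bad pairs. *)
Lemma coupling_bound n (T tau e : R) (A : {set state K n}) x y : 0 <= T -> 0 <= tau ->
  (forall x, sg (@dar R K alpha n) T (fun z => (bad z)%:R) x <= e) ->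
  sg (@dar R K alpha n) (T + tau) (fun z => (z \in A)%:R) x
    - sg (@dar R K alpha n) (T + tau) (fun z => (z \in A)%:R) y <=
  expR (- kappa * tau) * (n%:R * Wmax) + tau * (n%:R * M * (2 * e)).
Proof.
move=> T0 tau0 badT.
pose C := coupled (@dar_lam R K n alpha).
have linC : linear_op C := linear_op_coupled _.
have [c posC] := coupled_pos (@dar_lam_ge0 R K alpha alpha_gt0 n).
have t0 : 0 <= T + tau by exact: addr_ge0.
pose nu z := sg C T (delta R z) (x, y).
have nu0 z : 0 <= nu z.
  by apply: (sg_ge0 linC posC _ T0) => z'; rewrite /delta ler0n.
have nuE g : \sum_z nu z * g z = sg C T g (x, y).
  by rewrite [RHS](linear_opE (linear_op_sg linC T)); apply: eq_bigr => z _; exact: mulrC.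
have step1 : sg (@dar R K alpha n) (T + tau) (fun z => (z \in A)%:R) x
    - sg (@dar R K alpha n) (T + tau) (fun z => (z \in A)%:R) y <=
    sg C (T + tau) (distance W) (x, y).
  rewrite -[X in X - _](sg_coupled_fst _ _ _ (x, y)) -[X in _ - X](sg_coupled_snd _ _ _ (x, y)).
  rewrite addrC -mulN1r -(linear_op_sg linC).
  apply: (le_sg linC posC _ t0) => -[u v] /=; rewrite mulN1r.
  have [<-|uv] := eqVneq u v; first by rewrite addNr distance_ge0.
  apply: (@le_trans _ _ 1).
    by case: (u \in A); case: (v \in A); rewrite /= ?addNr ?oppr0 ?add0r ?addr0 ?lerN10//
      (le_trans (lerN10 _)).
  have [j uvj] : exists j, u j != v j.
    by apply/existsP; apply: contraR uv => /existsPn uv; apply/eqP/ffunP => j;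
      apply/eqP; have := uv j; rewrite negbK.
  rewrite /distance (bigD1 j)//= (le_trans (W_sep uvj))// lerDl.
  by apply: sumr_ge0 => i _; exact: gap_ge0.
apply: (le_trans step1); rewrite -(sgD linC)// -nuE.
have nu_dist : \sum_z nu z * (expR (- kappa * tau) * distance W z) <=
    expR (- kappa * tau) * (n%:R * Wmax).
  rewrite nuE (linear_opZ (linear_op_sg linC T)) ler_wpM2l ?expR_ge0//.
  rewrite -(sg_const linC (n%:R * Wmax) (x, y) T0 (coupled1 _)).
  by apply: (le_sg linC posC _ T0) => z; exact: distance_max.
pose u (s : R) (z : state K n * state K n) := expR (- kappa * s) * distance W z.
pose u' (s : R) (z : state K n * state K n) := distance W z * (- kappa * expR (- kappa * s)).
have u0 : u 0 = distance W by apply/funext => z; rewrite /u mulr0 expR0 mul1r.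
have lin_s s := linear_op_sg linC s.
rewrite -u0; apply: (@le_trans _ _ (\sum_z nu z * u tau z + tau * (n%:R * M * (2 * e)))); last first.
  by rewrite lerD2r.
apply: (sg_super linC tau0 (u' := u')) => [s z _ _|s s0 st].
  rewrite (_ : (fun r => u r z) = (fun r => distance W z * expR (- kappa * r))).
    exact/is_derive_scale/is_derive_expR_scale.
  by apply/funext => r; rewrite /u mulrC.
have ts0 : 0 <= tau - s by rewrite subr_ge0.
have drift_le z : C (u s) z - u' s z <= n%:R * M * (1 * (bad z.1)%:R + (bad z.2)%:R).
  rewrite /u (linear_opZ linC) /u' mul1r; case: z => p q /=.
  have E0 := expR_gt0 (- kappa * s).
  have E1 : expR (- kappa * s) <= 1.
    by rewrite expR_le1 mulNr oppr_le0 mulr_ge0// ltW.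
  have nM0 : 0 <= n%:R * M * ((bad p)%:R + (bad q)%:R).
    by rewrite mulr_ge0 ?addr_ge0// mulr_ge0.
  apply: le_trans (_ : expR (- kappa * s) * (n%:R * M * ((bad p)%:R + (bad q)%:R)) <= _).
    rewrite (_ : _ - _ = expR (- kappa * s) * (C (distance W) (p, q) +
      kappa * distance W (p, q))); last by ring.
    by rewrite ler_wpM2l ?(ltW E0)// coupled_distance_bad.
  by rewrite ler_piMl.
apply: (@le_trans _ _ (\sum_z nu z * sg C (tau - s)
    (fun z => n%:R * M * (1 * (bad z.1)%:R + (bad z.2)%:R)) z)).
  by apply: ler_sum => z _; rewrite ler_wpM2l//; exact: (le_sg linC posC _ ts0).
rewrite nuE (sgD linC)// (linear_opZ (lin_s _)) (lin_s _).
rewrite (sg_coupled_fst _ _ (fun z => (bad z)%:R)) (sg_coupled_snd _ _ (fun z => (bad z)%:R)) /=.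
apply: ler_wpM2l; first exact: mulr_ge0 (ler0n _ _) M_ge0.
rewrite mul1r mulr_natl mulr2n.
have Tr : T <= T + (tau - s) by rewrite lerDl.
by rewrite lerD// (rare_later alpha_gt0 T0 Tr).
Qed.

(** At [2 / kappa * ln n] the contraction factor is [n ^ -2] up to the constant [expR (kappa * T)],
    against a diameter of order [n]; [T], [Wmax] and [M] may depend on [K] and are absorbed by
    [n0]. *)
Lemma tmix_log (eps : R) : 0 < eps -> exists n0 : nat, forall n, (1 <= n)%N ->
  (n0 <= n)%N -> (tmix alpha K n eps <= (2 / kappa * ln n%:R)%:E)%E.
Proof.
move=> eps0; have [T [c [N [T0 c0 badT]]]] := bad_rare.
have ck0 : 0 < 2 / kappa by rewrite divr_gt0.
have [N1 hN1] := ex_nat_gt (expR (kappa * T)).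
have [N2 hN2] := ex_nat_gt (2 * (expR (kappa * T) * Wmax) / eps).
(* Makes the error [2 / kappa * n * (2 * M * n)] equal to [eps / 2 * (A - 1) * n ^ 2], to be
   compared with [(A * n) ^ 2 <= expR (c * n)]. *)
pose A := 4 * (2 / kappa) * M / eps + 1.
have A1 : 1 <= A.
  rewrite lerDr divr_ge0 ?(ltW eps0)//.
  exact: mulr_ge0 (mulr_ge0 (ler0n _ 4) (ltW ck0)) M_ge0.
have [N3 hN3] := @expR_dominates_linear R A (c / 2) (divr_gt0 c0 (ltr0n _ 2)).
exists (maxn (maxn N N1) (maxn N2 N3)) => n n1.
rewrite !geq_max => /andP[/andP[Nn N1n] /andP[N2n N3n]].
have nr : 0 < n%:R :> R by rewrite ltr0n.
have n1r : 1 <= n%:R :> R by rewrite ler1n.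
have ln0 : 0 <= ln n%:R :> R by rewrite ln_ge0.
set t := 2 / kappa * ln n%:R.
have kt : kappa * t = 2 * ln n%:R by rewrite /t; field; rewrite gt_eqF.
have Tt : T <= t.
  rewrite -(ler_pM2l kappa_gt0) kt (@le_trans _ _ (ln n%:R))//; last by lra.
  rewrite -[leLHS]expRK ler_ln ?posrE ?expR_gt0// (le_trans (ltW hN1))// ler_nat//.
have t0 : 0 <= t by exact: le_trans Tt.
apply: tmix_le => //; first exact: ltW.
move=> S x y; rewrite -(subrKC T t).
have tau0 : 0 <= t - T by rewrite subr_ge0.
apply: (le_trans (coupling_bound S x y T0 tau0 (badT n Nn))).
have first_le : expR (- kappa * (t - T)) * (n%:R * Wmax) <= eps / 2.
  have -> : - kappa * (t - T) = - (ln n%:R) + - (ln n%:R) + kappa * T.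
    by rewrite mulrBr mulNr kt; ring.
  rewrite !expRD !expRN !lnK ?posrE//.
  have -> : n%:R^-1 / n%:R * expR (kappa * T) * (n%:R * Wmax) =
      expR (kappa * T) * Wmax / n%:R by field; rewrite gt_eqF.
  rewrite ler_pdivrMr//; have : 2 * (expR (kappa * T) * Wmax) / eps <= n%:R.
    by rewrite (le_trans (ltW hN2))// ler_nat.
  by rewrite ler_pdivrMr//; lra.
have second_le : (t - T) * (n%:R * M * (2 * expR (- (c * n%:R)))) <= eps / 2.
  have tn : t - T <= 2 / kappa * n%:R.
    rewrite (@le_trans _ _ t)//; first by rewrite gerBl.
    by rewrite ler_wpM2l ?(ltW ck0)// ltW// ln_sublinear.
  have E0 := expR_gt0 (c * n%:R).
  rewrite expRN.
  have -> : (t - T) * (n%:R * M * (2 * (expR (c * n%:R))^-1)) =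
     (t - T) * (2 * M * n%:R) / expR (c * n%:R) by ring.
  rewrite ler_pdivrMr//.
  have sq : (A * n%:R) * (A * n%:R) <= expR (c * n%:R).
    have -> : c * n%:R = c / 2 * n%:R + c / 2 * n%:R by field.
    have An0 : 0 <= A * n%:R by rewrite mulr_ge0// (le_trans ler01).
    have AnE : A * n%:R <= expR (c / 2 * n%:R).
      by apply: le_trans (hN3 n N3n); rewrite lerDr.
    by rewrite expRD; apply: ler_pM.
  apply: (@le_trans _ _ (eps / 2 * (A * n%:R * (A * n%:R)))); last first.
    by rewrite ler_wpM2l// divr_ge0// ltW.
  apply: (@le_trans _ _ (2 / kappa * n%:R * (2 * M * n%:R))).
    apply: ler_wpM2r => //.
    exact: mulr_ge0 (mulr_ge0 (ler0n _ 2) M_ge0) (ltW nr).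
  have -> : 2 / kappa * n%:R * (2 * M * n%:R) = eps / 2 * ((A - 1) * (n%:R * n%:R)).
    by rewrite /A; field; rewrite !gt_eqF.
  rewrite ler_wpM2l ?divr_ge0 ?(ltW eps0)//.
  have -> : A * n%:R * (A * n%:R) = A * A * (n%:R * n%:R) by ring.
  rewrite ler_wpM2r ?mulr_ge0//.
  have : A * 1 <= A * A by rewrite ler_wpM2l// (le_trans ler01).
  by lra.
by rewrite [leRHS](_ : eps = eps / 2 + eps / 2); [exact: lerD|field].
Qed.

End Mixing.

(** * One-sided control of the proportion of full links *)

Section FullLinks.
Variables (R : realType) (K : nat).
Implicit Types k p : 'I_K.+1.

Lemma is_full01 k : 0 <= is_full R k <= 1.
Proof. by rewrite /is_full; case: eqP; rewrite lexx ler01. Qed.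

Lemma is_full_increasing : increasing (@is_full R K).
Proof.
move=> k p kp; rewrite /is_full ler_nat; case: eqP => // kK.
suff -> : (p : nat) == K by [].
by move: kp; rewrite kK eqn_leq => ->; rewrite andbT -ltnS ltn_ord.
Qed.

Lemma sum_erlang_full (l : R) :
  \sum_(k < K.+1) erlang K l k * is_full R k = erlang K l K.
Proof. exact: sum_erlang_top. Qed.

Variable alpha : R.
Hypothesis alpha_gt0 : 0 < alpha.

Definition rate_at (f : R) : R := alpha * (1 + 2 * f * (1 - f)).

Lemma dar_lamE n (x : state K n) : dar_lam alpha x = rate_at (full_prop R x) * K%:R.
Proof. by rewrite /dar_lam /rate_at; ring. Qed.

Lemma rate_at_ge f : 0 <= f -> f <= 1 -> alpha <= rate_at f.
Proof.
move=> f0 f1; have : 0 <= f * (1 - f) by rewrite mulr_ge0// subr_ge0.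
move=> /(ler_wpM2l (ltW alpha_gt0)); rewrite mulr0 /rate_at; lra.
Qed.

Lemma rate_at_le f : rate_at f <= 3 / 2 * alpha.
Proof.
have : 0 <= (2 * f - 1) * (2 * f - 1) by rewrite -expr2 sqr_ge0.
move=> /(ler_wpM2l (ltW alpha_gt0)); rewrite mulr0 /rate_at; lra.
Qed.

Lemma rate_at_homo f g : f <= g -> f + g <= 1 -> rate_at f <= rate_at g.
Proof.
move=> fg fg1; have : 0 <= (g - f) * (1 - f - g) by rewrite mulr_ge0; lra.
move=> /(ler_wpM2l (ltW alpha_gt0)); rewrite mulr0 /rate_at; lra.
Qed.

Definition many_full (b : R) n : pred (state K n) :=
  fun x => b * n%:R <= load (@is_full R K) x.

(** Expressed by the links that are not full, because [rare_stage] bounds loads from above. *)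
Definition few_full (a : R) n : pred (state K n) :=
  fun x => (1 - a) * n%:R <= load (fun k => 1 - is_full R k) x.

Lemma load_not_full n (x : state K n) :
  load (fun k => 1 - is_full R k) x = n%:R - load (@is_full R K) x.
Proof. by rewrite /load sumrB sumr_const card_ord. Qed.

Lemma many_fullN (b : R) n (x : state K n) :
  ~~ many_full b x -> (0 < n)%N /\ full_prop R x < b.
Proof.
rewrite /many_full -ltNge; have [n0|n0] := posnP n; last first.
  by rewrite load_full// ltr_pM2r// ltr0n.
by rewrite load0// (_ : n%:R = 0) ?mulr0 ?ltxx// n0.
Qed.

Lemma few_fullN (a : R) n (x : state K n) :
  ~~ few_full a x -> (0 < n)%N /\ a < full_prop R x.
Proof.
rewrite /few_full -ltNge load_not_full; have [n0|n0] := posnP n; last first.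
  rewrite load_full// => h; split => //.
  have nr : 0 < n%:R :> R by rewrite ltr0n.
  by rewrite -(ltr_pM2r nr); lra.
by rewrite load0// (_ : n%:R = 0) ?mulr0 ?subr0 ?ltxx// n0.
Qed.

Lemma rare_pred0 : rare alpha (fun n (x : state K n) => false).
Proof.
exists 0, 1, 0%N; split => // n _ x; rewrite sg0 expR_ge0//.
Qed.

Hypothesis K_gt0 : (0 < K)%N.
Let Kr : 0 < K%:R :> R. Proof. by rewrite ltr0n. Qed.

Lemma rare_many_full (bad : forall n, pred (state K n)) (lam b : R) : 0 < lam ->
  rare alpha bad ->
  (forall n (x : state K n), ~~ bad n x -> rate_at (full_prop R x) <= lam) ->
  erlang K (lam * K%:R) K < b -> rare alpha (many_full b).
Proof.
move=> lam0 bad_rare good erl.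
apply: (@rare_stage R K alpha alpha_gt0 bad (lam * K%:R) 1) => //.
- exact: mulr_gt0.
- move=> n x /good h; rewrite mul1r dar_lamE subr_le0 ler_wpM2r//.
- exact: is_full01.
- exact: mulr1.
- by move=> k p kp; rewrite !mul1r is_full_increasing.
- by rewrite sum_erlang_full.
Qed.

(** [erlang_full_ge] holds for every positive [K], so this stage puts no threshold on [K], in
    contrast with upper bounds on the blocking probability. *)
Lemma rare_few_full (bad : forall n, pred (state K n)) (lam a : R) : 0 < lam ->
  rare alpha bad ->
  (forall n (x : state K n), ~~ bad n x -> lam <= rate_at (full_prop R x)) ->
  a < 1 - lam^-1 -> rare alpha (few_full a).
Proof.
move=> lam0 bad_rare good a_lt; have l0 : 0 < lam * K%:R by exact: mulr_gt0.
apply: (@rare_stage R K alpha alpha_gt0 bad (lam * K%:R) (-1)) => //.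
- move=> n x /good h; rewrite mulN1r oppr_le0 dar_lamE subr_ge0 ler_wpM2r//.
- by move=> k; have /andP[] := is_full01 k; lra.
- by rewrite mulrNN mulr1.
- by move=> k p kp; have := is_full_increasing kp; lra.
under eq_bigr do rewrite mulrBr mulr1.
rewrite sumrB sum_erlang// sum_erlang_full.
have := erlang_full_ge K l0.
have -> : K%:R / (lam * K%:R) = lam^-1 by field; rewrite !gt_eqF.
by lra.
Qed.

End FullLinks.

(** * Fast mixing for [alpha > 1], with the unweighted distance *)

Section IdentityOnLinks.
Variables (R : realType) (K : nat).
Implicit Types k : 'I_K.+1.

Lemma up_sub k : (up k)%:R - k%:R = 1 - is_full R k :> R.
Proof.
rewrite val_up /is_full; have [->|kK] := eqVneq (k : nat) K.
  by rewrite (minn_idPr (leqnSn K)) !subrr.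
rewrite (minn_idPl _); first by rewrite -natr1 subr0 addrC addKr.
by rewrite ltn_neqAle kK -ltnS ltn_ord.
Qed.

Lemma mul_dn_sub k : k%:R * ((dn k)%:R - k%:R) = - k%:R :> R.
Proof.
rewrite val_dn; case: (nat_of_ord k) => [|m] /=; first by rewrite mul0r oppr0.
by rewrite -[m.+1%:R]natr1; ring.
Qed.

End IdentityOnLinks.

Section Supercritical.
Variables (R : realType) (alpha : R).
Hypothesis alpha_gt1 : 1 < alpha.

Let alpha_gt0 : 0 < alpha. Proof. exact: lt_trans alpha_gt1. Qed.

(** Rates never exceed [3 / 2 * alpha], whose blocking limit [1 - 2 / (3 * alpha)] is below this
    ceiling; at the ceiling the rate is still at least [3 / 2]. *)
Let cap : R := 1 - (2 * alpha)^-1.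

Let inv_alpha : alpha * alpha^-1 = 1. Proof. by rewrite divff// gt_eqF. Qed.

Let inv_alpha_bounds : 0 < alpha^-1 < 1.
Proof. by rewrite invr_gt0 alpha_gt0 invf_lt1. Qed.

Let capE : cap = 1 - alpha^-1 / 2.
Proof. by rewrite /cap invfM mulrC. Qed.

Lemma rate_at_cap : 3 / 2 <= rate_at alpha cap.
Proof.
have -> : rate_at alpha cap = alpha + 1 - alpha^-1 / 2.
  have -> : rate_at alpha cap =
      alpha + alpha * alpha^-1 - alpha * alpha^-1 * alpha^-1 / 2.
    by rewrite /rate_at capE; field; rewrite gt_eqF.
  by rewrite inv_alpha mul1r.
by have /andP[] := inv_alpha_bounds; move: alpha_gt1; set i := alpha^-1; lra.
Qed.

Lemma rate_at_between a f : a <= f -> f <= cap ->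
  Num.min (rate_at alpha a) (rate_at alpha cap) <= rate_at alpha f.
Proof.
move=> af fc; rewrite ge_min; have [fa|fa] := leP (a + f) 1.
  by rewrite rate_at_homo.
apply/orP; right; have : 0 <= (cap - f) * (f + cap - 1) by rewrite mulr_ge0; lra.
move=> /(ler_wpM2l (ltW alpha_gt0)); rewrite mulr0 /rate_at; lra.
Qed.

Lemma rare_few_full_supercritical : exists K0 : nat, forall K, (K0 <= K)%N ->
  (0 < K)%N -> rare alpha (@few_full R K (4 / 25)).
Proof.
have /andP[inv0 inv1] := inv_alpha_bounds.
have [K0 erl] : exists K0 : nat, forall K, (K0 <= K)%N -> (0 < K)%N ->
    erlang K (3 / 2 * alpha * K%:R) K < cap.
  apply: erlang_full_lt; first by rewrite mulr_gt0.
    by rewrite capE; lra.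
  have -> : (3 / 2 * alpha)^-1 = 2 / 3 * alpha^-1 by field; rewrite gt_eqF.
  by rewrite capE; lra.
exists K0 => K KK0 K_gt0.
have high : rare alpha (@many_full R K cap).
  apply: (@rare_many_full R K alpha alpha_gt0 K_gt0 (fun n x => false) (3 / 2 * alpha)) => //.
  - by rewrite mulr_gt0.
  - exact: rare_pred0.
  - by move=> n x _; exact: rate_at_le.
  - exact: erl.
have base : rare alpha (@few_full R K 0).
  apply: (@rare_few_full R K alpha alpha_gt0 K_gt0 (fun n x => false) alpha) => //.
  - exact: rare_pred0.
  - by move=> n x _; have /andP[? ?] := full_prop01 R x; exact: rate_at_ge.
  - by lra.
(* For [a <= 4 / 25] the limit [1 - (rate_at alpha a)^-1] exceeds [a] by at least [2 * eta], as
   [rate_at alpha a * (1 - a) >= alpha] and [rate_at alpha a <= 3 / 2 * alpha]; each stage gains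
   [eta]. *)
pose eta := (alpha - 1) / (3 * alpha).
have eta0 : 0 < eta by rewrite divr_gt0 ?subr_gt0// mulr_gt0.
have eta_alpha : alpha * eta = (alpha - 1) / 3 by rewrite /eta; field; rewrite gt_eqF.
have iter_few i : rare alpha (@few_full R K (Num.min (i%:R * eta) (4 / 25))).
  elim: i => [|i IH].
    have -> : Num.min (0%:R * eta) (4 / 25) = 0 :> R by rewrite mul0r; apply/min_idPl; lra.
    exact: base.
  set a := Num.min _ _ in IH; set a' := Num.min _ _.
  have a0 : 0 <= a by rewrite le_min mulr_ge0 ?(ltW eta0)//=; lra.
  have a_le : a <= 4 / 25 by rewrite ge_min lexx orbT.
  have a'_le : a' <= 4 / 25 by rewrite ge_min lexx orbT.
  have a'a : a' <= a + eta.
    rewrite /a' /a -natr1 mulrDl mul1r; have [h|h] := leP (i%:R * eta) (4 / 25).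
      by rewrite ge_min lexx.
    by rewrite ge_min lerDl (ltW eta0) orbT.
  have ra_gt0 : 0 < rate_at alpha a.
    by apply: lt_le_trans (rate_at_ge alpha_gt0 _ _) => //; lra.
  have rc_gt0 : 0 < rate_at alpha cap by apply: lt_le_trans rate_at_cap; lra.
  apply: (@rare_few_full R K alpha alpha_gt0 K_gt0
    (fun n x => many_full cap x || few_full a x)
    (Num.min (rate_at alpha a) (rate_at alpha cap))).
  - by rewrite lt_min ra_gt0.
  - exact: rareU.
  - move=> n x; rewrite negb_or => /andP[/many_fullN [_ /ltW fc] /few_fullN [_ /ltW af]].
    exact: rate_at_between.
  - rewrite ltrBrDl -ltrBrDr; have [_|_] := leP (rate_at alpha a) _.
      rewrite -[ltLHS]mul1r ltr_pdivrMr//.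
      have ra_ge : alpha <= rate_at alpha a * (1 - a).
        have : 0 <= alpha * (a * (1 - 4 * a + 2 * a * a)).
          rewrite mulr_ge0 ?(ltW alpha_gt0)// mulr_ge0//.
          have : 0 <= a * a by exact: mulr_ge0.
          by lra.
        by rewrite /rate_at; lra.
      have := ler_wpM2l (ltW ra_gt0) a'a.
      have := ler_wpM2r (ltW eta0) (rate_at_le alpha_gt0 a).
      move: ra_ge eta_alpha alpha_gt1; clearbody eta a a'.
      by move: (rate_at alpha a) => r; lra.
    (* A rate of at least [3 / 2] has a limit of at least [1 / 3], beyond the target [4 / 25]. *)
    by rewrite -[ltLHS]mul1r ltr_pdivrMr//; have := rate_at_cap; nra.
have [i hi] := ex_nat_gt (4 / 25 / eta).
have := iter_few i; rewrite (_ : Num.min _ _ = 4 / 25)//.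
by apply/min_idPr; rewrite -ler_pdivrMr// ltW.
Qed.

(** For [a = b <= 1 / 2] the claim is [6 b^2 - 8 b + 1 <= 0], that is [b >= phi_c]: this quadratic
    is the derivative of [(1 + 2 f (1 - f)) (1 - f)]. The bound [3 / 20] lies just above [phi_c]. *)
Lemma supercritical_excess (a b : R) : 3 / 20 <= b -> 0 <= a -> a <= 1 -> b <= 1 ->
  b * (1 - b) <= a * (1 - a) ->
  2 * `|1 - a - b| * (1 - a) <= 1 + 2 * b * (1 - b).
Proof.
move=> b0 a0 a1 b1 ba.
have b_b : 0 <= b * (1 - b) by rewrite mulr_ge0; lra.
have [s0|s0] := leP 0 (1 - a - b).
  rewrite ger0_norm//; have [ab|ab] := leP b a.
    have : (1 - a - b) * (1 - a) <= (1 - 2 * b) * (1 - b) by apply: ler_pM; lra.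
    have : 0 <= (b - 3 / 20) * (1 / 2 - b) by apply: mulr_ge0; lra.
    lra.
  have : (b - a) * (1 - a - b) <= 0 by lra.
  rewrite pmulr_rle0 ?subr_gt0// => s_le.
  have -> : 1 - a - b = 0 by lra.
  by lra.
rewrite ltr0_norm//.
have : 0 <= (2 * a - 1) * (2 * a - 1) by rewrite -expr2 sqr_ge0.
have : 0 <= (1 - b) * (1 - a) by rewrite mulr_ge0; lra.
by lra.
Qed.

Theorem fast_supercritical : exists C : R, forall eps : R, 0 < eps < 1 ->
  exists K0 : nat, forall K : nat, (1 <= K)%N -> (K0 <= K)%N ->
  exists n0 : nat, forall n : nat, (1 <= n)%N -> (n0 <= n)%N ->
    (tmix alpha K n eps <= (C * ln n%:R)%:E)%E.
Proof.
exists (2 / 1) => eps /andP[eps0 _].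
have [K0 few] := rare_few_full_supercritical; exists K0 => K K_gt0 KK0.
pose W (k : 'I_K.+1) : R := k%:R.
have W_inc : increasing W by move=> k p kp; rewrite ler_nat.
apply: (@tmix_log R K alpha alpha_gt0 W 1 (@few_full R K (4 / 25))) => //.
- move=> p q pq; rewrite /gap /W; wlog lt_pq : p q pq / (p < q)%N => [hwlog|].
    have [|qp] := ltnP p q; first exact: hwlog.
    rewrite distrC; apply: hwlog; first by rewrite eq_sym.
    by rewrite ltn_neqAle qp andbT; apply: contra pq => /eqP qp'; apply/eqP/ord_inj.
  have : p.+1%:R <= q%:R :> R by rewrite ler_nat.
  by rewrite distrC -natr1 => h; rewrite ger0_norm; lra.
- exact: few.
- move=> n x y /few_fullN [n0 fx] /few_fullN [_ fy].
  wlog yx : x y fx fy / dar_lam alpha y <= dar_lam alpha x => [hwlog|].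
    have [|/ltW xy] := leP (dar_lam alpha y) (dar_lam alpha x); first exact: hwlog.
    by rewrite coupled_distanceC distanceC; exact: hwlog.
  have Kr : 0 < K%:R :> R by rewrite ltr0n.
  apply: (@coupled_distance_contracts R K n W W_inc alpha 1 1) => //.
  + exact: ltW.
  (* For the identity weight, with [kappa = w = 1], both sides are equal to the constant [m]. *)
  + by move=> k p _; rewrite !linkE /W !up_sub !mul_dn_sub; lra.
  + have -> : \sum_j (W (up (x j)) - W (x j)) = n%:R * (1 - full_prop R x).
      rewrite mulrBr mulr1 [n%:R * _]mulrC -load_full// -load_not_full.
      by apply: eq_bigr => j _; exact: up_sub.
    rewrite mulr1; move: yx; rewrite !dar_lamE ler_pM2r// /rate_at => yx.
    have /andP[ax0 ax1] := full_prop01 R x; have /andP[ay0 ay1] := full_prop01 R y.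
    have fy' : 3 / 20 <= full_prop R y by apply: le_trans (ltW fy); lra.
    have fxy : full_prop R y * (1 - full_prop R y) <= full_prop R x * (1 - full_prop R x).
      by move: yx; rewrite ler_pM2l//; lra.
    have := supercritical_excess fy' ax0 ax1 ay1 fxy.
    have aKn : 0 <= n%:R * (alpha * K%:R).
      exact: mulr_ge0 (ler0n _ _) (mulr_ge0 (ltW alpha_gt0) (ltW Kr)).
    move=> /(ler_wpM2l aKn); move: `|_| => u; move: (full_prop R x) (full_prop R y).
    by move=> f g; lra.
Qed.

End Supercritical.

(** * The critical value and the maximiser [phi_c] *)

Section CriticalValue.
Variable R : realType.
Let s : R := Num.sqrt 10.

Let ss : s * s = 10. Proof. by rewrite -expr2 sqr_sqrtr. Qed.
Let s0 : 0 <= s. Proof. exact: sqrtr_ge0. Qed.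

Let s_bounds : 3 <= s <= 19 / 6.
Proof.
have s_sq (a : R) : 0 <= a -> a * a <= 10 -> a <= s.
  by move=> a0 aa; rewrite -(ler_pXn2r (n := 2))// ?nnegrE// !expr2 ss.
have sq_s (a : R) : 0 <= a -> 10 <= a * a -> s <= a.
  by move=> a0 aa; rewrite -(ler_pXn2r (n := 2))// ?nnegrE// !expr2 ss.
by apply/andP; split; [apply: s_sq|apply: sq_s]; lra.
Qed.

(* The point of [0, 1] at which [(1 + 2 f (1 - f)) (1 - f)] is maximal. *)
Definition phi_c : R := (4 - s) / 6.

Lemma alpha_cE : alpha_c R = (5 * s - 13) / 3. Proof. by []. Qed.

Lemma alpha_c_bounds : 0 < alpha_c R < 1.
Proof. by have /andP[? ?] := s_bounds; rewrite alpha_cE; apply/andP; split; lra. Qed.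

Lemma phi_c_bounds : 2 / 15 <= phi_c <= 1 / 6.
Proof. by have /andP[? ?] := s_bounds; rewrite /phi_c; apply/andP; split; lra. Qed.

(** The cubic touches 1 at its maximiser, hence a double root there; the third root [(2 + s) / 3] is
    larger than 1. *)
Lemma alpha_c_factor f : alpha_c R * ((1 + 2 * f * (1 - f)) * (1 - f)) =
  1 + 2 * alpha_c R * (f - phi_c) * (f - phi_c) * (f - (2 + s) / 3).
Proof.
rewrite alpha_cE /phi_c.
(* Reductions modulo [s * s = 10], which make the polynomial identity linear in the remaining
   monomials. *)
have e0 := ss; have e1 : s * s * s = 10 * s by rewrite ss.
have e2 : s * s * s * s = 100 by rewrite ss -mulrA ss; lra.
have e3 : s * s * f = 10 * f by rewrite ss.
have e4 : s * s * s * f = 10 * s * f by rewrite ss.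
have e5 : s * s * f * f = 10 * f * f by rewrite ss.
by lra.
Qed.

Lemma alpha_c_max f : f <= 1 -> alpha_c R * ((1 + 2 * f * (1 - f)) * (1 - f)) <= 1.
Proof.
move=> f1; rewrite alpha_c_factor gerDl; have /andP[ac0 _] := alpha_c_bounds.
have /andP[? ?] := s_bounds; rewrite -(mulrA _ (f - phi_c) (f - phi_c)).
rewrite mulr_ge0_le0//; last by lra.
by rewrite mulr_ge0 -?expr2 ?sqr_ge0// mulr_ge0// ltW.
Qed.

Lemma alpha_c_phi_c :
  alpha_c R * ((1 + 2 * phi_c * (1 - phi_c)) * (1 - phi_c)) = 1.
Proof. by rewrite alpha_c_factor subrr mulr0 mul0r addr0. Qed.

End CriticalValue.

(** * A weighted distance for fast mixing below [alpha_c] *)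

Section WeightedDistance.
Variables (R : realType) (K : nat) (s eps : R).
Hypotheses (K_gt0 : (0 < K)%N) (s_gt1 : 1 < s) (eps_gt0 : 0 < eps).
Implicit Types k p q : 'I_K.+1.

(* The increments grow geometrically near [K], so that creating a full link weighs
   much more than the discrepancies it can cause in links far from being full. *)
Definition weighted k : R := k%:R + eps * s ^+ k.
(** The increment of [weighted] from [K - 1] to [K], its largest one. *)
Definition top_step : R := 1 + eps * (s - 1) * s ^+ K.-1.

Let s_gt0 : 0 < s. Proof. exact: lt_trans s_gt1. Qed.
Let es_ge0 : 0 <= eps * (s - 1). Proof. by apply: mulr_ge0; rewrite ?subr_ge0 ltW. Qed.

Lemma weighted_sub k p : (k <= p)%N -> p%:R - k%:R <= weighted p - weighted k.
Proof.
move=> kp; have : eps * s ^+ k <= eps * s ^+ p.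
  by apply: ler_wpM2l; [exact: ltW | apply: ler_weXn2l => //; exact: ltW].
by rewrite /weighted; lra.
Qed.

Lemma weighted_increasing : increasing weighted.
Proof.
move=> k p kp; rewrite -subr_ge0 (le_trans _ (weighted_sub kp))// subr_ge0.
by rewrite ler_nat.
Qed.

Lemma weighted_separates p q : p != q -> 1 <= gap weighted p q.
Proof.
wlog pq : p q / (p < q)%N => [hwlog|_].
  have [|qp] := ltnP p q; first exact: hwlog.
  move=> pq; rewrite gapC; apply: hwlog; last by rewrite eq_sym.
  by rewrite ltn_neqAle qp andbT; apply: contra pq => /eqP qp'; apply/eqP/ord_inj.
rewrite (gap_le weighted_increasing (ltnW pq)).
apply: le_trans (weighted_sub (ltnW pq)).
by rewrite lerBrDl natr1 ler_nat.
Qed.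

Lemma weighted_up k : weighted (up k) - weighted k =
  (1 - is_full R k) * (1 + eps * (s - 1) * s ^+ k).
Proof.
rewrite /weighted val_up /is_full; have [kK|kK] := eqVneq (k : nat) K.
  by rewrite kK (minn_idPr (leqnSn K)) !subrr mul0r.
rewrite (minn_idPl _); first by rewrite -natr1 exprS subr0 mul1r; ring.
by rewrite ltn_neqAle kK -ltnS ltn_ord.
Qed.

Lemma weighted_dn k : k%:R * (weighted (dn k) - weighted k) =
  - (k%:R * (1 + eps * (s - 1) * s ^+ k / s)).
Proof.
rewrite /weighted val_dn; case: (nat_of_ord k) => [|j] /=; first by rewrite !mul0r oppr0.
by rewrite exprS -natr1; field; rewrite gt_eqF.
Qed.

(** From [j] to [j + 1] the linear part loses 1 and [kappa] returns one half of it. The geometric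
    part adds at most [eps (s - 1)^2 s^j (m - j / s)], positive only for [j < m * s <= J], where
    [eps] keeps it below the other half. *)
Lemma weighted_contracting m (J : nat) : 0 <= m -> m <= K%:R -> m * s <= J%:R ->
  eps * (s - 1) * ((s - 1) * K%:R) * s ^+ J <= 1 / 2 ->
  contracting weighted m (1 / 2) top_step.
Proof.
move=> m0 mK msJ eps_small.
(* The minimum repeats [m * top_step] at [j = K]: there the gain for full links replaces the missing
   birth. *)
pose psi (j : nat) := m * (1 + eps * (s - 1) * s ^+ minn j K.-1)
  - j%:R * (1 + eps * (s - 1) * s ^+ j / s) + 1 / 2 * (j%:R + eps * s ^+ j).
have psiE k : link m weighted k + 1 / 2 * weighted k + m * top_step * is_full R k = psi k.
  rewrite linkE weighted_up weighted_dn /psi /weighted /top_step /is_full.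
  have [kK|kK] := eqVneq (k : nat) K.
    by rewrite kK (minn_idPr (leq_pred K)) /=; ring.
  rewrite (minn_idPl _) /=; first by ring.
  by rewrite -ltnS prednK// ltn_neqAle kK -ltnS ltn_ord.
have psi_step j : (j < K)%N -> psi j.+1 <= psi j.
  move=> jK; have jK' : (j <= K.-1)%N by rewrite -ltnS prednK.
  have P0 : 0 < s ^+ j by rewrite exprn_gt0.
  have top_le : m * (eps * (s - 1)) * s ^+ minn j.+1 K.-1 <= m * (eps * (s - 1)) * (s * s ^+ j).
    rewrite -exprS; apply: ler_wpM2l; first exact: mulr_ge0.
    by apply: ler_weXn2l; [exact: ltW | exact: geq_minl].
  rewrite /psi (minn_idPl jK') -[j.+1%:R]natr1 exprS.
  set P := s ^+ j in P0 top_le *.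
  have -> : eps * (s - 1) * (s * P) / s = eps * (s - 1) * P by field; rewrite gt_eqF.
  have key : eps * (s - 1) * P * ((s - 1) * (m - j%:R / s)) <= 1 / 2.
    have [mj|mj] := leP (m - j%:R / s) 0.
      apply: (@le_trans _ _ 0); last by lra.
      apply: mulr_ge0_le0; first exact: mulr_ge0 es_ge0 (ltW P0).
      by apply: mulr_ge0_le0 => //; rewrite subr_ge0 ltW.
    apply: le_trans eps_small; rewrite [leRHS]mulrAC; apply: ler_pM.
    - exact: mulr_ge0 es_ge0 (ltW P0).
    - by apply: mulr_ge0; rewrite ?subr_ge0 ltW// -subr_gt0.
    - rewrite ler_wpM2l//; apply: ler_weXn2l; first exact: ltW.
      rewrite -(ler_nat R) (le_trans _ msJ)// -ler_pdivrMr// -subr_ge0 ltW//.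
    - rewrite ler_wpM2l ?subr_ge0 ?(ltW s_gt1)// (le_trans _ mK)// gerBl.
      by rewrite divr_ge0// ltW.
  have : 0 <= eps * (s - 1) * P by exact: mulr_ge0 es_ge0 (ltW P0).
  have keyE : eps * (s - 1) * P * ((s - 1) * (m - j%:R / s)) =
     m * (eps * (s - 1)) * (s * P) - m * (eps * (s - 1)) * P
     - eps * (s - 1) * P * j%:R + eps * (s - 1) * P * j%:R / s.
    by field; rewrite gt_eqF.
  rewrite keyE in key.
  by move: key top_le; lra.
have psi_dec j i : (j + i <= K)%N -> psi (j + i)%N <= psi j.
  elim: i => [|i IH] ji; first by rewrite addn0.
  have ji' : (j + i < K)%N by rewrite -addnS.
  by rewrite addnS; exact: le_trans (psi_step _ ji') (IH (ltnW ji')).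
move=> p q pq; rewrite !psiE -(subnKC pq); apply: psi_dec.
by rewrite subnKC// -ltnS.
Qed.

(** Outside the top [i0] levels the geometric part of the increment is at least 8 times smaller than
    at the top, and [8 <= top_step] absorbs the linear part. *)
Lemma weighted_step_le (i0 : nat) k : (0 < i0)%N -> (i0 <= K)%N -> 8 <= s ^+ i0.-1 ->
  8 <= top_step ->
  weighted (up k) - weighted k <= top_step * (K - i0 < k)%N%:R + top_step / 4.
Proof.
move=> i00 i0K s8 w8; rewrite weighted_up.
have w0 : 0 < top_step by lra.
have [kK|kK] := eqVneq (k : nat) K.
  rewrite /is_full kK eqxx subrr mul0r addr_ge0 ?mulr_ge0 ?divr_ge0// ltW//.
have kK' : (k <= K.-1)%N by rewrite -ltnS prednK// ltn_neqAle kK -ltnS ltn_ord.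
rewrite /is_full (negPf kK) subr0 mul1r.
have [kt|kt] := ltnP (K - i0) k; rewrite ?mulr1 ?mulr0 ?add0r.
  apply: (@le_trans _ _ top_step); last by rewrite lerDl divr_ge0// ltW.
  by rewrite lerD2l ler_wpM2l//; apply: ler_weXn2l => //; exact: ltW.
have : eps * (s - 1) * s ^+ k * 8 <= eps * (s - 1) * s ^+ K.-1.
  rewrite -mulrA ler_wpM2l//.
  have -> : K.-1 = (K - i0 + i0.-1)%N by rewrite -!subn1 addnBA// subnK.
  rewrite exprD; apply: ler_pM => //; first by rewrite exprn_ge0// ltW.
  by apply: ler_weXn2l => //; exact: ltW.
by rewrite /top_step in w8 w0 *; lra.
Qed.

End WeightedDistance.

Section WeightExists.
Variables (R : realType) (s mu : R).
Hypotheses (s_gt1 : 1 < s) (mu_ge0 : 0 <= mu) (mu_lt1 : mu < 1).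

(** A fixed fraction of the levels lies above [mu * K], enough for powers of [s] to outgrow a
    multiple of [K]. So the geometric part can be small at level [J] and large at the top. *)
Lemma ex_weight_scale : exists K0 : nat, forall K, (K0 <= K)%N ->
  exists J : nat, [/\ (J < K)%N, mu * K%:R <= J%:R &
    16 * (s - 1) * K%:R <= s ^+ (K.-1 - J)].
Proof.
have s0 : 0 < s by exact: lt_trans s_gt1.
have d0 : 0 < 1 - mu by rewrite subr_gt0.
have ln_s : 0 < ln s by rewrite ln_gt0.
pose A := 32 * (s - 1) / (1 - mu).
have A0 : 0 < A by rewrite divr_gt0// mulr_gt0// subr_gt0.
have [N hN] := @expR_dominates_linear R A (ln s) ln_s.
have [K1 hK1] := ex_nat_gt (4 / (1 - mu)).
have [K2 hK2] := ex_nat_gt (2 * N%:R / (1 - mu)).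
exists (maxn K1 K2) => K; rewrite geq_max => /andP[K1K K2K].
have K1r : 4 < (1 - mu) * K%:R.
  rewrite [ltRHS]mulrC -ltr_pdivrMr// (lt_le_trans hK1)// ler_nat//.
have K2r : 2 * N%:R < (1 - mu) * K%:R.
  rewrite [ltRHS]mulrC -ltr_pdivrMr// (lt_le_trans hK2)// ler_nat//.
have muK0 : 0 <= mu * K%:R by rewrite mulr_ge0.
have /andP[J_le J_gt] := truncn_itv muK0.
pose J := (Num.truncn (mu * K%:R)).+1.
have Jr : J%:R <= mu * K%:R + 1 by rewrite /J -natr1 lerD2r.
have JK : (J < K)%N by rewrite -(ltr_nat R); lra.
exists J; split => //; first exact: ltW.
have pE : (K.-1 - J)%:R = K%:R - 1 - J%:R :> R.
  by rewrite natrB; [rewrite -[in RHS](prednK (leq_ltn_trans (leq0n _) JK)) -natr1; ring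
    | rewrite -ltnS prednK// (leq_ltn_trans _ JK)].
have Np : (N <= K.-1 - J)%N by rewrite -(ler_nat R) pE; lra.
have -> : s ^+ (K.-1 - J) = expR (ln s * (K.-1 - J)%:R) by rewrite expRM_natr lnK.
apply: le_trans (hN _ Np); rewrite pE.
have half : (1 - mu) * K%:R / 2 <= K%:R - 1 - J%:R by lra.
have := ler_wpM2l (ltW A0) half.
have -> : A * ((1 - mu) * K%:R / 2) = 16 * (s - 1) * K%:R.
  by rewrite /A; field; rewrite gt_eqF.
by lra.
Qed.

End WeightExists.

Section Subcritical.
Variables (R : realType) (alpha : R).
Hypotheses (alpha_gt0 : 0 < alpha) (alpha_lt : alpha < alpha_c R).

Let alpha_lt1 : alpha < 1.
Proof. by have /andP[_] := alpha_c_bounds R; apply: lt_trans. Qed.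

(** The second bound gives [2 * alpha * beta <= (1 - alpha) / 2], which keeps the rate at most
    [lam1 < 1] up to this proportion. *)
Let beta : R := Num.min (1 / 2) ((1 - alpha) / (4 * alpha)).

Let beta_bounds : 0 < beta <= 1 / 2.
Proof.
rewrite ge_min lexx lt_min divr_gt0//= divr_gt0 ?subr_gt0//.
exact: mulr_gt0.
Qed.

Let lam1 : R := (1 + alpha) / 2.

Let lam1_bounds : 0 < lam1 < 1.
Proof. by rewrite /lam1; move: alpha_gt0 alpha_lt1 => *; apply/andP; split; lra. Qed.

Let rate_at_beta : rate_at alpha beta <= lam1.
Proof.
have /andP[b0 b1] := beta_bounds.
have : 4 * (alpha * beta) <= 1 - alpha.
  have -> : 4 * (alpha * beta) = beta * (4 * alpha) by ring.
  by rewrite -ler_pdivlMr ?mulr_gt0// ge_min lexx orbT.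
have : 0 <= alpha * (beta * beta) by rewrite !mulr_ge0 ?ltW.
by rewrite /rate_at /lam1; lra.
Qed.

Lemma rare_many_full_subcritical : exists K0 : nat, forall K, (K0 <= K)%N ->
  (0 < K)%N -> rare alpha (@many_full R K beta).
Proof.
have /andP[ac0 ac1] := alpha_c_bounds R.
have /andP[b0 b1] := beta_bounds.
(* The limit [1 - (rate_at alpha b)^-1] is at least [2 * eta] below [b], as [rate_at alpha b * (1 -
   b) <= alpha / alpha_c] and [rate_at alpha b <= 3 / 2 * alpha]. The descent starts at [1 / 2], up
   to which the rate increases. *)
pose eta := (1 - alpha / alpha_c R) / (3 * alpha).
have ratio : alpha / alpha_c R < 1 by rewrite ltr_pdivrMr// mul1r.
have eta0 : 0 < eta by rewrite divr_gt0 ?subr_gt0// mulr_gt0.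
have eta_alpha : alpha * eta = (1 - alpha / alpha_c R) / 3.
  by rewrite /eta; field; rewrite !gt_eqF.
have iter_many i : exists K0 : nat, forall K, (K0 <= K)%N -> (0 < K)%N ->
    rare alpha (@many_full R K (Num.max (1 / 2 - i%:R * eta) beta)).
  elim: i => [|i [K1 IH]].
    have [K0 erl] : exists K0 : nat, forall K, (K0 <= K)%N -> (0 < K)%N ->
        erlang K (3 / 2 * alpha * K%:R) K < 1 / 2.
      apply: erlang_full_lt; first by rewrite mulr_gt0.
        by rewrite divr_gt0.
      rewrite ltrBlDr -ltrBlDl -[ltRHS]mul1r ltr_pdivlMr ?mulr_gt0//.
      by move: alpha_lt1; lra.
    exists K0 => K KK0 K_gt0.
    have -> : Num.max (1 / 2 - 0%:R * eta) beta = 1 / 2 :> R.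
      by rewrite mul0r subr0; apply/max_idPl.
    apply: (@rare_many_full R K alpha alpha_gt0 K_gt0 (fun n x => false) (3 / 2 * alpha)) => //.
    - by rewrite mulr_gt0.
    - exact: rare_pred0.
    - by move=> n x _; exact: rate_at_le.
    - exact: erl.
  set b := Num.max _ _ in IH; set b' := Num.max _ _.
  have b'0 : 0 < b' by rewrite lt_max b0 orbT.
  have b_half : b <= 1 / 2.
    by rewrite /b ge_max b1 andbT gerBl mulr_ge0// ltW.
  have b_ge0 : 0 < b by rewrite lt_max b0 orbT.
  have b'b : b - eta <= b'.
    rewrite /b' /b -[i.+1%:R]natr1 mulrDl [1 * eta]mul1r; have [h|h] := leP (1 / 2 - i%:R * eta) beta.
      by rewrite le_max; apply/orP; right; rewrite gerBl ltW.
    by rewrite le_max opprD addrA lexx.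
  have r0 : 0 < rate_at alpha b.
    by apply: lt_le_trans (rate_at_ge alpha_gt0 _ _) => //; lra.
  have gap_b : 1 - (rate_at alpha b)^-1 < b'.
    apply: lt_le_trans b'b; rewrite ltrBlDr -ltrBlDl -[ltRHS]mul1r ltr_pdivlMr//.
    have : alpha / alpha_c R * (alpha_c R * ((1 + 2 * b * (1 - b)) * (1 - b))) <=
        alpha / alpha_c R.
      apply: ler_piMr; first by rewrite divr_ge0 ?(ltW alpha_gt0) ?(ltW ac0).
      by apply: alpha_c_max; lra.
    have -> : alpha / alpha_c R * (alpha_c R * ((1 + 2 * b * (1 - b)) * (1 - b))) =
       rate_at alpha b * (1 - b) by rewrite /rate_at; field; rewrite gt_eqF.
    have := ler_wpM2r (ltW eta0) (rate_at_le alpha_gt0 b).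
    move: ratio eta_alpha; move: (rate_at alpha b) => r; clearbody eta b.
    by move: (alpha / alpha_c R) => q; lra.
  have [K2 erl] := erlang_full_lt r0 b'0 gap_b.
  exists (maxn K1 K2) => K; rewrite geq_max => /andP[KK1 KK2] K_gt0.
  apply: (@rare_many_full R K alpha alpha_gt0 K_gt0 (@many_full R K b) (rate_at alpha b)) => //.
  - exact: IH.
  - move=> n x /many_fullN [_ /ltW fb].
    by rewrite rate_at_homo//; lra.
  - exact: erl.
have [i hi] := ex_nat_gt (1 / 2 / eta).
have [K0 many] := iter_many i; exists K0 => K KK0 K_gt0.
have := many K KK0 K_gt0; rewrite (_ : Num.max _ _ = beta)//.
apply/max_idPr; rewrite (@le_trans _ _ 0) ?(ltW b0)// subr_le0.
by rewrite -ler_pdivrMr// ltW.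
Qed.

Theorem fast_subcritical : exists C : R, forall eps : R, 0 < eps < 1 ->
  exists K0 : nat, forall K : nat, (1 <= K)%N -> (K0 <= K)%N ->
  exists n0 : nat, forall n : nat, (1 <= n)%N -> (n0 <= n)%N ->
    (tmix alpha K n eps <= (C * ln n%:R)%:E)%E.
Proof.
exists (2 / (1 / 2)) => eps /andP[eps0 _].
have /andP[l0 l1] := lam1_bounds.
(* Between 1 and [lam1^-1], so that [lam1 * s < 1] leaves levels above [lam1 * s * K]. *)
pose s := (1 + lam1^-1) / 2.
have s1 : 1 < s by have : 1 < lam1^-1 by [rewrite invf_gt1]; rewrite /s; lra.
have mu_lt1 : lam1 * s < 1.
  have -> : lam1 * s = (lam1 + 1) / 2 by rewrite /s; field; rewrite gt_eqF.
  by lra.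
have mu_ge0 : 0 <= lam1 * s by rewrite mulr_ge0 ?ltW// (lt_trans ltr01).
have [i1 hi1] := ex_nat_gt (8 / (s - 1)).
have s8 : 8 <= s ^+ i1.
  have := @bernoulli_ge R (s - 1) i1; rewrite subr_ge0 (ltW s1) => /(_ isT).
  have -> : 1 + (s - 1) = s by ring.
  move: hi1; rewrite ltr_pdivrMr ?subr_gt0//; lra.
pose S : R := \sum_(i < i1.+1) lam1^-1 ^+ i.
have S0 : 0 < S.
  rewrite /S big_ord_recl expr0 ltr_pwDl// sumr_ge0// => i _.
  by rewrite exprn_ge0// invr_ge0 ltW.
have [K1 many] := rare_many_full_subcritical.
(* As [lam1 < 1], blocking tends to 0; below [(4 * S)^-1] it leaves mass less than [1 / 4] to the
   top [i1 + 1] levels. *)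
have [K2 erl] : exists K0 : nat, forall K, (K0 <= K)%N -> (0 < K)%N ->
    erlang K (lam1 * K%:R) K < (4 * S)^-1.
  apply: erlang_full_lt => //; first by rewrite invr_gt0 mulr_gt0.
  apply: (@lt_trans _ _ 0); last by rewrite invr_gt0 mulr_gt0.
  by rewrite subr_lt0 invf_gt1.
have [K3 scale] := ex_weight_scale s1 mu_ge0 mu_lt1.
exists (maxn (maxn K1 K2) (maxn K3 i1.+1)) => K K_gt0.
rewrite !geq_max => /andP[/andP[KK1 KK2] /andP[KK3 i1K]].
have Kr : 0 < K%:R :> R by rewrite ltr0n.
have high := many K KK1 K_gt0.
pose v (k : 'I_K.+1) : R := (K - i1.+1 < k)%N%:R.
have lam_le n (x : state K n) : ~~ many_full beta x -> dar_lam alpha x <= lam1 * K%:R.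
  move=> /many_fullN [_ /ltW fb]; rewrite dar_lamE ler_pM2r//.
  apply: le_trans rate_at_beta; have /andP[? ?] := beta_bounds.
  by rewrite rate_at_homo//; lra.
have top : rare alpha (fun n (x : state K n) => 1 / 4 * n%:R <= load v x).
  apply: (@rare_stage R K alpha alpha_gt0 (@many_full R K beta) (lam1 * K%:R) 1) => //.
  - exact: mulr_gt0.
  - by move=> n x /lam_le; rewrite mul1r subr_le0.
  - by move=> k; rewrite /v; case: (_ < _)%N; rewrite lexx ler01.
  - exact: mulr1.
  - move=> k p kp; rewrite !mul1r /v ler_nat.
    by case: (ltnP (K - i1.+1) k) => // h; rewrite (leq_trans h kp).
  - apply: le_lt_trans (erlang_top_le l0 K_gt0 i1K) _.
    rewrite -ltr_pdivlMr// (lt_le_trans (erl K KK2 K_gt0))//.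
    by rewrite invfM div1r.
have [J [JK muJ sJ]] := scale K KK3.
have s0 : 0 < s by exact: lt_trans s1.
have sm0 : 0 < s - 1 by rewrite subr_gt0.
(* The largest scale that [weighted_contracting] allows. *)
pose e := (2 * (s - 1) * (s - 1) * K%:R * s ^+ J)^-1.
have e0 : 0 < e by rewrite invr_gt0 !mulr_gt0// exprn_gt0.
have sJ_neq0 : s ^+ J != 0 by rewrite gt_eqF// exprn_gt0.
have w8 : 8 <= top_step K s e.
  rewrite /top_step; have -> : K.-1 = (J + (K.-1 - J))%N.
    by rewrite subnKC// -ltnS prednK.
  rewrite exprD; have -> : e * (s - 1) * (s ^+ J * s ^+ (K.-1 - J)) =
      s ^+ (K.-1 - J) / (2 * (s - 1) * K%:R).
    by rewrite /e; field; rewrite sJ_neq0 !gt_eqF.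
  have : 8 <= s ^+ (K.-1 - J) / (2 * (s - 1) * K%:R).
    by rewrite ler_pdivlMr ?mulr_gt0//; lra.
  by lra.
apply: (@tmix_log R K alpha alpha_gt0 (@weighted R K s e) (1 / 2)
  (fun n x => many_full beta x || (1 / 4 * n%:R <= load v x))) => //.
- exact: weighted_increasing.
- exact: weighted_separates.
- exact: rareU.
move=> n x y; rewrite !negb_or => /andP[xm xt] /andP[ym yt].
wlog yx : x y xm xt ym yt / dar_lam alpha y <= dar_lam alpha x => [hwlog|].
  have [|/ltW xy] := leP (dar_lam alpha y) (dar_lam alpha x); first exact: hwlog.
  by rewrite coupled_distanceC distanceC; exact: hwlog.
have y0 : 0 <= dar_lam alpha y by exact: dar_lam_ge0.
have w0 : 0 < top_step K s e by apply: lt_le_trans w8.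
apply: (@coupled_distance_contracts R K n _ (weighted_increasing s1 e0) alpha
  (1 / 2) (top_step K s e)) => //; first exact: ltW.
  apply: (@weighted_contracting R K s e K_gt0 s1 e0 _ J) => //.
  - by rewrite (le_trans (lam_le n y ym))// ler_piMl// ltW.
  - apply: le_trans muJ; rewrite [leRHS]mulrAC ler_pM2r//; exact: lam_le.
  - rewrite le_eqVlt; apply/orP; left; apply/eqP.
    by rewrite /e; field; rewrite sJ_neq0 !gt_eqF.
(* One quarter comes from the links near the top, one from all the others. The half compensates the
   2 of the rate difference, leaving [alpha * K], a lower bound of all birth rates. *)
have sum_le : \sum_j (weighted s e (up (x j)) - weighted s e (x j)) <=
    n%:R * (top_step K s e / 2).
  apply: (@le_trans _ _ (\sum_j (top_step K s e * v (x j) + top_step K s e / 4))).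
    by apply: ler_sum => j _; apply: weighted_step_le.
  rewrite big_split/= -mulr_sumr sumr_const card_ord -mulr_natl -/(load v x).
  move: xt; rewrite -ltNge => /ltW /(ler_wpM2l (ltW w0)); lra.
have abs_le : `|1 - full_prop R x - full_prop R y| <= 1.
  have /andP[? ?] := full_prop01 R x; have /andP[? ?] := full_prop01 R y.
  by rewrite ler_norml; apply/andP; split; lra.
have sum_ge0 : 0 <= \sum_j (weighted s e (up (x j)) - weighted s e (x j)).
  apply: sumr_ge0 => j _; rewrite subr_ge0.
  exact/(weighted_increasing s1 e0)/le_up.
have aK : 0 <= 2 * alpha * K%:R by rewrite !mulr_ge0// ltW.
apply: (@le_trans _ _ (2 * alpha * K%:R * 1 * (n%:R * (top_step K s e / 2)))).
  apply: ler_pM => //; first exact: mulr_ge0.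
  exact: ler_wpM2l.
have -> : 2 * alpha * K%:R * 1 * (n%:R * (top_step K s e / 2)) =
  n%:R * (alpha * K%:R * top_step K s e) by field.
rewrite ler_wpM2l// ler_wpM2r ?(ltW w0)//.
by have /andP[] := dar_lam_bounds y (ltW alpha_gt0).
Qed.

End Subcritical.

(** * Wells: product equilibria, escape and stationary mass *)

Section Metastability.
Variables (R : realType) (K n : nat).
Notation state := (state K n).
Implicit Types (x y : state) (lam : state -> R).

Lemma sum_prodf (f g : 'I_K.+1 -> R) :
  \sum_(x : state) prodf f x * prodf g x = (\sum_k f k * g k) ^+ n.
Proof.
rewrite -[X in _ ^+ X]card_ord -prodr_const bigA_distr_bigA/=.
by apply: eq_bigr => x _; rewrite /prodf -big_split.
Qed.

Definition erlang_product (l : R) : state -> R := prodf (fun k => erlang K l k).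

Lemma erlang_product_ge0 l x : 0 < l -> 0 <= erlang_product l x.
Proof. by move=> l0; apply: prodr_ge0 => j _; exact: erlang_ge0. Qed.

Lemma sum_erlang_product l : 0 < l -> \sum_x erlang_product l x = 1.
Proof.
move=> l0; transitivity (\sum_x erlang_product l x * prodf (fun=> 1) x).
  by apply: eq_bigr => x _; rewrite [X in _ * X]big1 ?mulr1.
by rewrite sum_prodf; under eq_bigr do rewrite mulr1; rewrite sum_erlang// expr1n.
Qed.

(** The one-sided bound on [lam] is global, so the comparison is free of error at all times. The
    rate [l] of the start may differ from the rate [l'] of the comparison. *)
Lemma equilibrium_load lam (l l' eta sgn m a s : R) (v : 'I_K.+1 -> R) :
  0 < l -> 0 <= l' -> 0 <= eta -> eta <= 1 -> (forall k, 0 <= v k <= 1) ->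
  sgn * sgn = 1 -> increasing (fun k => sgn * v k) -> (forall x, 0 <= lam x) ->
  (forall x, sgn * (lam x - l') <= 0) -> (forall r, 0 <= r ->
    \sum_(k < K.+1) erlang K l k * relaxed l' v r k <= m) -> 0 <= s ->
  \sum_x erlang_product l x *
    sg (chain lam) s (fun y => (a * n%:R <= load v y)%R%:R) x <=
  expR (- ((eta - eta * eta) * a * n%:R)) * expR (eta * m * n%:R).
Proof.
move=> l0 l'0 eta0 eta1 v01 sgn2 sgn_v lam0 lam_l' relm s0.
have nu0 x : 0 <= erlang_product l x by exact: erlang_product_ge0.
apply: (le_trans (@sg_load_ge R K n l' eta v l'0 eta0 eta1 v01 lam _ s a lam0 nu0 s0)).
rewrite ler_wpM2l ?expR_ge0//.
pose B := \sum_x `|lam x - l'|.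
have lamB x : `|lam x - l'| <= B by rewrite /B (bigD1 x)//= lerDl sumr_ge0.
have lin := linear_op_chain lam.
have never r : 0 <= r -> r <= s ->
    \sum_x erlang_product l x * sg (chain lam) r (fun y => (~~ predT y)%:R) x <= 0.
  move=> r0 _; rewrite big1// => x _.
  by rewrite (_ : (fun _ => _) = fun=> 0) ?(linear_op0 (linear_op_sg lin r)) ?mulr0.
have := @tilted_comparison R K n l' eta sgn v l'0 eta0 eta1 v01 sgn2 sgn_v lam predT B s 0
  (erlang_product l) lam0 (fun x _ => lam_l' x) lamB s0 nu0 never.
rewrite !mulr0 addr0 => h; apply: (le_trans h).
rewrite sum_prodf expRM_natr; apply: lerXn2r; rewrite ?nnegrE ?expR_ge0//.
  apply: sumr_ge0 => k _; rewrite mulr_ge0 ?erlang_ge0//.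
  by rewrite (le_trans ler01)// tilted_factor_ge1.
apply: le_trans (expR_ge1Dx _); under eq_bigr do rewrite mulrDr mulr1 mulrCA.
by rewrite big_split/= sum_erlang// -mulr_sumr lerD2l ler_wpM2l// relm.
Qed.

Variable alpha : R.
Hypothesis alpha_gt0 : 0 < alpha.

(* Duhamel: the two semigroups differ by the time the truncated chain spends
   outside [G]. *)
Lemma escape_bound lam (G : pred state) (nu : state -> R) (B q t : R) :
  (forall x, 0 <= lam x) -> (forall x, `|dar_lam alpha x - lam x| <= B) ->
  (forall x, G x -> lam x = dar_lam alpha x) -> (forall x, 0 <= nu x) ->
  (forall s, 0 <= s -> \sum_x nu x * sg (chain lam) s (fun y => (~~ G y)%:R) x <= q) ->
  0 <= t ->
  \sum_x nu x * sg (@dar R K alpha n) t (fun y => (~~ G y)%:R) x <=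
  q * (1 + t * (n%:R * B)).
Proof.
move=> lam0 lamB lamG nu0 escape t0.
pose f y : R := (~~ G y)%:R.
have lin := linear_op_chain lam; have [c pos] := chain_shift_ge0 lam0.
have linD := @linear_op_dar R K alpha n; have [d posD] := dar_pos K alpha_gt0 n.
pose g s y := sg (@dar R K alpha n) s f y.
have g01 s y : 0 <= s -> 0 <= g s y <= 1.
  move=> s0; apply/andP; split.
    by apply: (sg_ge0 linD posD _ s0) => z; rewrite /f; case: (~~ _).
  rewrite -(sg_const linD (1 : R) y s0 (@chain1 R K n _)).
  by apply: (le_sg linD posD _ s0) => z; rewrite /f; case: (~~ _).
have B0 : 0 <= B by apply: le_trans (lamB [ffun=> ord0]); exact: normr_ge0.
(* The sign turns the comparison into an upper bound of the original evolution by the truncated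
   one. *)
pose u (s : R) y := -1 * g s y.
pose u' (s : R) y := -1 * @dar R K alpha n (g s) y.
have drift s y : 0 <= s -> chain lam (u s) y - u' s y <= n%:R * B * f y.
  move=> s0; rewrite /u (linear_opZ lin) /u' !mulN1r opprK addrC /dar !chainE -sumrB.
  rewrite (eq_bigr (fun j => (dar_lam alpha y - lam y) * (g s (upd y j (up (y j))) - g s y))); last first.
    by move=> j _; ring.
  rewrite /f; have [Gy|_] := boolP (G y); rewrite ?mulr0 ?mulr1.
    by rewrite big1// => j _; rewrite lamG// subrr mul0r.
  rewrite mulr_natl -[X in _ *+ X]card_ord -sumr_const; apply: ler_sum => j _.
  rewrite (le_trans (ler_norm _))// normrM -[B]mulr1; apply: ler_pM => //.
  have /andP[? ?] := g01 s (upd y j (up (y j))) s0; have /andP[? ?] := g01 s y s0.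
  by rewrite ler_norml; apply/andP; split; lra.
have du s x : 0 <= s -> s <= t -> is_derive s 1 (fun r => u r x) (u' s x).
  by move=> _ _; exact/is_derive_scale/is_derive_sg'.
have := @sg_super R _ _ lin nu u u' t (n%:R * B * q) t0 du.
have step s : 0 <= s -> s <= t ->
    \sum_x nu x * sg (chain lam) (t - s) (fun y => chain lam (u s) y - u' s y) x
    <= n%:R * B * q.
  move=> s0 st; have ts0 : 0 <= t - s by rewrite subr_ge0.
  apply: (@le_trans _ _ (n%:R * B * \sum_x nu x * sg (chain lam) (t - s) f x)).
    rewrite mulr_sumr; apply: ler_sum => x _; rewrite mulrCA ler_wpM2l//.
    rewrite -(linear_opZ (linear_op_sg lin _)).
    by apply: (le_sg lin pos _ ts0) => y; exact: drift.
  by apply: ler_wpM2l; [exact: mulr_ge0|exact: escape].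
move=> /(_ step).
have u0E x : sg (chain lam) t (u 0) x = -1 * sg (chain lam) t f x.
  rewrite -(linear_opZ (linear_op_sg lin t)); congr (sg _ _ _ x).
  by apply/funext => y; rewrite /u /g sg0.
under eq_bigr do rewrite u0E mulrCA; rewrite -mulr_sumr.
under [X in _ <= X + _]eq_bigr do rewrite /u mulrCA; rewrite -mulr_sumr.
have := escape t t0; rewrite -/f -/(g t).
by move: (\sum_x _ * sg _ _ _ _) => X; lra.
Qed.

(** If the chain is mixed at time [t], the stationary law inherits the mass that the chain still has
    in the well. *)
Lemma well_stationary (G : pred state) (nu : state -> R) (eps d t : R) :
  0 <= t -> (forall x, 0 <= nu x) -> \sum_x nu x = 1 ->
  \sum_x nu x * sg (@dar R K alpha n) t (fun y => (~~ G y)%:R) x <= d ->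
  \big[Num.max/0]_x tv_dist (law (@dar_rate R alpha K n) x t)
     (stationary (@dar_rate R alpha K n)) <= eps ->
  1 - d - eps <= \sum_(x | G x) stationary (@dar_rate R alpha K n) x.
Proof.
move=> t0 nu0 nu1 escape mixed; set pi := stationary _ in mixed *.
have linD := @linear_op_dar R K alpha n.
have pointwise x : sg (@dar R K alpha n) t (fun y => (G y)%:R) x
    - \sum_(x | G x) pi x <= eps.
  rewrite (le_trans _ mixed)// (le_trans _ (le_bigmax_term _ x))//.
  rewrite (le_trans _ (le_bigmax_term _ [set y | G y]%SET))//.
  rewrite sum_law_set (le_trans (ler_norm _))//.
  rewrite (_ : (fun y => (y \in [set y | G y]%SET)%:R) = (fun y => (G y)%:R)); last first.
    by apply/funext => y; rewrite inE.
  have -> : \sum_(y in [set y | G y]%SET) pi y = \sum_(y | G y) pi y.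
    by apply: eq_bigl => y; rewrite inE.
  by [].
have split_mass x : sg (@dar R K alpha n) t (fun y => (~~ G y)%:R) x =
    1 - sg (@dar R K alpha n) t (fun y => (G y)%:R) x.
  have := linear_op_sg linD t (-1) (fun y => (G y)%:R) (fun=> 1) x.
  rewrite (sg_const linD (1 : R) x t0 (@chain1 R K n _)) mulN1r addrC => <-.
  congr (sg _ _ _ x); apply/funext => y.
  by case: (G y); rewrite ?mulr1 ?mulr0 ?addNr ?add0r.
have : \sum_x nu x * (sg (@dar R K alpha n) t (fun y => (G y)%:R) x
    - \sum_(x | G x) pi x) <= \sum_x nu x * eps.
  by apply: ler_sum => x _; rewrite ler_wpM2l.
rewrite -mulr_suml nu1 mul1r; under eq_bigr do rewrite mulrBr.
rewrite sumrB -mulr_suml nu1 mul1r.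
move: escape; under eq_bigr do rewrite split_mass mulrBr mulr1.
rewrite sumrB nu1; lra.
Qed.

End Metastability.

(** * Slow mixing between the two wells *)

Section Slow.
Variables (R : realType) (alpha : R).
Hypotheses (alpha_gt : alpha_c R < alpha) (alpha_lt1 : alpha < 1).

Let alpha_gt0 : 0 < alpha.
Proof. by have /andP[] := alpha_c_bounds R => h _; exact: lt_trans alpha_gt. Qed.

Let phi0 : R := phi_c R.
(** [1 / 15] separates this well from [phi_c >= 2 / 15]; the other bound makes [lam1 < 1], so that
    blocking vanishes at rate [lam1]. *)
Let phi1 : R := Num.min (1 / 15) ((1 - alpha) / (4 * alpha)).
Let lam0 : R := rate_at alpha phi0.
Let lam1 : R := rate_at alpha phi1.
Let lam2 : R := 3 / 2 * alpha.

Let phi1_bounds : 0 < phi1 <= 1 / 15.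
Proof.
rewrite ge_min lexx lt_min divr_gt0//= divr_gt0 ?subr_gt0//.
exact: mulr_gt0.
Qed.

Let lam1_bounds : 0 < lam1 < 1.
Proof.
have /andP[b0 b1] := phi1_bounds.
have : 4 * (alpha * phi1) <= 1 - alpha.
  have -> : 4 * (alpha * phi1) = phi1 * (4 * alpha) by ring.
  by rewrite -ler_pdivlMr ?mulr_gt0// ge_min lexx orbT.
have : 0 <= alpha * (phi1 * phi1) by rewrite !mulr_ge0 ?ltW.
have : alpha <= lam1 by apply: rate_at_ge => //; lra.
rewrite /lam1 /rate_at; move: alpha_gt0 alpha_lt1 => *.
by apply/andP; split; lra.
Qed.

Let lam0_gt0 : 0 < lam0.
Proof.
have /andP[? ?] := phi_c_bounds R.
by apply: lt_le_trans (rate_at_ge alpha_gt0 _ _) => //; rewrite /phi0; lra.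
Qed.

Let lam2_gt0 : 0 < lam2. Proof. by rewrite mulr_gt0. Qed.

(** Independent links at the rate of the lower edge [phi0] have blocking at least [1 - lam0^-1];
    this exceeds [phi0] because [alpha > alpha_c]. *)
Let delta : R := 1 - phi0 - lam0^-1.

Let delta_gt0 : 0 < delta.
Proof.
have /andP[? ?] := phi_c_bounds R; have /andP[ac0 _] := alpha_c_bounds R.
rewrite /delta subr_gt0 -[ltLHS]mul1r ltr_pdivrMr// -[ltLHS](alpha_c_phi_c R).
have -> : (1 - phi0) * lam0 =
   alpha * ((1 + 2 * phi0 * (1 - phi0)) * (1 - phi0)) by rewrite /lam0 /rate_at; ring.
rewrite /phi0 ltr_pM2r// mulr_gt0; [by []| |by lra].
have : 0 <= phi_c R * (1 - phi_c R) by rewrite mulr_ge0; lra.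
by lra.
Qed.

(** Values of [(eta - eta^2) a - eta m], or lower bounds of it, at the three edges: [eta = 1 / 4] at
    the top of the low well, [eta = delta / 2] at the bottom of the high one, [eta = 1 / 4] at its
    top. *)
Let kappa : R := Num.min (phi1 / 16) (Num.min (delta * delta / 4) (1 / 32)).

Let kappa_gt0 : 0 < kappa.
Proof.
have /andP[? _] := phi1_bounds.
by rewrite !lt_min !divr_gt0// mulr_gt0.
Qed.

Section FixedK.
Variable K : nat.
Hypotheses (K_gt0 : (0 < K)%N) (erl1 : erlang K (lam1 * K%:R) K < phi1 / 2)
  (erl2 : erlang K (lam2 * K%:R) K < 1 / 2).

Let Kr : 0 < K%:R :> R. Proof. by rewrite ltr0n. Qed.

Lemma well_bound n (lam : state K n -> R) (G : pred (state K n)) (l t : R) :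
  (0 < n)%N -> 0 < l -> (forall x, 0 <= lam x <= lam2 * K%:R) ->
  (forall x, G x -> lam x = dar_lam alpha x) ->
  (forall s, 0 <= s -> \sum_x erlang_product l x *
     sg (chain lam) s (fun y => (~~ G y)%:R) x <= 2 * expR (- (kappa * n%:R))) ->
  0 <= t -> \sum_x erlang_product l x *
    sg (@dar R K alpha n) t (fun y => (~~ G y)%:R) x <=
  2 * expR (- (kappa * n%:R)) * (1 + t * (n%:R * (lam2 * K%:R))).
Proof.
move=> n0 l0 lamb lamG esc t0.
apply: (@escape_bound R K n alpha alpha_gt0 lam G) => //.
- by move=> x; have /andP[] := lamb x.
- move=> x; have /andP[? ?] := lamb x.
  have /andP[] := dar_lam_bounds x (ltW alpha_gt0); rewrite -/lam2 => ? ?.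
  have ? : 0 <= alpha * K%:R by rewrite mulr_ge0// ltW.
  by rewrite ler_norml; apply/andP; split; lra.
- by move=> x; exact: erlang_product_ge0.
Qed.

Let dar_lam_le n (x : state K n) : 0 <= dar_lam alpha x <= lam2 * K%:R.
Proof.
by rewrite dar_lam_ge0//; have /andP[_] := dar_lam_bounds x (ltW alpha_gt0).
Qed.

Lemma low_well n t : (0 < n)%N -> 0 <= t ->
  \sum_x erlang_product (lam1 * K%:R) x *
    sg (@dar R K alpha n) t (fun y => (~~ ~~ many_full phi1 y)%:R) x <=
  2 * expR (- (kappa * n%:R)) * (1 + t * (n%:R * (lam2 * K%:R))).
Proof.
move=> n0 t0; have /andP[l10 l11] := lam1_bounds; have /andP[p0 p1] := phi1_bounds.
have l0 : 0 < lam1 * K%:R by exact: mulr_gt0.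
pose lam (x : state K n) := Num.min (dar_lam alpha x) (lam1 * K%:R).
have lam_ge0 x : 0 <= lam x by rewrite le_min (ltW l0) dar_lam_ge0.
apply: (@well_bound n lam) => //.
- move=> x; rewrite lam_ge0 ge_min; apply/orP; left.
  by have /andP[] := dar_lam_le x.
- move=> x /many_fullN [_ /ltW fx]; apply/min_idPl; rewrite dar_lamE ler_pM2r//.
  by apply: rate_at_homo => //; lra.
move=> s s0.
have := @equilibrium_load R K n lam (lam1 * K%:R) (lam1 * K%:R) (1 / 4) 1 (phi1 / 2)
  phi1 s (@is_full R K) l0 (ltW l0).
have -> : (fun y => (~~ ~~ @many_full R K phi1 n y)%:R) =
   (fun y => (phi1 * n%:R <= load (@is_full R K) y)%R%:R) :> (state K n -> R).
  by apply/funext => y; rewrite negbK.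
move=> h; apply: le_trans (h _ _ _ _ _ _ _ _ s0) _; try lra.
- exact: is_full01.
- by move=> k p kp; rewrite !mul1r is_full_increasing.
- exact: lam_ge0.
- by move=> x; rewrite mul1r subr_le0 ge_min lexx orbT.
- by move=> r r0; rewrite /relaxed sum_erlang_sg sum_erlang_full ltW.
rewrite -expRD -[leLHS]mul1r; apply: ler_pM; [by lra|exact: expR_ge0|by lra|].
rewrite ler_expR; have : kappa * n%:R <= phi1 / 16 * n%:R.
  by rewrite ler_wpM2r// ge_min lexx.
by lra.
Qed.

(** The rate is symmetric about [1 / 2], so it stays above its value at [phi0] up to
    [1 - phi0 >= 5 / 6]. The upper edge is guarded by the overall bound [lam2], whose blocking is
    below [1 / 2]. *)
Lemma high_well n t : (0 < n)%N -> 0 <= t ->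
  \sum_x erlang_product (lam0 * K%:R) x *
    sg (@dar R K alpha n) t
      (fun y => (~~ (~~ few_full phi0 y && ~~ many_full (5 / 6 : R) y))%:R) x <=
  2 * expR (- (kappa * n%:R)) * (1 + t * (n%:R * (lam2 * K%:R))).
Proof.
move=> n0 t0; have /andP[p0 p1] := phi_c_bounds R.
have l0 : 0 < lam0 * K%:R by exact: mulr_gt0.
have l2 : 0 < lam2 * K%:R by exact: mulr_gt0.
have lam02 : lam0 * K%:R <= lam2 * K%:R by rewrite ler_pM2r//; exact: rate_at_le.
pose lam (x : state K n) := Num.max (dar_lam alpha x) (lam0 * K%:R).
have lam_ge0 x : 0 <= lam x by rewrite le_max dar_lam_ge0.
have lam_le x : lam x <= lam2 * K%:R.
  by rewrite ge_max lam02 andbT; have /andP[] := dar_lam_le x.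
apply: (@well_bound n lam) => //.
- by move=> x; rewrite lam_ge0 lam_le.
- move=> x /andP[/few_fullN [_ /ltW fx] /many_fullN [_ /ltW fx']].
  apply/max_idPl; rewrite dar_lamE ler_pM2r//.
  by apply: rate_at_homo => //; rewrite /phi0; lra.
move=> s s0.
have low := @equilibrium_load R K n lam (lam0 * K%:R) (lam0 * K%:R) (delta / 2) (-1)
  (lam0^-1) (1 - phi0) s (fun k => 1 - is_full R k) l0 (ltW l0).
have high := @equilibrium_load R K n lam (lam0 * K%:R) (lam2 * K%:R) (1 / 4) 1
  (1 / 2) (5 / 6) s (@is_full R K) l0 (ltW l2).
have lin := linear_op_chain lam; have [c pos] := chain_shift_ge0 lam_ge0.
apply: (@le_trans _ _ (\sum_x erlang_product (lam0 * K%:R) x *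
    sg (chain lam) s (fun y => (few_full phi0 y)%:R) x +
  \sum_x erlang_product (lam0 * K%:R) x *
    sg (chain lam) s (fun y => (many_full (5 / 6 : R) y)%:R) x)).
  rewrite -big_split/=; apply: ler_sum => x _; rewrite -mulrDr.
  rewrite ler_wpM2l ?erlang_product_ge0//.
  rewrite -[X in _ <= X + _]mul1r -(linear_op_sg lin s).
  apply: (le_sg lin pos _ s0) => y; rewrite mul1r -natrD ler_nat.
  by case: (few_full _ y); case: (many_full _ y).
rewrite [2 * _]mulr_natl mulr2n; apply: lerD.
  have inv0 : 0 < lam0^-1 by rewrite invr_gt0.
  have d1 : delta <= 1 by rewrite /delta /phi0; lra.
  apply: le_trans (low _ _ _ _ _ _ _ _ s0) _.
  - by rewrite divr_ge0// ltW.
  - by lra.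
  - by move=> k; have /andP[] := is_full01 R k; lra.
  - by rewrite mulrNN mulr1.
  - by move=> k p kp; have := @is_full_increasing R K k p kp; lra.
  - exact: lam_ge0.
  - by move=> x; rewrite mulN1r oppr_le0 subr_ge0 le_max lexx orbT.
  - move=> r r0; rewrite /relaxed sum_erlang_sg.
    under eq_bigr do rewrite mulrBr mulr1.
    rewrite sumrB sum_erlang// sum_erlang_full; have := erlang_full_ge K l0.
    have -> : K%:R / (lam0 * K%:R) = lam0^-1 by field; rewrite !gt_eqF.
    by lra.
  rewrite -expRD ler_expR.
  have : kappa * n%:R <= delta * delta / 4 * n%:R.
    by rewrite ler_wpM2r// !ge_min lexx orbT.
  have : 0 <= delta * delta * phi0 * n%:R.
    have f0 : 0 <= phi0 by rewrite /phi0; lra.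
    have d0 := ltW delta_gt0.
    exact: mulr_ge0 (mulr_ge0 (mulr_ge0 d0 d0) f0) (ler0n _ n).
  have : lam0^-1 = 1 - phi0 - delta by rewrite /delta; ring.
  by move=> ->; move: delta phi0 => d f; lra.
apply: le_trans (high _ _ _ _ _ _ _ _ s0) _; try lra.
- exact: is_full01.
- by move=> k p kp; rewrite !mul1r is_full_increasing.
- exact: lam_ge0.
- by move=> x; rewrite mul1r subr_le0.
- move=> r r0; have full_inc := @is_full_increasing R K.
  (* The start is stationary for [lam0] but the evolution has rate [lam2]; the larger stationary law
     replaces the start. *)
  apply: le_trans (erlang_monotone l0 lam02 (increasing_sg_link (ltW l2) r0 full_inc)) _.
  by rewrite sum_erlang_sg sum_erlang_full ltW.
rewrite -expRD ler_expR.
have : kappa * n%:R <= 1 / 32 * n%:R by rewrite ler_wpM2r// !ge_min lexx !orbT.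
by lra.
Qed.

Lemma tmix_ge (eps : R) : eps < 1 / 2 -> exists n0 : nat, forall n, (1 <= n)%N ->
  (n0 <= n)%N -> ((expR (kappa / 2 * n%:R))%:E <= tmix alpha K n eps)%E.
Proof.
move=> eps_lt; have k4 : 0 < kappa / 4 by rewrite divr_gt0.
have d0 : 0 < 1 / 2 - eps by rewrite subr_gt0.
have [N1 hN1] := @expR_dominates_linear R (lam2 * K%:R) (kappa / 4) k4.
have [N2 hN2] := @expR_dominates_linear R (2 / (1 / 2 - eps)) (kappa / 4) k4.
exists (maxn N1 N2) => n n1; rewrite geq_max => /andP[N1n N2n].
have n1r : 1 <= n%:R :> R by rewrite ler1n.
apply: le_ereal_inf_tmp => _ [t [t0 mixed] <-]; rewrite lee_fin leNgt.
apply/negP => t_lt.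
pose d := 2 * expR (- (kappa * n%:R)) * (1 + t * (n%:R * (lam2 * K%:R))).
have lK0 : 0 <= lam2 * K%:R by rewrite mulr_ge0// ltW.
have d_lt : d < 1 / 2 - eps.
  (* The four factors of [expR (kappa * n)]: two bound [t], one the linear factor, and the last
     makes [d] small. *)
  set E := expR (kappa / 4 * n%:R) in hN1 hN2.
  have E_lin : 1 + lam2 * K%:R * n%:R <= E by exact: hN1.
  have E_big : 1 + 2 / (1 / 2 - eps) * n%:R <= E by exact: hN2.
  have E0 : 0 < E by exact: expR_gt0.
  have kE : expR (- (kappa * n%:R)) * (E * E * E * E) = 1.
    rewrite /E -!expRD [X in expR X](_ : _ = 0) ?expR0//.
    by field.
  have tE : t <= E * E.
    rewrite (le_trans (ltW t_lt))// /E -expRD ler_expR le_eqVlt; apply/orP; left.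
    by apply/eqP; field.
  have factor_le : 1 + t * (n%:R * (lam2 * K%:R)) <= E * E * E.
    have E1 : 1 <= E * E.
      have : 0 <= lam2 * K%:R * n%:R by rewrite mulr_ge0.
      by move=> h; apply: mulr_ege1; lra.
    have : t * (n%:R * (lam2 * K%:R)) <= E * E * (lam2 * K%:R * n%:R).
      rewrite [n%:R * _]mulrC; apply: ler_wpM2r => //; exact: mulr_ge0.
    have : E * E * (1 + lam2 * K%:R * n%:R) <= E * E * E.
      by rewrite ler_wpM2l// mulr_ge0// ltW.
    by lra.
  have d_le : d * E <= 2.
    have -> : 2 = 2 * (expR (- (kappa * n%:R)) * (E * E * E * E)) :> R by rewrite kE mulr1.
    have -> : 2 * (expR (- (kappa * n%:R)) * (E * E * E * E)) =
      2 * expR (- (kappa * n%:R)) * (E * E * E) * E by ring.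
    rewrite ler_pM2r// ler_wpM2l// mulr_ge0// expR_ge0//.
  rewrite -(ltr_pM2r E0) (le_lt_trans d_le)//.
  have : (1 / 2 - eps) * (1 + 2 / (1 / 2 - eps) * n%:R) <= (1 / 2 - eps) * E.
    by rewrite ler_wpM2l// ltW.
  have -> : (1 / 2 - eps) * (1 + 2 / (1 / 2 - eps) * n%:R) =
    (1 / 2 - eps) + 2 * n%:R.
    by rewrite mulrDr mulr1 mulrA [_ * (2 / _)]mulrCA divff ?mulr1// gt_eqF.
  by lra.
have /andP[p0 p1] := phi_c_bounds R; have /andP[q0 q1] := phi1_bounds.
have /andP[l10 _] := lam1_bounds.
have low := @well_stationary R K n alpha (fun x => ~~ many_full phi1 x)
  (erlang_product (lam1 * K%:R)) eps d t t0
  (fun x => erlang_product_ge0 x (mulr_gt0 l10 Kr))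
  (sum_erlang_product _ _ (mulr_gt0 l10 Kr)) (low_well n1 t0) mixed.
have high := @well_stationary R K n alpha
  (fun x => ~~ few_full phi0 x && ~~ many_full (5 / 6 : R) x)
  (erlang_product (lam0 * K%:R)) eps d t t0
  (fun x => erlang_product_ge0 x (mulr_gt0 lam0_gt0 Kr))
  (sum_erlang_product _ _ (mulr_gt0 lam0_gt0 Kr)) (high_well n1 t0) mixed.
have [pi0 pi1 _] := dar_stationaryP K alpha_gt0 n.
set pi := stationary _ in pi0 pi1 low high.
(* The wells are disjoint because [phi1 < phi0], yet each would have stationary mass above
   [1 / 2]. *)
have : \sum_(x | ~~ many_full phi1 x) pi x +
    \sum_(x | ~~ few_full phi0 x && ~~ many_full (5 / 6 : R) x) pi x <= 1.
  rewrite [X in X + _]big_mkcond [X in _ + X]big_mkcond -big_split/=.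
  rewrite -[leRHS]pi1; apply: ler_sum => x _.
  have [/many_fullN [_ fx]|_] := boolP (~~ many_full phi1 x); last first.
    by rewrite add0r; case: ifP.
  rewrite (_ : _ && _ = false) ?addr0//; apply/negP => /andP[/few_fullN [_ fx'] _].
  have : phi0 < phi1 by exact: lt_trans fx' fx.
  by rewrite /phi0; lra.
by lra.
Qed.

End FixedK.

Theorem slow_mixing : exists c : R, 0 < c /\ forall eps : R, 0 < eps < 1 / 2 ->
  exists K0 : nat, forall K : nat, (1 <= K)%N -> (K0 <= K)%N ->
  exists n0 : nat, forall n : nat, (1 <= n)%N -> (n0 <= n)%N ->
    ((expR (c * n%:R))%:E <= tmix alpha K n eps)%E.
Proof.
exists (kappa / 2); split; first by rewrite divr_gt0.
move=> eps /andP[_ eps_lt].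
have /andP[l10 l11] := lam1_bounds; have /andP[q0 _] := phi1_bounds.
have [K1 erl1] : exists K0 : nat, forall K, (K0 <= K)%N -> (0 < K)%N ->
    erlang K (lam1 * K%:R) K < phi1 / 2.
  apply: erlang_full_lt => //; first exact: divr_gt0.
  apply: (@lt_trans _ _ 0); last exact: divr_gt0.
  by rewrite subr_lt0 invf_gt1.
have [K2 erl2] : exists K0 : nat, forall K, (K0 <= K)%N -> (0 < K)%N ->
    erlang K (lam2 * K%:R) K < 1 / 2.
  apply: erlang_full_lt => //.
  rewrite ltrBlDr -ltrBlDl -[ltRHS]mul1r ltr_pdivlMr// /lam2.
  by move: alpha_lt1; lra.
exists (maxn K1 K2) => K K0; rewrite geq_max => /andP[KK1 KK2].
by apply: tmix_ge => //; [exact: erl1|exact: erl2].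
Qed.

End Slow.

Theorem theorem1 (R : realType) (alpha : R) (alpha_gt0 : 0 < alpha) :
  (alpha < alpha_c R \/ 1 < alpha ->
   exists C : R, forall eps : R, 0 < eps < 1 ->
   exists K0 : nat, forall K : nat, (1 <= K)%N -> (K0 <= K)%N ->
   exists n0 : nat, forall n : nat, (1 <= n)%N -> (n0 <= n)%N ->
     (tmix alpha K n eps <= (C * ln n%:R)%:E)%E) /\
  (alpha_c R < alpha < 1 ->
   exists c : R, 0 < c /\ forall eps : R, 0 < eps < 1 / 2 ->
   exists K0 : nat, forall K : nat, (1 <= K)%N -> (K0 <= K)%N ->
   exists n0 : nat, forall n : nat, (1 <= n)%N -> (n0 <= n)%N ->
     ((expR (c * n%:R))%:E <= tmix alpha K n eps)%E).
Proof.
split=> [[alpha_lt|alpha_gt]|/andP[alpha_gt alpha_lt]].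
- exact: fast_subcritical.
- exact: fast_supercritical.
- exact: slow_mixing.
Qed.
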